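(* Let $\mathsf G$ be a weighted graph with a well. Let $\mathsf F$ be a Hermitian or Euclidean vector bundle over $\mathsf G$. Let $h$ be a connection on $\mathsf F$ and $H$ a potential on $\mathsf F$. Let $\Phi$ have law $\mathbb P^h$, with expectation $\mathbb E^h$. For all vertices $x,y\in\mathsf V\setminus\mathsf W$, the following identity holds in $\mathrm{Hom}(\mathsf F_y,\mathsf F_x)$: $$\mathbb E^h\otimes\int_{\nu_{x,y}}\Big[e^{-\frac12(\Phi,H\Phi)_{\Omega^0}}\,\mathrm{hol}_{h,H}(\gamma^{-1})\Big]=\mathbb E^h\Big[e^{-\frac12(\Phi,H\Phi)_{\Omega^0}}\,\Phi_x\otimes\overline{\Phi_y}\Big],$$ where $\int_{\nu_{x,y}}$ denotes integration over $\gamma$ with respect to the finite measure $\nu_{x,y}$.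
   Context: Graphs. A graph $\mathsf G$ consists of non-empty finite sets $\mathsf V$ (vertices) and $\mathsf E$ (oriented edges), maps $s,t:\mathsf E\to\mathsf V$ and a fixed-point free involution $i$ of $\mathsf E$ with $t\circ i=s$; write $\underline e=s(e)$, $\overline e=t(e)$, $e^{-1}=i(e)$ (multiple edges and loop edges are allowed). A weighted graph with a well is a connected graph with a non-empty proper subset $\mathsf W\subset \mathsf V$ (the well; elements of $\mathsf V\setminus\mathsf W$ are the proper vertices) and a function $\chi:\mathsf E\to(0,\infty)$ with $\chi_{e^{-1}}=\chi_e$. Set $\lambda_x=\sum_{e:\underline e=x}\chi_e$ and $P_{x,e}=\chi_e/\lambda_x$ when $\underline e=x$. Paths. A discrete path is $(x_0,e_1,x_1,\dots,e_n,x_n)$, $n\ge0$, with $\underline{e_k}=x_{k-1}$, $\overline{e_k}=x_k$. A continuous path is $\gamma=((x_0,\tau_0),e_1,(x_1,\tau_1),\dots,e_n,(x_n,\tau_n))$ with $(x_0,e_1,\dots,x_n)$ a discrete path, $\tau_0,\dots,\tau_{n-1}\in(0,\infty)$, $\tau_n\in(0,\infty]$. $\mathsf P(\mathsf G)$ is the set of continuous paths with its natural $\sigma$-field. For $0\le t<|\gamma|=\sum_k\tau_k$, $\gamma_t=x_k$ if $\tau_0+\dots+\tau_{k-1}\le t<\tau_0+\dots+\tau_k$, and for $0<t<|\gamma|$, $\gamma_{|[0,t)}=((x_0,\tau_0),e_1,\dots,e_k,(x_k,t-(\tau_0+\dots+\tau_{k-1})))$ with the same $k$. If $|\gamma|<\infty$,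 $\gamma^{-1}=((x_n,\tau_n),e_n^{-1},\dots,e_1^{-1},(x_0,\tau_0))$. Random walk. For $x\in\mathsf V$, $\mathbb P_x$ is the law on $\mathsf P(\mathsf G)$ of the path obtained as follows: start at $x_0=x$; from a proper vertex $x_k$ choose an edge $e_{k+1}$ issued from $x_k$ with probability $P_{x_k,e_{k+1}}$ and move to $\overline{e_{k+1}}$; stop at the first vertex in $\mathsf W$; holding times at the proper vertices visited are independent exponential variables of parameter $1$, and the last holding time (in the well) is $+\infty$. For proper $x,y$, $\int F\,d\nu_{x,y}=\int\int_0^\infty F(\gamma_{|[0,t)})\mathbf 1_{\{\gamma_t=y\}}\frac1{\lambda_y}\,dt\,d\mathbb P_x(\gamma)$; this is a finite measure. Bundles. A Euclidean (resp. Hermitian) vector bundle of rank $r$ is a collection of $r$-dimensional Euclidean (resp. Hermitian) spaces $\mathsf F_x$ ($x\in\mathsf V$), $\mathsf F_e=\mathsf F_{e^{-1}}$ ($e\in\mathsf E$). Hermitian products are linear in the second variable. A connection $h$ consists, for every edge $e$, of orthogonal (resp. unitary) isomorphisms $h_{e,\underline e}:\mathsf F_{\underline e}\to\mathsf F_e$ and $h_{\overline e,e}:\mathsf F_e\to\mathsf F_{\overline e}$ with $h_{\underline e,e^{-1}}=h_{e,\underline e}^{-1}$; set $h_e=h_{\overline e,e}\circ h_{e,\underline e}$. A potential $H$ is a family of symmetric (resp. Hermitian) operators $H_x\in\mathrm{End}(\mathsf F_x)$, $x\in\mathsf V$, with $H_x=0$ for $x\in\mathsf W$. For a continuous path $\gamma=((x_0,\tau_0),e_1,(x_1,\tau_1),\dots,e_n,(x_n,\tau_n))$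 with $\tau_n<\infty$, $\mathrm{hol}_{h,H}(\gamma)=e^{-\tau_nH_{x_n}}\circ h_{e_n}\circ\cdots\circ e^{-\tau_1H_{x_1}}\circ h_{e_1}\circ e^{-\tau_0H_{x_0}}:\mathsf F_{x_0}\to\mathsf F_{x_n}$. Gaussian field. $\Omega^0(\mathsf V\setminus\mathsf W,\mathsf F)$ is the space of sections vanishing on $\mathsf W$, with $(f,g)_{\Omega^0}=\sum_x\lambda_x\langle f(x),g(x)\rangle_x$, and $(Hf)(x)=H_xf(x)$. The Laplacian is $(\Delta_hf)(x)=f(x)-\sum_{e:\underline e=x}P_{x,e}\mathbf 1_{\mathsf V\setminus\mathsf W}(\overline e)h_{e^{-1}}f(\overline e)$, $x\in\mathsf V\setminus\mathsf W$; it is positive definite. $\mathbb P^h$ is the probability measure on $\Omega^0(\mathsf V\setminus\mathsf W,\mathsf F)$ with density proportional to $e^{-\frac12(f,\Delta_hf)_{\Omega^0}}$ with respect to the Lebesgue measure. For $v\in\mathsf F_x,w\in\mathsf F_y$, $v\otimes\overline w\in\mathrm{Hom}(\mathsf F_y,\mathsf F_x)$ is $u\mapsto\langle w,u\rangle_y\,v$.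
   Formalization: In the Hermitian case the left side is multiplied by 2 (the identity as displayed is off by this factor); and, H being arbitrary, the weight e^{-(Φ,HΦ)/2} is assumed P^h-integrable and hol(γ^{-1}) ν_{x,y}-integrable, without which the integrals can diverge. *)

(* Defs.v *)
From HB Require Import structures.
From mathcomp Require Import all_boot all_order all_algebra.
From mathcomp Require Import complex.
From mathcomp Require Import all_classical all_reals all_analysis.
From mathcomp Require Import measurable_realfun.

Set Implicit Arguments.
Unset Strict Implicit.
Unset Printing Implicit Defensive.
Import Order.TTheory GRing.Theory Num.Theory.
Import numFieldNormedType.Exports.
Local Open Scope classical_set_scope.
Local Open Scope ring_scope.

(** * Scalars: Euclidean means K = R, Hermitian means K = R[i] *)

Variant scal_kind := Euclidean | Hermitian.

Definition scal (R : realType) (k : scal_kind) : numFieldType :=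
  match k with Euclidean => R | Hermitian => R[i] end.

(* Index set of the real coordinates of a scalar. *)
Definition scal_coord (k : scal_kind) : finType :=
  match k with Euclidean => unit | Hermitian => bool end.

(* The dimension of K over R. *)
Definition scal_dim (k : scal_kind) : nat := #|scal_coord k|.

Section scalars.
Variable R : realType.

(* In R[i], [false] indexes the real part and [true] the imaginary part. *)
Definition scal_part (k : scal_kind) : scal_coord k -> scal R k -> R :=
  match k with
  | Euclidean => fun _ z => z
  | Hermitian => fun c z => if c then complex.Im z else complex.Re z
  end.

Definition scal_mk (k : scal_kind) : (scal_coord k -> R) -> scal R k :=
  match k with
  | Euclidean => fun a => a tt
  | Hermitian => fun a => Complex (a false) (a true)
  end.

Definition scal_of (k : scal_kind) : R -> scal R k :=
  match k with
  | Euclidean => fun a => a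
  | Hermitian => fun a => Complex a 0
  end.

Definition scal_re (k : scal_kind) : scal R k -> R :=
  match k with
  | Euclidean => fun z => z
  | Hermitian => fun z => complex.Re z
  end.

Definition scal_conj (k : scal_kind) : scal R k -> scal R k :=
  match k with
  | Euclidean => fun z => z
  | Hermitian => fun z => conjc z
  end.

(* [I] is an extended-real valued integral; it is applied coordinatewise. *)
Definition scal_int (k : scal_kind) (T : Type) (I : (T -> \bar R) -> \bar R)
    (f : T -> scal R k) : scal R k :=
  scal_mk (fun c : scal_coord k => fine (I (fun t => (scal_part c (f t))%:E))).

Definition mx_int (k : scal_kind) (T : Type) (I : (T -> \bar R) -> \bar R)
    (m n : nat) (F : T -> 'M[scal R k]_(m, n)) : 'M[scal R k]_(m, n) :=
  \matrix_(i, j) scal_int I (fun t => F t i j).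

(* The exponential series, summed entrywise. *)
Definition expmx (k : scal_kind) (r : nat) (A : 'M[scal R k]_r) :
    'M[scal R k]_r :=
  \matrix_(i, j) scal_mk (fun c : scal_coord k =>
    lim (series (fun n => scal_part c ((n`!%:R^-1 *: A ^+ n) i j)) @ \oo)).

End scalars.

(** * Weighted graphs with a well *)

Record graph := Graph {
  vert : finType;
  edge : finType;
  src : edge -> vert;
  tgt : edge -> vert;
  einv : edge -> edge;
  vert_nonempty : (0 < #|vert|)%N;
  edge_nonempty : (0 < #|edge|)%N;
  einvK : involutive einv;
  einv_neq : forall e, einv e != e;
  tgt_einv : forall e, tgt (einv e) = src e
}.

Definition adj (G : graph) : rel (vert G) :=
  fun x y => [exists e : edge G, (src e == x) && (tgt e == y)].

Record wgraph (R : realType) := WGraph {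
  wgraph_graph :> graph;
  wgraph_connected : forall x y : vert wgraph_graph, connect (@adj _) x y;
  well : {set vert wgraph_graph};
  well_neq0 : well != finset.set0;
  well_neqT : well != [set: vert wgraph_graph]%SET;
  chi : edge wgraph_graph -> R;
  chi_gt0 : forall e, 0 < chi e;
  chi_einv : forall e, chi (einv e) = chi e
}.

Section weights.
Variables (R : realType) (G : wgraph R).

Definition lambda (x : vert G) : R := \sum_(e : edge G | src e == x) chi e.

(* P_{x,e} for x the source of e. *)
Definition jump_prob (e : edge G) : R := chi e / lambda (src e).

End weights.

(** * Continuous paths *)

(* The path ((x_0,t_0),e_1,(x_1,t_1),...,e_n,(x_n,t_n)) is encoded by x_0,
   [:: e_1; ...; e_n] and [:: t_0; ...; t_n]; one has x_k = tgt e_k for k > 0.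
   Triples which do not encode a path are harmless: the law of the random walk
   does not charge them. *)
Definition cpath (R : realType) (G : graph) : Type :=
  (vert G * seq (edge G) * seq (\bar R))%type.

Section cpaths.
Variables (R : realType) (G : wgraph R).
Local Notation cpath := (cpath R G).
Implicit Type g : cpath.

Definition cp_start g : vert G := g.1.1.
Definition cp_edges g : seq (edge G) := g.1.2.
Definition cp_holds g : seq (\bar R) := g.2.

Definition cp_vertices g : seq (vert G) :=
  cp_start g :: [seq tgt e | e <- cp_edges g].

(* t_0 + ... + t_{k-1} *)
Definition cp_jump g (k : nat) : \bar R :=
  (\sum_(j < k) nth 0%E (cp_holds g) j)%E.

(* The k such that t_0 + ... + t_{k-1} <= t < t_0 + ... + t_k. *)
Definition cp_index g (t : R) : nat :=
  find (fun k => (t%:E < cp_jump g k.+1)%E) (iota 0 (size (cp_edges g)).+1).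

Definition cp_at g (t : R) : vert G :=
  nth (cp_start g) (cp_vertices g) (cp_index g t).

Definition cp_restr g (t : R) : cpath :=
  let k := cp_index g t in
  (cp_start g, take k (cp_edges g),
   rcons (take k (cp_holds g)) (t%:E - cp_jump g k)%E).

Definition cp_inv g : cpath :=
  (last (cp_start g) (cp_vertices g),
   rev [seq einv e | e <- cp_edges g], rev (cp_holds g)).

End cpaths.

(* The natural sigma-field of the disjoint union, over the discrete paths, of
   the spaces of holding times. *)
Section cpath_measurable.
Variables (R : realType) (G : graph).
Local Notation cpath := (cpath R G).

Definition cpath_measurable : set (set cpath) :=
  [set A | forall (x : vert G) (es : seq (edge G)) (n : nat),
     measurable [set ts : n.-tuple (\bar R) | A (x, es, val ts)]].

Let cpath_measurable0 : cpath_measurable set0.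
Proof. by move=> x es n; exact: measurable0. Qed.

Let cpath_measurableC A : cpath_measurable A -> cpath_measurable (~` A).
Proof. by move=> mA x es n; exact: (measurableC (mA x es n)). Qed.

Let cpath_measurable_bigcup (F : (set cpath)^nat) :
  (forall i, cpath_measurable (F i)) -> cpath_measurable (\bigcup_i F i).
Proof. by move=> mF x es n; apply: bigcup_measurable => i _; exact: mF. Qed.

HB.instance Definition _ := Choice.on cpath.

Let cpath_point : cpath.
Proof.
suff /card_gt0P/sigW[x _] : (0 < #|vert G|)%N by exact: (x, [::], [::]).
exact: vert_nonempty.
Qed.

HB.instance Definition _ := isPointed.Build cpath cpath_point.
HB.instance Definition _ := @isMeasurable.Build default_measure_display cpath
  cpath_measurable cpath_measurable0 cpath_measurableC cpath_measurable_bigcup.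

End cpath_measurable.

(** * Powers of a measure on the line *)

Section mpow.
Context d (T : measurableType d) (R : realType).
Variable mu : {sigma_finite_measure set T -> \bar R}.

Definition tuple_cons n (p : T * n.-tuple T) : n.+1.-tuple T :=
  [tuple of p.1 :: p.2].

Lemma measurable_tuple_cons n : measurable_fun setT (@tuple_cons n).
Proof. exact: measurable_cons. Qed.

Definition mpow_step n (m : {measure set (n.-tuple T) -> \bar R}) :
    set (n.+1.-tuple T) -> \bar R :=
  pushforward (mu \x^ m)%E (@tuple_cons n).

HB.instance Definition _ n m := Measure.copy (@mpow_step n m)
  (measure_function_pushforward__canonical__measure_function_Measure
     (mu \x^ m)%E (@measurable_tuple_cons n)).

(* The product measure of n copies of mu. *)
Fixpoint mpow (n : nat) : {measure set (n.-tuple T) -> \bar R} :=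
  match n with
  | 0 => \d_([tuple])
  | m.+1 => mpow_step (mpow m)
  end.

End mpow.

Section exponential_law.
Variable R : realType.

(* The exponential law of parameter 1. *)
Definition exp_law : set (measurableTypeR R) -> \bar R := exponential_prob 1.

HB.instance Definition _ := Probability.copy exp_law
  (exponential_distribution_exponential_prob__canonical__probability_measure_Probability
     (@ltr01 R)).

End exponential_law.

(** * The random walk stopped in the well *)

Section walk.
Variables (R : realType) (G : wgraph R).
Local Notation cpath := (cpath R G).

(* (x,es) is a discrete path which ends at its first visit to the well. *)
Fixpoint stopped (x : vert G) (es : seq (edge G)) : bool :=
  match es with
  | [::] => x \in well G
  | e :: es' => [&& x \notin well G, src e == x & stopped (tgt e) es']
  end.

Definition walk_path (x : vert G) (es : seq (edge G)) n
    (ts : n.-tuple (measurableTypeR R)) : cpath :=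
  (x, es, rcons [seq (t : R)%:E | t <- ts] +oo%E).

Lemma measurable_walk_path x es n : measurable_fun setT (@walk_path x es n).
Proof.
move=> _ A mA; rewrite setTI.
pose f (ts : n.-tuple (measurableTypeR R)) : n.+1.-tuple (\bar R) :=
  [tuple of rcons [seq (t : R)%:E | t <- ts] +oo%E].
have mf : measurable_fun setT f.
  apply/measurable_fun_tnthP => i.
  have [ltin|leni] := ltnP i n.
    rewrite (_ : _ \o _ = EFin \o (fun ts => tnth ts (Ordinal ltin))).
      by apply: measurableT_comp => //; exact: measurable_tnth.
    apply/funext => ts /=; rewrite (tnth_nth +oo%E) /= nth_rcons.
    by rewrite size_map size_tuple ltin (nth_map 0) ?size_tuple // (tnth_nth 0).
  rewrite (_ : _ \o _ = cst +oo%E); first exact: measurable_cst.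
  apply/funext => ts /=; rewrite (tnth_nth +oo%E) /= nth_rcons.
  by rewrite size_map size_tuple ltnNge leni /= if_same.
by have := mf measurableT _ (mA x es n.+1); rewrite setTI.
Qed.

(* The law of the path issued from x. The discrete path is es with probability
   the product of the P_{x_{k-1},e_k} and, given this, the holding times before
   the last one are independent with exponential law of parameter 1. *)
Definition walk (x : vert G) (A : set cpath) : \bar R :=
  (\esum_(es in [set es | stopped x es])
     (\prod_(e <- es) jump_prob e)%:E *
     mpow (@exp_law R) (size es) (@walk_path x es (size es) @^-1` A))%E.

Let prob_ge0 (es : seq (edge G)) : 0 <= \prod_(e <- es) jump_prob e.
Proof.
apply: prodr_ge0 => e _; rewrite divr_ge0 ?(ltW (chi_gt0 _)) //.
by apply: sumr_ge0 => e' _; exact: ltW (chi_gt0 _).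
Qed.

Let walk0 x : walk x set0 = 0%E.
Proof.
by rewrite /walk; apply: esum1 => es _; rewrite preimage_set0 measure0 mule0.
Qed.

Let walk_ge0 x A : (0 <= walk x A)%E.
Proof. by apply: esum_ge0 => es _; rewrite mule_ge0 ?lee_fin. Qed.

Let walk_sigma_additive x : semi_sigma_additive (walk x).
Proof.
move=> F mF tF mUF.
suff -> : walk x (\bigcup_i F i) = (\sum_(i <oo) walk x (F i))%E.
  by apply: is_cvg_ereal_nneg_natsum => k _; exact: walk_ge0.
rewrite nneseries_esumT; last by move=> i; exact: walk_ge0.
rewrite /walk esum_esum; last by move=> i es; rewrite mule_ge0 ?lee_fin.
rewrite (reindex_esum ([set es | stopped x es] `*`` (fun=> [set: nat])) _
  (fun p => (p.2, p.1))); last first.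
  split=> [[es i] [/= ? _]|[es i] [es' i'] _ _ [-> ->]|[i es] [_ /= ?]] //.
  by exists (es, i).
transitivity (\esum_(es in [set es | stopped x es]) \esum_(i in [set: nat])
    ((\prod_(e <- es) jump_prob e)%:E *
     mpow (@exp_law R) (size es) (@walk_path x es (size es) @^-1` F i)))%E;
  last by rewrite esum_esum // => es i _ _; rewrite mule_ge0 ?lee_fin.
apply: eq_esum => es _.
rewrite -nneseries_esumT; last by move=> i; rewrite mule_ge0 ?lee_fin.
rewrite nneseriesZl //; congr (_ * _)%E.
rewrite preimage_bigcup measure_semi_bigcup //.
- by move=> i; rewrite -[X in measurable X]setTI; exact: measurable_walk_path.
- apply/trivIsetP => i j _ _ ij; rewrite -preimage_setI.
  by move/trivIsetP : tF => /(_ i j Logic.I Logic.I ij) ->; rewrite preimage_set0.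
- rewrite -preimage_bigcup -[X in measurable X]setTI.
  exact: measurable_walk_path.
Qed.

HB.instance Definition _ x := isMeasure.Build _ _ _ (walk x)
  (walk0 x) (walk_ge0 x) (@walk_sigma_additive x).

(* The integral of F with respect to nu_{x,y}, a measure on paths of finite
   lifetime; under [walk x] the lifetime is infinite, so that [cp_restr g t]
   is meaningful for all t > 0. *)
Definition nu_int (x y : vert G) (F : cpath -> \bar R) : \bar R :=
  (\int[walk x]_g \int[lebesgue_measure]_(t in `]0%R, +oo[)
     (F (cp_restr g t) *
      (if cp_at g t == y then (lambda y)^-1 else 0)%:E))%E.

End walk.

(** * Bundles, connections, potentials *)

(* Inner products on K^r, linear in the second variable. *)
Record inner_product (R : realType) (k : scal_kind) (r : nat) := InnerProduct {
  dot :> 'cV[scal R k]_r -> 'cV[scal R k]_r -> scal R k;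
  dot_linear : forall u (a : scal R k) v w,
    dot u (a *: v + w) = a * dot u v + dot u w;
  dot_conj : forall u v, dot v u = scal_conj (dot u v);
  dot_gt0 : forall u, u != 0 -> 0 < dot u u
}.

(* Every fibre has K^r as underlying vector space, by the choice of a basis,
   and carries its own inner product. *)
Record bundle (R : realType) (G : wgraph R) (k : scal_kind) (r : nat) :=
  Bundle {
    vdot : vert G -> inner_product R k r;
    edot : edge G -> inner_product R k r;
    edot_einv : forall e, edot (einv e) = edot e
  }.

(* [conn_in e] and [conn_out e] are the isomorphisms h_{e,s(e)} from F_{s(e)}
   to F_e and h_{t(e),e} from F_e to F_{t(e)}. *)
Record connection (R : realType) (G : wgraph R) (k : scal_kind) (r : nat)
    (F : bundle G k r) := Connection {
  conn_in : edge G -> 'M[scal R k]_r;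
  conn_out : edge G -> 'M[scal R k]_r;
  conn_in_unit : forall e, conn_in e \in unitmx;
  conn_out_unit : forall e, conn_out e \in unitmx;
  conn_in_isometry : forall e u v,
    edot F e (conn_in e *m u) (conn_in e *m v) = vdot F (src e) u v;
  conn_out_isometry : forall e u v,
    vdot F (tgt e) (conn_out e *m u) (conn_out e *m v) = edot F e u v;
  conn_einv : forall e, conn_out (einv e) = invmx (conn_in e)
}.

Record potential (R : realType) (G : wgraph R) (k : scal_kind) (r : nat)
    (F : bundle G k r) := Potential {
  pot :> vert G -> 'M[scal R k]_r;
  pot_selfadjoint : forall x u v,
    vdot F x (pot x *m u) v = vdot F x u (pot x *m v);
  pot_well : forall x, x \in well G -> pot x = 0
}.

Section holonomy.
Variables (R : realType) (G : wgraph R) (k : scal_kind) (r : nat).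
Variables (F : bundle G k r) (h : connection F) (H : potential F).

Definition transport (e : edge G) : 'M[scal R k]_r :=
  conn_out h e *m conn_in h e.

Fixpoint hol_rec (x : vert G) (es : seq (edge G)) (ts : seq (\bar R)) :
    'M[scal R k]_r :=
  match ts with
  | [::] => 1%:M
  | t :: ts' =>
    let Q := expmx (scal_of k (- fine t) *: H x) in
    match es with
    | [::] => Q
    | e :: es' => hol_rec (tgt e) es' ts' *m transport e *m Q
    end
  end.

Definition hol (g : cpath R G) : 'M[scal R k]_r :=
  hol_rec (cp_start g) (cp_edges g) (cp_holds g).

End holonomy.

(** * The Gaussian field *)

Section sections.
Variables (R : realType) (G : wgraph R) (k : scal_kind) (r : nat).

(* Sections of the bundle over the proper vertices. *)
Definition Omega0 : Type :=
  {ffun {x : vert G | x \notin well G} -> 'cV[scal R k]_r}.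

(* The same, as sections over all vertices which vanish on the well. *)
Definition sec (f : Omega0) (x : vert G) : 'cV[scal R k]_r :=
  if insub x is Some p then f p else 0.

Definition Omega0_coord : finType :=
  ({x : vert G | x \notin well G} * 'I_r * scal_coord k)%type.

Definition Omega0_dim : nat := #|Omega0_coord|.

Definition Omega0_of (a : Omega0_dim.-tuple (measurableTypeR R)) : Omega0 :=
  [ffun p => \col_i scal_mk (fun c : scal_coord k =>
     (tnth a (enum_rank ((p, i, c) : Omega0_coord)) : R))].

Let Omega0_measurable : set (set Omega0) :=
  [set A | measurable (Omega0_of @^-1` A)].

Let Omega0_measurable0 : Omega0_measurable set0.
Proof. exact: measurable0. Qed.

Let Omega0_measurableC A : Omega0_measurable A -> Omega0_measurable (~` A).
Proof. by move=> mA; exact: measurableC. Qed.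

Let Omega0_measurable_bigcup (A : (set Omega0)^nat) :
  (forall i, Omega0_measurable (A i)) -> Omega0_measurable (\bigcup_i A i).
Proof. by move=> mA; apply: bigcup_measurable => i _; exact: mA. Qed.

HB.instance Definition _ := Choice.on Omega0.
HB.instance Definition _ := isPointed.Build Omega0 [ffun=> 0].

(* The Borel sigma-field, transported from the real coordinates. *)
HB.instance Definition _ := @isMeasurable.Build default_measure_display Omega0
  Omega0_measurable Omega0_measurable0 Omega0_measurableC
  Omega0_measurable_bigcup.

Lemma measurable_Omega0_of : measurable_fun setT Omega0_of.
Proof. by move=> _ A mA; rewrite setTI. Qed.

(* The image of the Lebesgue measure on the real coordinates; another choice of
   coordinates would only multiply it by a constant. *)
Definition Omega0_lebesgue : set Omega0 -> \bar R :=
  pushforward (mpow (@lebesgue_measure R) Omega0_dim) Omega0_of.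

HB.instance Definition _ := Measure.copy Omega0_lebesgue
  (measure_function_pushforward__canonical__measure_function_Measure
     (mpow (@lebesgue_measure R) Omega0_dim) measurable_Omega0_of).

End sections.

Section gaussian.
Variables (R : realType) (G : wgraph R) (k : scal_kind) (r : nat).
Variables (F : bundle G k r).
Local Notation Omega0 := (Omega0 G k r).

Definition sec_dot (f g : vert G -> 'cV[scal R k]_r) : scal R k :=
  \sum_(x : vert G) scal_of k (lambda x) * vdot F x (f x) (g x).

Definition pot_sec (H : potential F) (f : vert G -> 'cV[scal R k]_r) :
    vert G -> 'cV[scal R k]_r :=
  fun x => H x *m f x.

Definition laplacian (h : connection F) (f : vert G -> 'cV[scal R k]_r) :
    vert G -> 'cV[scal R k]_r :=
  fun x => if x \in well G then 0 else
    f x - \sum_(e : edge G | src e == x)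
      scal_of k (jump_prob e * (tgt e \notin well G)%:R) *:
        (transport h (einv e) *m f (tgt e)).

(* The scalar products in the exponents below are real, the operators being
   self-adjoint; [scal_re] only changes their type. *)
Definition gauss_weight (h : connection F) (f : Omega0) : R :=
  expR (- (scal_re (sec_dot (sec f) (laplacian h (sec f))) / 2)).

Definition pot_weight (H : potential F) (f : Omega0) : R :=
  expR (- (scal_re (sec_dot (sec f) (pot_sec H (sec f))) / 2)).

(* The probability measure P^h. With this normalisation, the covariance
   f |-> E[(Phi,f) Phi] is [scal_dim k] times the inverse of the Laplacian:
   a complex Gaussian variable with density proportional to e^{-a|z|^2/2} has
   E|z|^2 = 2/a, whereas a real one has E z^2 = 1/a. *)
Definition gauss_law (h : connection F) (A : set Omega0) : \bar R :=
  ((\int[@Omega0_lebesgue R G k r]_(f in A) (gauss_weight h f)%:E) *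
   ((fine (\int[@Omega0_lebesgue R G k r]_f (gauss_weight h f)%:E))^-1)%:E)%E.

(* [tensor y v w] is the matrix of the map which sends u in F_y to
   <w,u>_y v in F_x. *)
Definition tensor (y : vert G) (v w : 'cV[scal R k]_r) : 'M[scal R k]_r :=
  \matrix_(i, j) (vdot F y w (delta_mx j 0) * v i 0).

End gaussian.

(* Main.v *)
Require Import Defs.
From HB Require Import structures.
From mathcomp Require Import all_boot all_order all_algebra.
From mathcomp Require Import complex.
From mathcomp Require Import all_classical all_reals all_analysis.
From mathcomp Require Import measurable_realfun ring lra.
Set Implicit Arguments.
Unset Strict Implicit.
Unset Printing Implicit Defensive.
Import Order.TTheory GRing.Theory Num.Theory.
Import numFieldNormedType.Exports.
Import HBNNSimple.
Local Open Scope classical_set_scope.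
Local Open Scope ring_scope.

(** Let N be the Laplacian plus the potential, acting on the sections which vanish on
    the well, and let B(f, g) be the real part of the scalar product of f and N g,
    a symmetric bilinear form. Both sides are computed by inverting N.

    On the probabilistic side, the density of the field times the weight
    e^{-(f,Hf)/2} is e^{-B(f,f)/2}. Its integrability, which is a hypothesis since
    H need not be positive, forces B to be nondegenerate
    ([gaussian_nondegenerate]), and the weighted covariance of B(Phi, u) and
    B(Phi, v) is B(u, v) times the expectation of the weight
    ([gaussian_covariance]). Both facts rest on the invariance of the Lebesgue
    measure under translations.

    On the side of paths, let G(x) be the integral of the holonomy of the inverse
    path with respect to nu_{x,y}. Splitting a path at its first jump
    ([nu_int_first_step]) shows that G(x) is the integral over s of
    e^{-s} e^{-s H_x} A, where A is the sum of lambda_y^{-1} 1_{x=y} and of the mean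
    over the jumps from x of the transported values of G. As e^{-s(1+H_x)} has
    derivative -(1+H_x) e^{-s(1+H_x)}, this gives (1+H_x) G(x) = A
    ([green_equation]), which says that for every vector u the section G u is
    solution of N (G u) = lambda_y^{-1} delta_y u ([green_sec_equation]).

    Consequently B(f, G u) is the real part of <f(y), u>, and if v represents a
    real-linear form l of the value at x, so that B(f, v) = l(f(x)), then the
    weighted covariance of l(Phi_x) and of the real part of <Phi_y, u> is
    B(v, G u) = l(G(x) u) times the expectation of the weight
    ([field_covariance]). This is the claim, read on real coordinates; in the
    Hermitian case the real part has to be used for u and for i u, which produces
    the dimension of the scalars over the reals as a factor ([tensor_moment]).

    The holonomy is only supposed to be integrable over the paths from x to y.
    Integrability propagates from a proper vertex to its neighbours
    ([summable_neighbor]), hence holds on a whole component of the graph of proper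
    vertices. The section G u is set to be zero on the components where it
    fails; since N preserves the decomposition into components, the argument goes
    through. *)

(** * Densities and products of the Lebesgue measure *)

Section density.
Local Open Scope ereal_scope.
Context d (T : measurableType d) (R : realType).
Variables (m mu : {measure set T -> \bar R}) (g : T -> R).
Hypotheses (mg : measurable_fun setT g) (g0 : forall x, (0 <= g x)%R).
Hypothesis mE : forall A, measurable A -> m A = \int[mu]_(x in A) (g x)%:E.

(** The usual approximation by simple functions: on each level set the identity
    is the hypothesis on the density, and monotone convergence does the rest. *)
Lemma ge0_integral_density (f : T -> \bar R) :
  measurable_fun setT f -> (forall x, 0 <= f x) ->
  \int[m]_x f x = \int[mu]_x (f x * (g x)%:E).
Proof.
move=> mf f0.
pose f_ := nnsfun_approx measurableT mf.
have f_cvg x : (f_ n x)%:E @[n --> \oo] --> f x.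
  by apply: cvg_nnsfun_approx => // y _; exact: f0.
have mg' : measurable_fun setT (fun x => (g x)%:E) by exact/measurable_EFinP.
have mind n r : measurable_fun setT (\1_(f_ n @^-1` [set r]) : T -> R).
  by apply: measurable_indic; exact: measurable_sfunP.
have step n : \int[m]_x (f_ n x)%:E = \int[mu]_x ((f_ n x)%:E * (g x)%:E).
  rewrite integralT_nnsfun sintegralE.
  transitivity (\sum_(x \in range (f_ n))
      \int[mu]_z ((x * \1_(f_ n @^-1` [set x]) z)%:E * (g z)%:E)).
    apply: eq_fsbigr => r /[!inE] -[t _ <-].
    rewrite mE; last exact: measurable_sfunP.
    under [RHS]eq_integral do rewrite EFinM -muleA.
    rewrite ge0_integralZl//; last 3 first.
    - by apply: emeasurable_funM => //; apply/measurable_EFinP.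
    - by move=> x _; rewrite mule_ge0// lee_fin.
    - by rewrite lee_fin.
    congr (_ * _); rewrite integral_mkcond; apply: eq_integral => z _.
    rewrite patchE indicE; case: ifPn => h; by rewrite ?mul1e ?mul0e.
  rewrite -ge0_integral_fsum//; last 2 first.
  - move=> r; apply: emeasurable_funM => //; apply/measurable_EFinP.
    exact: measurable_funM.
  - by move=> r x _; rewrite mule_ge0// ?nnfun_muleindic_ge0 ?lee_fin.
  apply: eq_integral => z _; rewrite -ge0_mule_fsuml; last first.
    by move=> r; exact: nnfun_muleindic_ge0.
  by rewrite fsumEFin// -(fimfunE (f_ n) z).
transitivity (limn (fun n => \int[m]_x (f_ n x)%:E)).
  rewrite -monotone_convergence//.
  - by apply: eq_integral => x _; apply/esym/cvg_lim => //; exact: f_cvg.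
  - by move=> n; exact/measurable_EFinP/measurable_funP.
  - by move=> n x _; rewrite lee_fin.
  - by move=> x _ a b ab; rewrite lee_fin; exact/lefP/nd_nnsfun_approx.
under eq_fun do rewrite step.
rewrite -monotone_convergence//.
- apply: eq_integral => x _; apply/cvg_lim => //.
  exact: cvgeZr.
- by move=> n; apply: emeasurable_funM => //; exact/measurable_EFinP/measurable_funP.
- by move=> n x _; rewrite mule_ge0// lee_fin.
- move=> x _ a b ab; apply: lee_wpmul2r; first by rewrite lee_fin.
  by rewrite lee_fin; exact/lefP/nd_nnsfun_approx.
Qed.

Lemma integral_density (f : T -> R) : measurable_fun setT f ->
  \int[m]_x (f x)%:E = \int[mu]_x (f x * g x)%:E.
Proof.
move=> mf; have mf' : measurable_fun setT (EFin \o f) by exact/measurable_EFinP.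
rewrite [LHS]integralE [RHS]integralE; congr (_ - _).
  rewrite ge0_integral_density//; last exact: measurable_funepos.
  apply: eq_integral => x _; rewrite !funeposE/= -!EFin_max.
  by rewrite -EFinM; congr EFin; rewrite maxr_pMl// mul0r.
rewrite ge0_integral_density//; last exact: measurable_funeneg.
apply: eq_integral => x _; rewrite !funenegE/= -!EFin_max -EFinM.
by congr EFin; rewrite maxr_pMl// mul0r mulNr.
Qed.

Lemma integrable_density (f : T -> R) : measurable_fun setT f ->
  m.-integrable setT (EFin \o f) <->
  mu.-integrable setT (fun x => (f x * g x)%:E).
Proof.
move=> mf.
have e : \int[m]_x `|(f x)%:E| = \int[mu]_x `|(f x * g x)%:E|.
  rewrite ge0_integral_density//; last first.
    by apply: measurableT_comp => //; exact/measurable_EFinP.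
  by apply: eq_integral => x _; rewrite EFinM abseM (gee0_abs (_ : 0 <= (g x)%:E))// lee_fin.
split=> /integrableP[_ h]; apply/integrableP; split.
- by apply/measurable_EFinP; exact: measurable_funM.
- by rewrite -e.
- exact/measurable_EFinP.
- by rewrite e.
Qed.

End density.

(** A measure which is only proved to be sigma-finite has to be renamed before it
    can carry the corresponding structure, on which the theorems of Fubini and
    Tonelli depend. *)
Definition sigma_finite_copy d (T : measurableType d) (R : realType)
    (m : {measure set T -> \bar R}) (h : sigma_finite setT m) :
  set T -> \bar R := Measure.sort m.

Section sigma_finite_copy.
Context d (T : measurableType d) (R : realType).
Variable m : {measure set T -> \bar R}.
Hypothesis h : sigma_finite setT m.
HB.instance Definition _ := isMeasure.Build d T R (sigma_finite_copy h)
  (measure0 m) (measure_ge0 m) (@measure_semi_sigma_additive _ _ _ m).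
HB.instance Definition _ :=
  Measure_isSigmaFinite.Build d T R (sigma_finite_copy h) h.
End sigma_finite_copy.

Section mpow_theory.
Local Open Scope ereal_scope.
Context d (T : measurableType d) (R : realType).
Variable mu : {sigma_finite_measure set T -> \bar R}.

Lemma measurable_tuple_uncons n :
  measurable_fun setT (fun t : n.+1.-tuple T => (thead t, [tuple of behead t])).
Proof.
apply: measurable_fun_pair; last exact: measurable_behead.
exact: measurable_tnth.
Qed.

(** Exhaust the product by the boxes on two increasing exhaustions. *)
Lemma mpow_sigma_finite n : sigma_finite setT (mpow mu n).
Proof.
elim: n => [|n [G TG Goo]] /=.
  exists (fun=> setT); first by rewrite bigcup_const//; exists 0%N.
  by move=> i; split => //; rewrite diracT ltry.
have [F TF Foo] := sigma_finiteT mu.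
have [F' [TF' ndF Foo']] : exists F : (set T)^nat, [/\ setT = \bigcup_i F i,
    {homo F : n m / (n <= m)%N >-> (n <= m)%O} &
    forall i, measurable (F i) /\ mu (F i) < +oo].
  by have /sigma_finiteP[F' []] := sigma_finiteT mu; exists F'.
have /sigma_finiteP[G' [TG' ndG Goo']] : sigma_finite setT (mpow mu n).
  by exists G.
exists (fun i => [set t : n.+1.-tuple T | F' i (thead t) /\ G' i [tuple of behead t]]).
  rewrite predeqE => t; split=> // _.
  have [i _ Fi] : (\bigcup_i F' i) (thead t) by rewrite -TF'.
  have [j _ Gj] : (\bigcup_i G' i) [tuple of behead t] by rewrite -TG'.
  exists (maxn i j) => //; split.
    by move: (thead t) Fi; exact/subsetPset/ndF/leq_maxl.
  by move: [tuple of behead t] Gj; exact/subsetPset/ndG/leq_maxr.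
move=> k; have [mF Fk] := Foo' k; have [mG Gk] := Goo' k; split.
  have := measurable_tuple_uncons measurableT (measurableX mF mG).
  by rewrite setTI.
rewrite [X in X < _](_ : _ = (mu \x^ mpow mu n) (F' k `*` G' k)).
  by rewrite product_measure2E// lte_mul_pinfty// ge0_fin_numE.
rewrite /mpow_step /pushforward; congr (_ _).
apply/seteqP; split => -[a b] /= [].
  rewrite /thead tnth0; split => //.
  by have /= -> : b = [tuple of behead (a :: b)] by exact: val_inj.
rewrite /thead tnth0; split => //.
by have /= <- : b = [tuple of behead (a :: b)] by exact: val_inj.
Qed.

Definition mpow_sf n : {sigma_finite_measure set (n.-tuple T) -> \bar R} :=
  sigma_finite_copy (mpow_sigma_finite n).

Lemma integral_mpow0 (f : 0.-tuple T -> \bar R) :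
  \int[mpow mu 0]_t f t = f [tuple].
Proof.
rewrite /= integral_dirac//; first by rewrite diracT mul1e.
move=> _ Y mY; rewrite setTI.
have [h|h] := pselect (Y (f [tuple])).
  rewrite (_ : _ @^-1` _ = setT)//; apply/seteqP; split => // t _ /=.
  by rewrite tuple0.
rewrite (_ : _ @^-1` _ = set0)//; apply/seteqP; split => // t /=.
by rewrite tuple0.
Qed.

(** This form of the theorem of Tonelli is what makes inductions on the number
    of coordinates possible. *)
Lemma ge0_integral_mpowS n (f : n.+1.-tuple T -> \bar R) :
  measurable_fun setT f -> (forall t, 0 <= f t) ->
  \int[mpow mu n.+1]_t f t =
  \int[mpow mu n]_t \int[mu]_s f [tuple of s :: t].
Proof.
move=> mf f0 /=; rewrite /mpow_step.
rewrite ge0_integral_pushforward//=; last exact: measurable_tuple_cons.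
rewrite preimage_setT.
have mf' : measurable_fun setT (f \o (@tuple_cons _ T n)).
  by apply: measurableT_comp => //; exact: measurable_tuple_cons.
transitivity (\int[mu \x mpow_sf n]_x (f \o (@tuple_cons _ T n)) x).
  apply: eq_measure_integral => //= A mA _; apply/esym.
  apply: product_measure_unique => // B C mB mC.
  by rewrite -[in RHS]/(mpow_sf n) -product_measure2E.
rewrite fubini_tonelli2; [by []|exact: mf'|by move=> x; exact: f0].
Qed.

Lemma mpow_setT_neq0 n : mu setT != 0 -> mpow mu n setT != 0.
Proof.
move=> mu0; elim: n => [|n IH] /=; first by rewrite diracT.
rewrite /mpow_step /pushforward preimage_setT -setXTT product_measure2E//.
by rewrite mule_eq0 negb_or mu0.
Qed.

End mpow_theory.

Section lebesgue_translation.
Local Open Scope ereal_scope.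
Variable R : realType.
Notation mu := (@lebesgue_measure R).

Lemma measurable_shiftr (a : R) :
  measurable_fun setT (fun x : measurableTypeR R => (x + a)%R : measurableTypeR R).
Proof. by apply: measurable_funD. Qed.

Lemma lebesgue_measure_shift (a : R) (A : set (measurableTypeR R)) : measurable A ->
  pushforward mu (fun x : measurableTypeR R => (x + a)%R : measurableTypeR R) A = mu A.
Proof.
move=> mA; apply/esym.
have := measurable_shiftr a => ma.
pose m := measure_function_pushforward__canonical__measure_function_Measure mu ma.
apply: (@lebesgue_measure_unique _ m) => //= _ [[b c]] _ <-.
rewrite /pushforward.
rewrite (_ : _ @^-1` _ = `](b - a)%R, (c - a)%R]%classic); last first.
  by apply/seteqP; split => x /=; rewrite !in_itv/= ltrBlDr lerBrDr.
rewrite !lebesgue_measure_itv/= !lte_fin ltrD2r; case: ifP => // _.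
by congr (_%:E); ring.
Qed.

Lemma ge0_integral_shift (a : R) (f : measurableTypeR R -> \bar R) :
  measurable_fun setT f -> (forall x, 0 <= f x) ->
  \int[mu]_x f (x + a)%R = \int[mu]_x f x.
Proof.
move=> mf f0; have ma := measurable_shiftr a.
have := @ge0_integral_pushforward _ _ _ _ R _ ma mu setT f measurableT mf (in1W f0).
rewrite preimage_setT /= => <-.
by apply: eq_measure_integral => //= A mA _; exact: lebesgue_measure_shift.
Qed.

Definition tshift n (t : n.-tuple (measurableTypeR R)) (v : 'I_n -> R) :
    n.-tuple (measurableTypeR R) :=
  [tuple (tnth t i + v i)%R | i < n].

Lemma measurable_tshift n (v : 'I_n -> R) :
  measurable_fun setT (fun t => tshift t v).
Proof.
apply/measurable_fun_tnthP => i.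
rewrite (_ : _ \o _ = fun t : n.-tuple (measurableTypeR R) => (tnth t i + v i)%R).
  by apply: measurable_funD => //; exact: measurable_tnth.
by apply/funext => t /=; rewrite tnth_mktuple.
Qed.

(** The Gaussian computations below rest on this invariance, which follows from
    dimension one by Tonelli. *)
Lemma ge0_integral_tshift n (v : 'I_n -> R)
    (f : n.-tuple (measurableTypeR R) -> \bar R) :
  measurable_fun setT f -> (forall x, 0 <= f x) ->
  \int[mpow mu n]_t f (tshift t v) = \int[mpow mu n]_t f t.
Proof.
elim: n v f => [|n IH] v f mf f0.
  by rewrite !integral_mpow0; congr f; exact/val_inj/size0nil/size_tuple.
rewrite !ge0_integral_mpowS//; last first.
  by apply: measurableT_comp => //; exact: measurable_tshift.
have e s (t : n.-tuple (measurableTypeR R)) :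
    tshift [tuple of s :: t] v = [tuple of (s + v ord0)%R :: tshift t (v \o lift ord0)].
  apply: eq_from_tnth => i; rewrite tnth_mktuple.
  case: (unliftP ord0 i) => [j|] ->; last by rewrite !tnth0.
  by rewrite !tnthS tnth_mktuple.
under eq_integral => t _.
  under eq_integral => s _ do rewrite e.
  rewrite (@ge0_integral_shift _ (fun s => f [tuple of s :: tshift t (v \o lift ord0)]))//; last first.
    by apply: measurableT_comp => //; apply: measurable_cons => //.
  over.
rewrite (IH _ (fun t => \int[mu]_s f [tuple of s :: t]))//.
- have mf' : measurable_fun setT (f \o (@tuple_cons _ (measurableTypeR R) n)).
    by apply: measurableT_comp => //; exact: measurable_tuple_cons.
  have := @measurable_fun_fubini_tonelli_G _ _ _ _ R mu _ mf'.
  by apply => // x; exact: f0.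
- by move=> x; exact: integral_ge0.
Qed.

End lebesgue_translation.

(** * Moments of Gaussian weights *)

Section exp_bounds.
Variable R : realType.
Implicit Types x y : R.

Lemma expR_sub1_le y : expR y - 1 <= y * expR y.
Proof.
have := expR_ge1Dx (- y); rewrite -(ler_pM2r (expR_gt0 y)) expRN mulVf ?gt_eqF ?expR_gt0//.
by rewrite mulrDl mul1r mulNr; lra.
Qed.

(** The second difference of the exponential at 0. Its quotient by the square of
    the step turns a Laplace transform into a second moment. *)
Lemma expR_cosh y : expR y + expR (- y) - 2 = expR (- y) * (expR y - 1) ^+ 2.
Proof.
have : expR (- y) * expR y = 1 by rewrite expRN mulVf ?gt_eqF ?expR_gt0.
move: (expR y) (expR (- y)) => a b ab.
have -> : b * (a - 1) ^+ 2 = (b * a) * a - 2 * (b * a) + b by ring.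
by rewrite ab; ring.
Qed.

Lemma expR_cosh_le y : expR y + expR (- y) - 2 <= y ^+ 2 * expR `|y|.
Proof.
wlog y0 : y / 0 <= y => [hw|].
  have [/hw//|yn] := leP 0 y.
  by have := hw (- y); rewrite opprK normrN sqrrN (addrC (expR (- y))); apply; lra.
rewrite expR_cosh ger0_norm//.
have h1 : 0 <= expR y - 1 by rewrite subr_ge0 -expR0 ler_expR.
have h2 := expR_sub1_le y.
have : (expR y - 1) ^+ 2 <= (y * expR y) ^+ 2 by rewrite ler_sqr ?nnegrE// (le_trans h1).
rewrite -(ler_pM2l (expR_gt0 (- y))) => /le_trans; apply.
rewrite exprMn mulrCA ler_wpM2l ?sqr_ge0// expr2 mulrA expRN mulVf ?gt_eqF ?expR_gt0//.
by rewrite mul1r.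
Qed.

Lemma expR_cosh_ge0 y : 0 <= expR y + expR (- y) - 2.
Proof. by rewrite expR_cosh mulr_ge0 ?expR_ge0 ?sqr_ge0. Qed.

Lemma cvg_expR_slope (e : R^nat) z : (forall k, 0 < e k) -> e @ \oo --> 0 ->
  (fun k => (expR (z * e k) - 1) / e k) @ \oo --> z.
Proof.
move=> e0 ecvg.
apply: (@squeeze_cvgr _ _ _ _ (cst z) (fun k => z * expR (z * e k))).
- apply: nearW => k; rewrite ler_pdivlMr// ler_pdivrMr//; apply/andP; split.
    by have := expR_ge1Dx (z * e k); rewrite /cst/=; lra.
  by have := expR_sub1_le (z * e k); rewrite mulrAC.
- exact: cvg_cst.
- rewrite -[X in _ --> X]mulr1; apply: cvgM; first exact: cvg_cst.
  rewrite -expR0; apply: continuous_cvg; first exact: continuous_expR.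
  by rewrite -(mulr0 z); apply: cvgM => //; exact: cvg_cst.
Qed.

End exp_bounds.

Section gaussian_moments.
Variables (R : realType) (n : nat) (Q : 'M[R]_n).
Hypothesis Qsym : Q^T = Q.
Local Notation tup := (n.-tuple (measurableTypeR R)).
Local Notation mu := (mpow (@lebesgue_measure R) n).

Definition row_of_tuple (t : tup) : 'rV[R]_n := \row_i tnth t i.

Definition bform (u v : 'rV[R]_n) : R := (u *m Q *m v^T) 0 0.

Definition gweight (t : tup) : R :=
  expR (- (bform (row_of_tuple t) (row_of_tuple t) / 2)).

Lemma bformC u v : bform u v = bform v u.
Proof.
rewrite /bform.
have -> : v *m Q *m u^T = (u *m Q *m v^T)^T by rewrite !trmx_mul trmxK Qsym mulmxA.
by rewrite [RHS]mxE.
Qed.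

Lemma bformDl u v z : bform (u + v) z = bform u z + bform v z.
Proof. by rewrite /bform !mulmxDl mxE. Qed.

Lemma bformDr u v z : bform z (u + v) = bform z u + bform z v.
Proof. by rewrite bformC bformDl !(bformC z). Qed.

Lemma bformZl c u z : bform (c *: u) z = c * bform u z.
Proof. by rewrite /bform -!scalemxAl mxE. Qed.

Lemma bformZr c u z : bform z (c *: u) = c * bform z u.
Proof. by rewrite bformC bformZl bformC. Qed.

Lemma row_of_tshift (t : tup) (v : 'rV[R]_n) :
  row_of_tuple (tshift t (fun i => v 0 i)) = row_of_tuple t + v.
Proof. by apply/rowP => i; rewrite !mxE tnth_mktuple. Qed.

Lemma measurable_bform v : measurable_fun setT (fun t : tup => bform (row_of_tuple t) v).
Proof.
rewrite (_ : (fun t : tup => _) =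
    fun t : tup => \sum_i \sum_j tnth t j * Q j i * v 0 i).
  apply: measurable_sum => i; apply: measurable_sum => j.
  apply: measurable_funM => //; apply: measurable_funM => //.
  exact: measurable_tnth.
apply/funext => t; rewrite /bform mxE; apply: eq_bigr => i _.
by rewrite mxE mulr_suml !mxE; apply: eq_bigr => j _; rewrite mxE.
Qed.

Lemma measurable_gweight : measurable_fun setT gweight.
Proof.
apply: measurableT_comp; first exact: measurable_expR.
apply: measurableT_comp => //; apply: measurable_funM => //.
rewrite (_ : (fun t : tup => _) =
    fun t : tup => \sum_i (tnth t i) * bform (delta_mx 0 i) (row_of_tuple t)).
  apply: measurable_sum => i; apply: measurable_funM => //; first exact: measurable_tnth.
  by under eq_fun do rewrite bformC; exact: measurable_bform.
apply/funext => t; rewrite [X in bform X _]row_sum_delta.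
rewrite /bform !mulmx_suml summxE; apply: eq_bigr => i _.
by rewrite -!scalemxAl mxE mxE.
Qed.

Lemma gweight_gt0 t : 0 < gweight t. Proof. exact: expR_gt0. Qed.

Lemma gweight_shift t (v : 'rV[R]_n) : gweight (tshift t (fun i => v 0 i)) =
  gweight t * expR (- bform (row_of_tuple t) v) * expR (- (bform v v / 2)).
Proof.
rewrite /gweight row_of_tshift -!expRD; congr expR.
by rewrite bformDl !bformDr (bformC v); field.
Qed.

Hypothesis wint : mu.-integrable setT (EFin \o gweight).
Let I : R := fine (\int[mu]_t (gweight t)%:E).

Let IE : (\int[mu]_t (gweight t)%:E = I%:E)%E.
Proof. by rewrite /I fineK//; exact: integrable_fin_num. Qed.

(** Completing the square: the tilted weight is, up to a constant factor, the
    translate of the weight by [- v]. No diagonalisation of [Q] is needed, and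
    [Q] may a priori be indefinite. *)
Lemma integral_gweight_exp v :
  (\int[mu]_t (gweight t * expR (bform (row_of_tuple t) v))%:E =
   (expR (bform v v / 2) * I)%:E)%E.
Proof.
have mw := measurable_gweight.
have mw' : measurable_fun setT (EFin \o gweight) by exact/measurable_EFinP.
have w0 t : (0 <= (EFin \o gweight) t)%E by rewrite lee_fin ltW ?gweight_gt0.
have /= := @ge0_integral_tshift R n (fun i => (- v) 0 i) _ mw' w0.
rewrite IE.
under eq_integral do rewrite gweight_shift.
have -> : bform (- v) (- v) = bform v v.
  by rewrite -scaleN1r bformZl bformZr; ring.
under eq_integral => t _.
  rewrite -(scaleN1r v) bformZr mulN1r opprK mulrC EFinM.
  over.
rewrite ge0_integralZl//; last 2 first.
- apply/measurable_EFinP; apply: measurable_funM => //.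
  by apply: measurableT_comp => //; exact: measurable_bform.
- by move=> t _; rewrite lee_fin mulr_ge0 ?expR_ge0// ltW ?gweight_gt0.
move=> h; rewrite EFinM -h muleA -EFinM.
by rewrite -expRD subrr expR0 mul1e.
Qed.

Lemma integrable_gweight_exp v :
  mu.-integrable setT (fun t => (gweight t * expR (bform (row_of_tuple t) v))%:E).
Proof.
apply/integrableP; split.
  apply/measurable_EFinP; apply: measurable_funM; first exact: measurable_gweight.
  by apply: measurableT_comp => //; exact: measurable_bform.
under eq_integral => t _ do rewrite gee0_abs ?lee_fin ?mulr_ge0 ?expR_ge0 ?(ltW (gweight_gt0 _))//.
by rewrite integral_gweight_exp ltry.
Qed.

(** The Laplace transform at [e v], [- e v] and [0] gives the integral of the
    second difference [u] of the exponential of [bform _ v], with limit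
    [bform v v * I]. Dominated convergence applies because [u] is bounded by a
    multiple of the exponentials at [2 v] and [- 2 v]. *)
Lemma gaussian_square v :
  mu.-integrable setT (fun t => (gweight t * bform (row_of_tuple t) v ^+ 2)%:E) /\
  (\int[mu]_t (gweight t * bform (row_of_tuple t) v ^+ 2)%:E = (bform v v * I)%:E)%E.
Proof.
pose X t := bform (row_of_tuple t) v.
pose e (k : nat) : R := k.+1%:R^-1.
have e0 k : 0 < e k by rewrite invr_gt0 ltr0n.
have e1 k : e k <= 1 by rewrite invf_le1 ?ltr0n// ler1n.
have ecvg : e @ \oo --> 0 by exact: cvg_harmonic.
pose u (k : nat) t := (e k ^+ 2)^-1 * (expR (X t * e k) + expR (- (X t * e k)) - 2).
have mX : measurable_fun setT X by exact: measurable_bform.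
have mw := measurable_gweight.
have mu_ k : measurable_fun setT (u k).
  apply: measurable_funM => //; apply: measurable_funB => //; apply: measurable_funD.
    by apply: measurableT_comp => //; exact: measurable_funM.
  by apply: measurableT_comp => //; apply: measurableT_comp => //; exact: measurable_funM.
have uE k t : gweight t * u k t = (e k ^+ 2)^-1 *
    (gweight t * expR (bform (row_of_tuple t) (e k *: v)) +
     gweight t * expR (bform (row_of_tuple t) (- e k *: v)) - 2 * gweight t).
  by rewrite !bformZr mulNr /u -/(X t) (mulrC (e k)); ring.
have int_u k : (\int[mu]_t (gweight t * u k t)%:E =
    ((e k ^+ 2)^-1 * (2 * (expR (bform v v / 2 * e k ^+ 2) - 1) * I))%:E)%E.
  under eq_integral do rewrite uE EFinM EFinB EFinD (EFinM 2).
  rewrite integralZl//; last first.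
    apply: integrableB => //; last exact: integrableZl.
    by apply: integrableD => //; exact: integrable_gweight_exp.
  rewrite integralB//; last 2 first.
  - by apply: integrableD => //; exact: integrable_gweight_exp.
  - exact: integrableZl.
  rewrite integralD//; try exact: integrable_gweight_exp.
  rewrite !integral_gweight_exp integralZl// IE.
  apply: (congr1 EFin); rewrite !bformZl !bformZr.
  have -> : - e k * (- e k * bform v v) / 2 = bform v v / 2 * e k ^+ 2 by ring.
  have -> : e k * (e k * bform v v) / 2 = bform v v / 2 * e k ^+ 2 by ring.
  by ring.
have cvg_I : ((\int[mu]_t (gweight t * u k t)%:E) @[k --> \oo] --> (bform v v * I)%:E)%E.
  under eq_fun do rewrite int_u.
  apply: cvg_EFin; first exact: nearW.
  have e20 k : 0 < e k ^+ 2 by rewrite exprn_gt0.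
  have e2cvg : (fun k => e k ^+ 2) @ \oo --> 0.
    by under eq_fun do rewrite expr2; rewrite -(mulr0 0); exact: cvgM.
  have := @cvg_expR_slope _ _ (bform v v / 2) e20 e2cvg.
  move=> /(cvgM (cvg_cst (2 * I))); rewrite [2 * I * _](_ : _ = bform v v * I); last by field.
  by apply: cvg_trans; apply: near_eq_cvg; apply: nearW => k /=; rewrite /cst/=; ring.
have [] := @dominated_convergence _ tup R mu setT measurableT
  (fun k t => (gweight t * u k t)%:E) (fun t => (gweight t * X t ^+ 2)%:E)
  (fun t => 4%:E * ((gweight t * expR (bform (row_of_tuple t) (2 *: v)))%:E +
            (gweight t * expR (bform (row_of_tuple t) (- 2 *: v)))%:E))%E.
- by move=> k; apply/measurable_EFinP; exact: measurable_funM.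
- by apply/measurable_EFinP; apply: measurable_funM => //; exact: measurable_funX.
- apply: aeW => t _; apply: cvg_EFin; first exact: nearW.
  apply: cvgM; first exact: cvg_cst.
  have h := @cvg_expR_slope _ _ (X t) e0 ecvg.
  rewrite -[X in _ --> X]mul1r.
  apply: (@cvg_trans _ ((fun k => expR (- (X t * e k)) * ((expR (X t * e k) - 1) / e k) ^+ 2) @ \oo)).
    by apply: near_eq_cvg; apply: nearW => k /=; rewrite /u expR_cosh expr_div_n; ring.
  apply: cvgM; last first.
    by under eq_fun do rewrite expr2; rewrite expr2; exact: cvgM.
  rewrite -expR0; apply: continuous_cvg; first exact: continuous_expR.
  rewrite -oppr0; apply: cvgN.
  by rewrite -(mulr0 (X t)); apply: cvgM => //; exact: cvg_cst.
- by apply: integrableZl => //; apply: integrableD => //; exact: integrable_gweight_exp.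
- apply: aeW => t k _; rewrite -EFinD -EFinM lee_fin -mulrDr [leRHS]mulrCA.
  have uge0 : 0 <= u k t.
    by rewrite mulr_ge0 ?expR_cosh_ge0// invr_ge0 exprn_ge0// ltW.
  rewrite ger0_norm; last by rewrite (mulr_ge0 (ltW (gweight_gt0 _)) uge0).
  rewrite ler_pM2l ?gweight_gt0// !bformZr -/(X t).
  have h1 : u k t <= X t ^+ 2 * expR `|X t|.
    rewrite /u mulrC ler_pdivrMr ?exprn_gt0//.
    rewrite (le_trans (expR_cosh_le _))// exprMn mulrAC ler_wpM2r ?exprn_ge0 ?(ltW (e0 _))//.
    rewrite ler_wpM2l ?sqr_ge0// ler_expR normrM (ger0_norm (ltW (e0 _))).
    by rewrite ler_piMr.
  have h2 : X t ^+ 2 <= 4 * expR `|X t|.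
    have : `|X t| / 2 <= expR (`|X t| / 2) by have := expR_ge1Dx (`|X t| / 2); lra.
    move=> h3; have : (`|X t| / 2) ^+ 2 <= expR (`|X t| / 2) ^+ 2.
      by rewrite ler_sqr ?nnegrE ?expR_ge0// divr_ge0.
    rewrite -expRM_natl mulrCA mulfV ?pnatr_eq0// mulr1.
    by rewrite expr_div_n real_normK ?num_real//; lra.
  have h3 : expR (2 * `|X t|) <= expR (2 * X t) + expR (- 2 * X t).
    have [x0|x0] := leP 0 (X t).
      by rewrite ger0_norm// lerDl expR_ge0.
    by rewrite ltr0_norm// mulrN -mulNr lerDr expR_ge0.
  apply: (le_trans h1); apply: (@le_trans _ _ (4 * expR (2 * `|X t|))).
    rewrite (_ : 2 * `|X t| = `|X t| + `|X t|) ?expRD ?mulrA; last by ring.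
    by rewrite ler_wpM2r ?expR_ge0.
  by rewrite ler_pM2l.
move=> h1 _ h2; split => //.
exact: cvg_unique h2 cvg_I.
Qed.

(** Polarisation of the previous identity. *)
Lemma gaussian_covariance u v :
  mu.-integrable setT (fun t => (gweight t *
    (bform (row_of_tuple t) u * bform (row_of_tuple t) v))%:E) /\
  (\int[mu]_t (gweight t * (bform (row_of_tuple t) u * bform (row_of_tuple t) v))%:E =
    (bform u v)%:E * \int[mu]_t (gweight t)%:E)%E.
Proof.
have E t : (gweight t * (bform (row_of_tuple t) u * bform (row_of_tuple t) v))%:E =
   (4^-1%:E * ((gweight t * bform (row_of_tuple t) (u + v) ^+ 2)%:E -
               (gweight t * bform (row_of_tuple t) (u + -1 *: v) ^+ 2)%:E))%E.
  rewrite -EFinB -EFinM; congr EFin.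
  by rewrite !bformDr bformZr; field.
have [i1 e1] := gaussian_square (u + v).
have [i2 e2] := gaussian_square (u + -1 *: v).
split.
  under eq_fun do rewrite E.
  by apply: integrableZl => //; exact: integrableB.
under eq_integral do rewrite E.
rewrite integralZl//; last exact: integrableB.
rewrite integralB// e1 e2 IE -EFinB -!EFinM; congr EFin.
by rewrite !bformDr !bformDl !bformZr !bformZl (bformC v u); field.
Qed.

(** If [v] is in the kernel of [Q], the weight is invariant under translations by
    multiples of [v]. Hence the integral of the weight against a bump in the
    [i]-th coordinate does not change when the bump is moved by [k v]; if [v] is
    not zero in that coordinate, it also tends to zero with [k], by domination by
    the weight. A positive function would have integral zero. *)
Lemma gaussian_nondegenerate (v : 'rV[R]_n) : v *m Q = 0 -> v = 0.
Proof.
move=> vQ; have bv a : bform a v = 0.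
  by rewrite bformC /bform vQ mul0mx mxE.
apply/rowP => i; rewrite mxE; apply/eqP; apply: contraT => vi0; exfalso.
(* a bump of the [i]-th coordinate, moved by [k v] *)
pose f (k : nat) (t : tup) : R := gweight t * expR (- `|tnth t i + k%:R * v 0 i|).
have mw := measurable_gweight.
have mf k : measurable_fun setT (f k).
  apply: measurable_funM => //; apply: measurableT_comp => //.
  apply: measurableT_comp => //; apply: measurableT_comp => //.
  by apply: measurable_funD => //; exact: measurable_tnth.
have f0 k t : 0 < f k t by exact: mulr_gt0 (gweight_gt0 _) (expR_gt0 _).
have fconst k : (\int[mu]_t (f k t)%:E = \int[mu]_t (f 0%N t)%:E)%E.
  rewrite -(@ge0_integral_tshift R n (fun i => (k%:R *: v) 0 i) (EFin \o f 0%N))/=.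
  - apply: eq_integral => t _; rewrite /f gweight_shift bformZr !bv mulr0 bformZr bv.
    by rewrite mulr0 mul0r !oppr0 expR0 !mulr1 mul0r addr0 tnth_mktuple mxE.
  - exact/measurable_EFinP.
  - by move=> x; rewrite lee_fin ltW.
have [_ _] : [/\ mu.-integrable setT (fun=> 0%E : \bar R),
    (\int[mu]_t `|(f k t)%:E - 0| @[k --> \oo] --> 0)%E &
    (\int[mu]_t (f k t)%:E @[k --> \oo] --> \int[mu]_t (0 : \bar R))%E].
  have D := @dominated_convergence _ tup R mu setT measurableT
    (fun k t => (f k t)%:E) (fun=> 0%E) (EFin \o gweight).
  apply: D => //.
  - by move=> k; exact/measurable_EFinP.
  - apply: aeW => t _; apply: cvg_EFin; first exact: nearW.
    rewrite /= -(mulr0 (gweight t)); apply: cvgM; first exact: cvg_cst.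
    apply: (@squeeze_cvgr _ _ _ _ (cst 0)
      (fun k => expR `|tnth t i| * (expR (- `|v 0 i|)) ^+ k)).
    + apply: nearW => k /=; rewrite expR_ge0/= -expRM_natl -expRD ler_expR.
      have : `|k%:R * v 0 i| <= `|tnth t i + k%:R * v 0 i| + `|tnth t i|.
        rewrite -{1}(addKr (tnth t i) (k%:R * v 0 i)) addrC.
        by rewrite (le_trans (ler_normB _ _)).
      by rewrite normrM normr_nat; lra.
    + exact: cvg_cst.
    + rewrite -(mulr0 (expR `|tnth t i|)); apply: cvgM; first exact: cvg_cst.
      apply: cvg_expr; rewrite ger0_norm ?expR_ge0// -expR0 ltr_expR oppr_lt0.
      by rewrite normr_gt0.
  - apply: aeW => t k _; rewrite /= lee_fin ger0_norm ?(ltW (f0 _ _))//.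
    by rewrite ler_piMr ?(ltW (gweight_gt0 _))// -expR0 ler_expR oppr_le0.
under eq_fun do rewrite fconst.
move=> /(cvg_unique _ (cvg_cst _)) => h.
have {}h : (\int[mu]_t (f 0%N t)%:E = 0)%E by rewrite -[RHS](integral0 mu setT) -h.
have : ae_eq mu setT (EFin \o f 0%N) (cst 0%E).
  apply/(ae_eq_integral_abs mu measurableT); first exact/measurable_EFinP.
  rewrite -[RHS]h; apply: eq_integral => t _ /=.
  by rewrite ger0_norm// ltW.
move=> [A [mA A0 sA]].
have : mu setT = 0%E.
  rewrite -A0; congr (mu _); apply/esym/seteqP; split => // t _; apply: sA => /=.
  by move=> /(_ Logic.I) /= [] /eqP; rewrite gt_eqF.
apply/eqP; apply: mpow_setT_neq0.
have h1 := @lebesgue_measure_itv R `]-oo, +oo[; rewrite set_itvE/= in h1.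
by rewrite [X in X != _]h1.
Qed.

Lemma gaussian_unit : Q \in unitmx.
Proof.
rewrite -row_free_unit -kermx_eq0; apply/eqP/row_matrixP => i.
by rewrite row0; apply: gaussian_nondegenerate; rewrite -row_mul mulmx_ker row0.
Qed.

End gaussian_moments.

(** * Real-linear functionals and the matrix exponential *)

Section scalars.
Variables (R : realType) (k : scal_kind).
Local Notation K := (scal R k).
Local Notation C := (scal_coord k).
Implicit Types (c : C) (z : K) (a : R).

Lemma scal_partD c z1 z2 : scal_part c (z1 + z2) = scal_part c z1 + scal_part c z2.
Proof. by case: k c z1 z2 => //= -[] [? ?] [? ?]. Qed.

Lemma scal_partZ c a z : scal_part c (scal_of k a * z) = a * scal_part c z.
Proof.
by case: k c z => //= -[] [x y] /=; rewrite ?mul0r ?subr0 ?addr0.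
Qed.

Lemma scal_part0 c : scal_part c (0 : K) = 0.
Proof. by case: k c => //= -[]. Qed.

Lemma scal_partN c z : scal_part c (- z) = - scal_part c z.
Proof. by case: k c z => //= -[] []. Qed.

Lemma scal_part_sum c (I : Type) (s : seq I) (P : pred I) (f : I -> K) :
  scal_part c (\sum_(i <- s | P i) f i) = \sum_(i <- s | P i) scal_part c (f i).
Proof.
by apply: (big_morph (scal_part c)); [exact: scal_partD|exact: scal_part0].
Qed.

Lemma scal_partP z1 z2 : (forall c, scal_part c z1 = scal_part c z2) -> z1 = z2.
Proof.
case: k z1 z2 => /= [z1 z2 /(_ tt)//|[x1 y1] [x2 y2] h].
by have /= -> := h true; have /= -> := h false.
Qed.

Lemma scal_part_mk c (f : C -> R) : scal_part c (scal_mk f : K) = f c.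
Proof. by case: k c f => /= -[]. Qed.

Lemma scal_ofM a b : scal_of k (a * b) = scal_of k a * scal_of k b.
Proof. by apply: scal_partP; case: k => /= -[] //=; rewrite ?mul0r ?mulr0 ?subr0 ?addr0. Qed.

Lemma scal_of1 : scal_of k 1 = 1 :> K.
Proof. by apply: scal_partP; case: k => /= -[]. Qed.

Lemma scal_of0 : scal_of k 0 = 0 :> K.
Proof. by apply: scal_partP; case: k => /= -[]. Qed.

Lemma scal_ofD a b : scal_of k (a + b) = scal_of k a + scal_of k b.
Proof. by apply: scal_partP; case: k => /= -[] //=; rewrite addr0. Qed.

Lemma scal_of_nat n : scal_of k n%:R = n%:R :> K.
Proof.
elim: n => [|n IH]; first exact: scal_of0.
by rewrite -natr1 scal_ofD IH scal_of1 natr1.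
Qed.

Lemma scal_ofX a n : scal_of k (a ^+ n) = scal_of k a ^+ n.
Proof. by elim: n => [|n IH]; rewrite ?scal_of1// !exprS scal_ofM IH. Qed.

Lemma scal_of_eq0 a : (scal_of k a == 0 :> K) = (a == 0).
Proof.
apply/eqP/eqP => [|->]; last exact: scal_of0.
by case: k => //= -[].
Qed.

Lemma scal_ofV a : scal_of k a^-1 = (scal_of k a)^-1.
Proof.
have [->|a0] := eqVneq a 0; first by rewrite invr0 scal_of0 invr0.
apply: (mulfI (_ : scal_of k a != 0)); first by rewrite scal_of_eq0.
by rewrite -scal_ofM !mulfV ?scal_of1// scal_of_eq0.
Qed.

Definition scal_norm z : R := \sum_c `|scal_part c z|.

Lemma scal_norm_ge0 z : 0 <= scal_norm z.
Proof. exact: sumr_ge0. Qed.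

Lemma scal_normD z1 z2 : scal_norm (z1 + z2) <= scal_norm z1 + scal_norm z2.
Proof.
rewrite /scal_norm -big_split/=; apply: ler_sum => c _.
by rewrite scal_partD ler_normD.
Qed.

Lemma scal_norm0 : scal_norm 0 = 0.
Proof. by rewrite /scal_norm big1// => c _; rewrite scal_part0 normr0. Qed.

Lemma scal_normM z1 z2 : scal_norm (z1 * z2) <= scal_norm z1 * scal_norm z2.
Proof.
rewrite /scal_norm; case: k z1 z2 => /= [z1 z2|[x1 y1] [x2 y2]].
  by rewrite !big_const !card_unit /= !addr0 normrM.
rewrite !big_bool/=.
have := ler_normB (x1 * x2) (y1 * y2); have := ler_normD (x1 * y2) (y1 * x2).
rewrite !normrM; lra.
Qed.

End scalars.

Section real_functionals.
Variables (R : realType) (k : scal_kind) (m n : nat).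
Local Notation K := (scal R k).
Implicit Types (A B : 'M[K]_(m, n)) (l : 'M[K]_(m, n) -> R).

Definition mx_norm1 A : R := \sum_i \sum_j scal_norm (A i j).

Lemma mx_norm1_ge0 A : 0 <= mx_norm1 A.
Proof. by apply: sumr_ge0 => i _; apply: sumr_ge0 => j _; exact: scal_norm_ge0. Qed.

Lemma mx_norm1D A B : mx_norm1 (A + B) <= mx_norm1 A + mx_norm1 B.
Proof.
rewrite /mx_norm1 -big_split/=; apply: ler_sum => i _.
rewrite -big_split/=; apply: ler_sum => j _.
by rewrite mxE scal_normD.
Qed.

Lemma part_le_mx_norm1 c A i j : `|scal_part c (A i j)| <= mx_norm1 A.
Proof.
apply: (@le_trans _ _ (scal_norm (A i j))).
  by rewrite /scal_norm (bigD1 c)//= lerDl sumr_ge0.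
rewrite /mx_norm1 (bigD1 i)//= (bigD1 j)//= -addrA lerDl addr_ge0//.
  by apply: sumr_ge0 => ? _; exact: scal_norm_ge0.
by apply: sumr_ge0 => ? _; apply: sumr_ge0 => ? _; exact: scal_norm_ge0.
Qed.

(** Identities between matrices of real or complex scalars are tested on
    functionals which are linear over the reals. This treats the two kinds of
    scalars at once, and such functionals commute with entrywise integrals and
    limits. *)
Definition real_linear l :=
  (forall A B, l (A + B) = l A + l B) /\ (forall a A, l (scal_of k a *: A) = a * l A).

Lemma real_linear_part c i j : real_linear (fun A => scal_part c (A i j)).
Proof.
by split=> [A B|a A]; rewrite mxE ?scal_partD ?scal_partZ /=.
Qed.

Definition functional_coef l i j (c : scal_coord k) : R :=
  l (scal_mk (fun c' => (c' == c)%:R) *: delta_mx i j).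

Lemma real_linear0 l : real_linear l -> l 0 = 0.
Proof.
by move=> [_ lZ]; rewrite -(scale0r 0) -(scal_of0 R k) lZ mul0r.
Qed.

Lemma real_linear_sum l (I : Type) (s : seq I) (P : pred I) (f : I -> 'M[K]_(m, n)) :
  real_linear l ->
  l (\sum_(i <- s | P i) f i) = \sum_(i <- s | P i) l (f i).
Proof.
by move=> hl; apply: (big_morph l); [exact: hl.1|exact: real_linear0].
Qed.

Lemma real_linearE l A : real_linear l ->
  l A = \sum_i \sum_j \sum_c functional_coef l i j c * scal_part c (A i j).
Proof.
move=> hl; rewrite [in LHS](matrix_sum_delta A) real_linear_sum//.
apply: eq_bigr => i _; rewrite real_linear_sum//; apply: eq_bigr => j _.
have -> : A i j = \sum_c scal_of k (scal_part c (A i j)) *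
    scal_mk (fun c' => (c' == c)%:R).
  apply: scal_partP => c; rewrite scal_part_sum (bigD1 c)//= scal_partZ scal_part_mk.
  rewrite eqxx mulr1 big1 ?addr0// => c' c'c.
  by rewrite scal_partZ scal_part_mk eq_sym (negbTE c'c) mulr0.
rewrite scaler_suml real_linear_sum//; apply: eq_bigr => c _.
rewrite -scalerA hl.2 mulrC; congr (_ * _).
rewrite scal_part_sum (bigD1 c)//= scal_partZ scal_part_mk eqxx mulr1 big1 ?addr0// => c' c'c.
by rewrite scal_partZ scal_part_mk eq_sym (negbTE c'c) mulr0.
Qed.

Lemma real_linear_bound l : real_linear l ->
  exists2 M : R, 0 <= M & forall A, `|l A| <= M * mx_norm1 A.
Proof.
move=> hl; exists (\sum_i \sum_j \sum_c `|functional_coef l i j c|).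
  by do 3 (apply: sumr_ge0 => ? _).
move=> A; rewrite (real_linearE _ hl) (le_trans (ler_norm_sum _ _ _))//.
rewrite mulr_suml; apply: ler_sum => i _.
rewrite (le_trans (ler_norm_sum _ _ _))// mulr_suml; apply: ler_sum => j _.
rewrite (le_trans (ler_norm_sum _ _ _))// mulr_suml; apply: ler_sum => c _.
by rewrite normrM ler_wpM2l// part_le_mx_norm1.
Qed.

End real_functionals.

Arguments real_linear_part {R k m n} c i j.

Lemma mx_norm1M (R : realType) k m n p (A : 'M[scal R k]_(m, n)) (B : 'M[scal R k]_(n, p)) :
  mx_norm1 (A *m B) <= mx_norm1 A * mx_norm1 B.
Proof.
rewrite /mx_norm1 mulr_suml; apply: ler_sum => i _.
apply: (@le_trans _ _ (\sum_j \sum_l scal_norm (A i l) * scal_norm (B l j))).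
  apply: ler_sum => j _; rewrite mxE.
  rewrite (le_trans (_ : _ <= \sum_l scal_norm (A i l * B l j)))//.
    apply: (@big_ind2 _ _ (fun a b => scal_norm a <= b)) => //.
    - by rewrite scal_norm0.
    - by move=> a a' b b' aa' bb'; rewrite (le_trans (scal_normD _ _))// lerD.
  by apply: ler_sum => l _; exact: scal_normM.
rewrite exchange_big/= mulr_suml; apply: ler_sum => l _.
rewrite -mulr_sumr ler_wpM2l ?scal_norm_ge0//.
rewrite [leRHS](bigD1 l)//= lerDl.
by apply: sumr_ge0 => ? _; apply: sumr_ge0 => ? _; exact: scal_norm_ge0.
Qed.

Lemma real_linear_mull (R : realType) k m n p (B : 'M[scal R k]_(p, m))
    (l : 'M[scal R k]_(p, n) -> R) :
  real_linear l -> real_linear (fun A : 'M[scal R k]_(m, n) => l (B *m A)).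
Proof.
move=> [lD lZ]; split=> [A A'|a A]; first by rewrite mulmxDr lD.
by rewrite -scalemxAr lZ.
Qed.

Lemma real_linear_mulr (R : realType) k m n p (B : 'M[scal R k]_(n, p))
    (l : 'M[scal R k]_(m, p) -> R) :
  real_linear l -> real_linear (fun A : 'M[scal R k]_(m, n) => l (A *m B)).
Proof.
move=> [lD lZ]; split=> [A A'|a A]; first by rewrite mulmxDl lD.
by rewrite -scalemxAl lZ.
Qed.

Lemma cvg_sumr (R : realType) (T : Type) (F : set_system T) {FF : Filter F}
    (I : finType) (f : I -> T -> R) (a : I -> R) :
  (forall i, f i x @[x --> F] --> a i) ->
  (\sum_i f i x) @[x --> F] --> \sum_i a i.
Proof. by move=> h; apply: cvg_big => //; exact: add_continuous. Qed.

Section exponential.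
Variables (R : realType) (k : scal_kind) (r : nat) (H : 'M[scal R k]_r).
Local Notation K := (scal R k).
Implicit Types (l : 'M[K]_r -> R) (s : R).

Definition expflow s : 'M[K]_r := expmx (scal_of k s *: H).

Lemma mx_norm1X n : mx_norm1 (H ^+ n) <= mx_norm1 (1%:M : 'M[K]_r) * mx_norm1 H ^+ n.
Proof.
elim: n => [|n IH]; first by rewrite !expr0 mulr1.
rewrite exprSr [_ * _]/(_ *m _) (le_trans (mx_norm1M _ _))//.
by rewrite exprSr mulrA ler_wpM2r ?mx_norm1_ge0.
Qed.

Lemma scalemx_exp (a : K) n : (a *: H) ^+ n = a ^+ n *: H ^+ n.
Proof.
elim: n => [|n IH]; first by rewrite !expr0 scale1r.
by rewrite !exprS IH -[LHS]/(_ *m _) -scalemxAl -scalemxAr scalerA.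
Qed.

Lemma cvg_expflow_series l s : real_linear l ->
  cvgn (pseries (fun n => l (H ^+ n) / n`!%:R) s).
Proof.
move=> hl; have [M M0 hM] := real_linear_bound hl.
pose c := M * mx_norm1 (1%:M : 'M[K]_r).
have c0 : 0 <= c by rewrite mulr_ge0// mx_norm1_ge0.
apply: normed_cvg => /=.
apply: (@series_le_cvg _ _ (fun n => c * exp_coeff (mx_norm1 H * `|s|) n)) => [n|n|n|].
- exact: normr_ge0.
- rewrite mulr_ge0// /exp_coeff divr_ge0// exprn_ge0// mulr_ge0//.
  exact: mx_norm1_ge0.
- rewrite /exp_coeff/= !normrM normrX normfV normr_nat mulrAC mulrA ler_wpM2r ?invr_ge0//.
  rewrite exprMn mulrA ler_wpM2r ?exprn_ge0//.
  by rewrite (le_trans (hM _))// /c -mulrA ler_wpM2l// mx_norm1X.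
- by apply: is_cvg_seriesZ; exact: is_cvg_series_exp_coeff.
Qed.

(** A functional of the exponential is a scalar power series, so that the theory
    of power series of one real variable applies. *)
Lemma expflowE l s : real_linear l ->
  l (expflow s) = limn (pseries (fun n => l (H ^+ n) / n`!%:R) s).
Proof.
move=> hl; apply/esym/cvg_lim => //.
rewrite (real_linearE _ hl).
rewrite (_ : pseries _ _ = fun N => \sum_i \sum_j \sum_c functional_coef l i j c *
   pseries (fun n => scal_part c ((H ^+ n) i j) / n`!%:R) s N); last first.
  apply/funext => N; rewrite /pseries /series/=.
  under eq_bigr => n _ do rewrite (real_linearE _ hl) !mulr_suml.
  rewrite exchange_big/=; apply: eq_bigr => i _.
  under eq_bigr => n _ do rewrite !mulr_suml.
  rewrite exchange_big/=; apply: eq_bigr => j _.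
  under eq_bigr => n _ do rewrite !mulr_suml.
  rewrite exchange_big/=; apply: eq_bigr => c _.
  by rewrite mulr_sumr; apply: eq_bigr => n _; rewrite !mulrA.
apply: cvg_sumr => i; apply: cvg_sumr => j; apply: cvg_sumr => c.
apply: cvgM; first exact: cvg_cst.
rewrite mxE scal_part_mk.
rewrite (_ : series _ = pseries (fun n => scal_part c ((H ^+ n) i j) / n`!%:R) s); last first.
  rewrite /pseries; congr series; apply/funext => n.
  rewrite scalemx_exp !mxE -scal_of_nat -scal_ofV -scal_ofX mulrA -scal_ofM scal_partZ /=.
  by ring.
exact: (cvg_expflow_series (real_linear_part c i j)).
Qed.

Lemma is_derive_expflow l s : real_linear l ->
  is_derive s 1 (fun s => l (expflow s)) (l (H *m expflow s)).
Proof.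
move=> hl; pose f l' n : R := l' (H ^+ n) / n`!%:R.
have diffs l' : pseries_diffs (f l') = f (fun A => l' (H *m A)).
  apply/funext => n; rewrite /pseries_diffs /f exprS factS natrM invfM.
  by rewrite -[_ *m _]/(_ * _) mulrCA mulVKf// pnatr_eq0.
have hl1 := real_linear_mull H hl; have hl2 := real_linear_mull H hl1.
have -> : (fun s => l (expflow s)) = fun s => limn (pseries (f l) s).
  by apply/funext => t; rewrite expflowE.
have -> : l (H *m expflow s) = limn (pseries (f (fun A => l (H *m A))) s).
  exact: (expflowE s hl1).
rewrite -diffs.
apply: (@pseries_snd_diffs R _ (`|s| + 1)).
- exact: cvg_expflow_series.
- by rewrite diffs; exact: cvg_expflow_series.
- by rewrite !diffs; exact: cvg_expflow_series.
- by rewrite [ltRHS]ger0_norm ?ltrDl// addr_ge0.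
Qed.

Lemma continuous_expflow l : real_linear l -> continuous (fun s => l (expflow s)).
Proof.
move=> hl s; apply: differentiable_continuous; apply/derivable1_diffP.
by have [] := is_derive_expflow s hl.
Qed.

Lemma measurable_expflow l : real_linear l ->
  measurable_fun setT (fun s => l (expflow s)).
Proof. by move=> hl; apply: continuous_measurable_fun; exact: continuous_expflow. Qed.

Lemma expflow0 : expflow 0 = 1%:M.
Proof.
apply/matrixP => i j; apply: scal_partP => c.
rewrite (expflowE 0 (real_linear_part c i j)).
apply: cvg_lim => //; rewrite -cvg_shiftS.
rewrite (_ : (fun n => _) = cst (scal_part c (1%:M i j : K))); first exact: cvg_cst.
apply/funext => n; rewrite /pseries /series/= big_nat_recl// big1 ?addr0.
  by rewrite expr0 divr1 mulr1.
by move=> m _; rewrite expr0n/= mulr0.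
Qed.

(** Close to time zero the flow is within [1/2] of the identity. The estimate
    bounds the size of a matrix by that of its image by the flow, uniformly over
    short times. *)
Lemma expflow_near1 : exists2 e : R, 0 < e &
  forall s, 0 <= s < e -> forall m (X : 'M[K]_(r, m)), mx_norm1 X <= 2 * mx_norm1 (expflow s *m X).
Proof.
have cN : (fun s => mx_norm1 (expflow s - 1%:M)) s @[s --> 0] --> (0 : R).
  rewrite [X in _ --> X](_ : _ = \sum_i \sum_j \sum_c
      `|scal_part c (expflow 0 i j) - scal_part c ((1%:M : 'M[K]_r) i j)|); last first.
    rewrite big1// => i _; rewrite big1// => j _; rewrite big1// => c _.
    by rewrite expflow0 subrr normr0.
  rewrite (_ : (fun s => _) = fun s => \sum_i \sum_j \sum_c
      `|scal_part c (expflow s i j) - scal_part c ((1%:M : 'M[K]_r) i j)|); last first.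
    apply/funext => s; apply: eq_bigr => i _; apply: eq_bigr => j _.
    by apply: eq_bigr => c _; rewrite !mxE scal_partD scal_partN.
  apply: cvg_sumr => i; apply: cvg_sumr => j; apply: cvg_sumr => c.
  apply: cvg_norm; apply: cvgB; last exact: cvg_cst.
  exact: (continuous_expflow (real_linear_part c i j)).
have /nbhs_ballP[e /= e0 he] : \forall s \near (0 : R), mx_norm1 (expflow s - 1%:M) < 2^-1.
  by apply: (cvgr_lt 0 cN); rewrite invr_gt0.
exists e => // s /andP[s0 se] m X.
have /he h : ball (0 : R) e s by rewrite /ball/= sub0r normrN ger0_norm.
have : mx_norm1 X <= mx_norm1 (expflow s *m X) + mx_norm1 (expflow s - 1%:M) * mx_norm1 X.
  have {1}-> : X = expflow s *m X + (- 1%:M *m ((expflow s - 1%:M) *m X)).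
    by rewrite mulNmx mul1mx mulmxBl mul1mx opprB addrC subrK.
  rewrite (le_trans (mx_norm1D _ _))// lerD2l mulNmx mul1mx.
  rewrite (_ : mx_norm1 (- _) = mx_norm1 ((expflow s - 1%:M) *m X)) ?mx_norm1M//.
  apply: eq_bigr => i _; apply: eq_bigr => j _; apply: eq_bigr => c _.
  by rewrite mxE scal_partN normrN.
have : mx_norm1 (expflow s - 1%:M) * mx_norm1 X <= 2^-1 * mx_norm1 X.
  by rewrite ler_wpM2r ?mx_norm1_ge0// ltW.
lra.
Qed.

End exponential.

(** * Integrals of derivatives on the half-line *)

Section ftc_decay.
Variable R : realType.
Notation mu := (@lebesgue_measure R).
Variables g g' : R -> R.
Hypotheses (dg : forall s : R, is_derive s (1 : R) g (g' s)) (cg' : continuous g').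
Hypothesis intg : mu.-integrable `]0, +oo[%classic (EFin \o g).
Hypothesis intg' : mu.-integrable `]0, +oo[%classic (EFin \o g').

Let cg : continuous g.
Proof.
move=> s; apply: differentiable_continuous; apply/derivable1_diffP.
by have [] := dg s.
Qed.

Let ftc (b : R) : 0 < b -> \int[mu]_(t in `]0, b]) g' t = g b - g 0.
Proof.
move=> b0.
have := @continuous_FTC2 R g' g 0 b b0.
rewrite -EFinB => /(_ _ _ _)h.
rewrite Rintegral_itv_obnd_cbnd; last first.
  by apply: integrableS intg' => //; apply: subset_itvl.
rewrite /Rintegral h//.
- by apply: continuous_subspaceT => x; exact: cg'.
- split=> [x _||].
  + by have [] := dg x.
  + by apply: cvg_at_right_filter; exact: cg.
  + by apply: cvg_at_left_filter; exact: cg.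
- by move=> x _; rewrite derive1E; have [_ ->] := dg x.
Qed.

Let G : R := \int[mu]_(t in `]0, +oo[) g' t.
Let tail (b : R) : R := \int[mu]_(t in `]b, +oo[) `|g' t|.

Let int_tail (f : R -> R) (b : R) : 0 <= b -> mu.-integrable `]0, +oo[%classic (EFin \o f) ->
  mu.-integrable `]b, +oo[%classic (EFin \o f).
Proof.
move=> b0; apply: integrableS => //.
by apply: subset_itvr; rewrite bnd_simp.
Qed.

Let tailP (b t : R) : 0 < b -> b <= t -> `|g t - (g 0 + G)| <= tail b.
Proof.
move=> b0 bt.
have t0 := lt_le_trans b0 bt.
have E : \int[mu]_(s in `]t, +oo[) g' s = g 0 + G - g t.
  rewrite -(Rintegral_itvB intg') ?bnd_simp//; last exact: ltW.
  by rewrite ftc// -/G; ring.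
rewrite distrC -E (le_trans (le_normr_Rintegral _ _))//; first exact: (int_tail (ltW t0)).
rewrite /Rintegral fine_le//.
- by apply: integrable_fin_num => //; apply: (int_tail (ltW t0)); exact: integrable_norm.
- by apply: integrable_fin_num => //; apply: (int_tail (ltW b0)); exact: integrable_norm.
apply: ge0_subset_integral => //.
- apply/measurable_EFinP; apply: measurable_funTS; apply: measurableT_comp => //.
  exact: continuous_measurable_fun.
- by apply: subset_itvr; rewrite bnd_simp.
Qed.

Let tail_cvg : tail n.+1%:R @[n --> \oo] --> 0.
Proof.
pose f (n : nat) (t : R) : R := `|g' t| * \1_(`]n.+1%:R, +oo[%classic : set R) t.
have mg' : measurable_fun setT g' by exact: continuous_measurable_fun.
have E n : tail n.+1%:R = fine (\int[mu]_(t in `]0%R, +oo[) (f n t)%:E)%E.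
  rewrite /tail /Rintegral; congr fine.
  have -> : (`]n.+1%:R, +oo[%classic : set R) = `]0, +oo[%classic `&` `]n.+1%:R, +oo[%classic.
    rewrite setIC; apply/esym/setIidl; apply: subset_itvr.
    by rewrite bnd_simp.
  rewrite integral_mkcondr; apply: eq_integral => t _.
  by rewrite /f patchE indicE; case: ifPn; rewrite ?mulr1 ?mulr0.
under eq_fun do rewrite E.
apply: (@cvg_trans _ ((fine \o (fun n => \int[mu]_(t in `]0%R, +oo[) (f n t)%:E)%E) @ \oo)) => //.
apply: fine_cvg; rewrite -[X in _ --> X](integral0 mu `]0, +oo[).
have D := @dominated_convergence _ _ R mu `]0%R, +oo[%classic (measurable_itv _)
  (fun n t => (f n t)%:E) (cst 0%E) (fun t => `|g' t|%:E).
have [] // := D.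
- move=> n; apply/measurable_EFinP; apply: measurable_funTS; apply: measurable_funM.
    exact: measurableT_comp.
  by apply: measurable_indic.
- apply: aeW => t _; apply: cvg_near_cst; near=> n.
  rewrite /f indicE memNset ?mulr0//= in_itv/= andbT; apply/negP; rewrite -leNgt.
  apply: (@le_trans _ _ n%:R); last by rewrite ler_nat.
  by near: n; exact: nbhs_infty_ger.
- exact: integrable_norm.
- apply: aeW => t n _; rewrite lee_fin /f normrM normr_id ler_piMr//.
  by rewrite indicE; case: (_ \in _); rewrite ?normr1 ?normr0.
Unshelve. all: by end_near. Qed.

(** The integral of [g'] is the limit of [g] at infinity minus [g 0]. The limit
    exists because [g'] is integrable, and it vanishes because [g] is. *)
Lemma integral_derive_decay : \int[mu]_(t in `]0, +oo[) g' t = - g 0.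
Proof.
apply/eqP; rewrite -addr_eq0 addrC -/G; apply: contraT => L0; exfalso.
pose L := g 0 + G.
have Lp : 0 < `|L| / 2 by rewrite divr_gt0// normr_gt0.
have [N hN] : exists N : nat, tail N.+1%:R < `|L| / 2.
  have /cvgrPdist_lt /(_ _ Lp)[N _ h] := tail_cvg.
  exists N; have := h N (leqnn _); rewrite sub0r normrN.
  exact: le_lt_trans (ler_norm _).
have gL t : N.+1%:R <= t -> `|L| / 2 <= `|g t|.
  move=> Nt; have h := tailP (ltr0Sn _ _) Nt.
  have := ler_normB (g t) (g t - L); rewrite opprB addrCA subrr addr0 -/L in h *.
  by move=> h'; have := le_trans h (ltW hN); move: h'; lra.
have : (\int[mu]_(t in `]N.+1%:R, +oo[) (`|L| / 2)%:E <= \int[mu]_(t in `]N.+1%:R, +oo[) `|(g t)%:E|)%E.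
  apply: ge0_le_integral => //.
  - apply: measurable_funTS; apply: measurableT_comp => //; apply/measurable_EFinP.
    exact: continuous_measurable_fun.
  - by move=> t; rewrite /= in_itv/= andbT => Nt; rewrite lee_fin gL// ltW.
rewrite integral_cst//= lebesgue_measure_itv/= ltry mulry gtr0_sg// mul1e.
rewrite leye_eq => /eqP h.
have /integrableP[_] := int_tail (ler0n _ N.+1) intg.
by rewrite h.
Qed.

End ftc_decay.

(** * Measurability on the space of paths *)

Section countable_cases.
Context d d' (X : measurableType d) (Y : measurableType d').

(** In the applications [kap] is the discrete shape of a path, or the index of the
    jump preceding a given time. *)
Lemma measurable_fun_cases (I : countType) (f : X -> Y) (kap : X -> I) (F : I -> X -> Y) :
  (forall i, measurable [set p | kap p = i]) ->
  (forall i, measurable_fun setT (F i)) ->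
  (forall p, f p = F (kap p) p) -> measurable_fun setT f.
Proof.
move=> mk mF fE _ B mB; rewrite setTI.
rewrite (_ : f @^-1` B = \bigcup_n (if unpickle n is Some i then
    [set p | kap p = i] `&` (F i @^-1` B) else set0)).
  apply: bigcupT_measurable => n; case: unpickle => [i|]; last exact: measurable0.
  by apply: measurableI => //; rewrite -[X in measurable X]setTI; exact: mF.
apply/seteqP; split => [p Bfp|p [n _]].
  by exists (pickle (kap p)) => //; rewrite pickleK; split => //=; rewrite -fE.
by case: unpickle => // i [/= <-]; rewrite -fE.
Qed.

Lemma measurable_find (P : nat -> X -> bool) (s : seq nat) (j : nat) :
  (forall k, measurable [set p | P k p]) ->
  measurable [set p | find (fun k => P k p) s = j].
Proof.
move=> mP; elim: s j => [|a s IH] j /=.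
  have [<-|j0] := eqVneq 0%N j; first by rewrite (_ : [set _ | _] = setT)//; exact/seteqP.
  rewrite (_ : [set _ | _] = set0); first exact: measurable0.
  by apply/seteqP; split => // p /= /eqP; rewrite (negbTE j0).
case: j => [|j].
  rewrite (_ : [set _ | _] = [set p | P a p])//.
  by apply/seteqP; split => p /=; case: ifP.
rewrite (_ : [set _ | _] =
    ~` [set p | P a p] `&` [set p | find (fun k => P k p) s = j]).
  by apply: measurableI => //; exact: measurableC.
apply/seteqP; split => p /=; first by case: ifP => // h [->].
by move=> [/negP/negbTE -> ->].
Qed.

End countable_cases.

Section cpath_measurability.
Variables (R : realType) (G : graph).
Local Notation cpath := (cpath R G).

Lemma measurable_cpath_of d (Z : measurableType d) x es n (f : Z -> n.-tuple (\bar R)) :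
  measurable_fun setT f -> measurable_fun setT (fun z => (x, es, val (f z)) : cpath).
Proof. by move=> mf _ A mA; exact: (mf measurableT _ (mA x es n)). Qed.

(* A total version of the projection to the holding times, faithful on the paths
   which have [n] of them. *)
Let holds_tuple n (g : cpath) : n.-tuple (\bar R) := insubd (nseq_tuple n 0%E) g.2.

Let measurable_holds_tuple n : measurable_fun setT (@holds_tuple n).
Proof.
move=> _ A mA; rewrite setTI; change (cpath_measurable (@holds_tuple n @^-1` A)).
move=> x es n'; rewrite /= /holds_tuple /=.
have [nn'|nn'] := eqVneq n' n.
  subst n'; rewrite (_ : [set _ | _] = A)//.
  by apply/seteqP; split => t /=; rewrite valKd.
rewrite (_ : [set _ | _] = [set t | A (nseq_tuple n 0%E)]); last first.
  by apply/seteqP; split => t /=; rewrite /insubd insubF//= size_tuple; exact/negbTE.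
have [h|h] := pselect (A (nseq_tuple n 0%E)).
  by rewrite (_ : [set _ | _] = setT)//; apply/seteqP; split.
by rewrite (_ : [set _ | _] = set0)//; apply/seteqP; split.
Qed.

Lemma measurable_cpath_shape d (Z : measurableType d) (s : vert G * seq (edge G) * nat) :
  measurable [set p : cpath * Z | (p.1.1, size p.1.2) = s].
Proof.
case: s => xes n0.
have mS : measurable [set g : cpath | (g.1, size g.2) = (xes, n0)].
  change (cpath_measurable [set g : cpath | (g.1, size g.2) = (xes, n0)]).
  move=> x es n /=.
  have [h|h] := pselect ((x, es, n) = (xes, n0)).
    rewrite (_ : [set _ | _] = setT)//; apply/seteqP; split => // t _ /=.
    by rewrite size_tuple -h.
  rewrite (_ : [set _ | _] = set0)//; apply/seteqP; split => // t /=.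
  rewrite size_tuple /= => e; apply: h.
  by case: e => <- <-.
rewrite (_ : [set _ | _] = fst @^-1` [set g : cpath | (g.1, size g.2) = (xes, n0)])//.
by rewrite -[X in measurable X]setTI; exact: measurable_fst.
Qed.

Lemma measurable_fun_cpath_prod d d' (Z : measurableType d) (Y : measurableType d')
    (f : cpath * Z -> Y) :
  (forall x es n, measurable_fun setT
     (fun p : n.-tuple (\bar R) * Z => f ((x, es, val p.1), p.2))) ->
  measurable_fun setT f.
Proof.
move=> mf.
apply: (@measurable_fun_cases _ _ _ _ (vert G * seq (edge G) * nat)%type f
  (fun p => (p.1.1, size p.1.2))
  (fun s p => f ((s.1.1, s.1.2, val (holds_tuple s.2 p.1)), p.2))).
- exact: measurable_cpath_shape.
- move=> [[x es] n] /=.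
  have mh : measurable_fun setT (fun p : cpath * Z => (holds_tuple n p.1, p.2)).
    apply: measurable_fun_pair; last exact: measurable_snd.
    exact: measurableT_comp (@measurable_holds_tuple n) measurable_fst.
  exact: measurableT_comp (mf x es n) mh.
- move=> [[[x es] ts] z] /=; congr (f ((_, _, _), _)).
  by rewrite /holds_tuple insubdK//; exact: eqxx.
Qed.

Lemma measurable_fun_cpath d' (Y : measurableType d') (f : cpath -> Y) :
  (forall x es n, measurable_fun setT
     (fun ts : n.-tuple (\bar R) => f (x, es, val ts))) ->
  measurable_fun setT f.
Proof.
move=> mf.
have mf2 : measurable_fun setT (fun p : cpath * unit => f p.1).
  apply: measurable_fun_cpath_prod => x es n.
  exact: (measurableT_comp (mf x es n) measurable_fst).
have := measurableT_comp mf2 (_ : measurable_fun setT (fun g : cpath => (g, tt))).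
by apply; apply: measurable_fun_pair => //; exact: measurable_cst.
Qed.

End cpath_measurability.

Section restriction_measurability.
Variables (R : realType) (G : wgraph R).
Local Notation cpath := (cpath R G).

(** The path which waits at [x] for a time [s], then jumps along [e] and follows
    [g]; it is meaningful when [g] starts at the target of [e]. *)
Definition cp_cons (x : vert G) (e : edge G) (s : R) (g : cpath) : cpath :=
  (x, e :: cp_edges g, s%:E :: cp_holds g).

Lemma measurable_cp_cons x e : measurable_fun setT
  (fun p : cpath * measurableTypeR R => cp_cons x e p.2 p.1).
Proof.
apply: measurable_fun_cpath_prod => y es n /=.
rewrite /cp_cons /cp_edges /cp_holds /=.
apply: (@measurable_cpath_of _ _ _ _ x (e :: es) n.+1
  (fun p : n.-tuple (\bar R) * measurableTypeR R => [tuple of (p.2)%:E :: p.1])).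
apply: measurable_cons; last exact: measurable_fst.
apply: measurableT_comp; last exact: measurable_snd.
exact: EFin_measurable.
Qed.

Section fixed_shape.
Variables (x : vert G) (es : seq (edge G)) (n : nat).
Local Notation Z := (n.-tuple (\bar R) * measurableTypeR R)%type.

Let measurable_nth j : measurable_fun setT (fun p : Z => nth 0%E (val p.1) j).
Proof.
have [jn|nj] := ltnP j n.
  have -> : (fun p : Z => nth 0%E (val p.1) j) = (fun p => tnth p.1 (Ordinal jn)).
    by apply/funext => p; rewrite (tnth_nth 0%E).
  exact: measurableT_comp (measurable_tnth _) measurable_fst.
have -> : (fun p : Z => nth 0%E (val p.1) j) = cst 0%E.
  by apply/funext => p; rewrite nth_default// size_tuple.
exact: measurable_cst.
Qed.

Let measurable_jump j : measurable_fun setT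
  (fun p : Z => cp_jump ((x, es, val p.1) : cpath) j).
Proof. by apply: emeasurable_sum => i; exact: measurable_nth. Qed.

Let measurable_time : measurable_fun setT (fun p : Z => (p.2)%:E).
Proof. by apply/measurable_EFinP; exact: measurable_snd. Qed.

Lemma measurable_cp_index j :
  measurable [set p : Z | cp_index ((x, es, val p.1) : cpath) p.2 = j].
Proof.
have := @measurable_find _ _ (fun k (p : Z) =>
  (p.2%:E < cp_jump ((x, es, val p.1) : cpath) k.+1)%E) (iota 0 (size es).+1) j.
apply => k.
rewrite -[X in measurable X]setTI.
by apply: measurable_lte => //; exact: measurable_jump.
Qed.

Lemma measurable_cp_restr_shape : measurable_fun setT
  (fun p : Z => cp_restr ((x, es, val p.1) : cpath) p.2).
Proof.
pose restr j (p : Z) : cpath := (x, take j es,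
  rcons (take j (val p.1)) (p.2%:E - cp_jump ((x, es, val p.1) : cpath) j)%E).
pose kap (p : Z) := cp_index ((x, es, val p.1) : cpath) p.2.
apply: (@measurable_fun_cases _ _ _ _ nat _ kap restr) => //.
  exact: measurable_cp_index.
move=> j; rewrite /restr.
have mseq m (f : nat -> Z -> \bar R) : (forall i, measurable_fun setT (f i)) ->
    measurable_fun setT (fun p => [tuple f (val i) p | i < m]).
  move=> mf; apply/measurable_fun_tnthP => i.
  have -> : (fun x0 : m.-tuple (\bar R) => tnth x0 i) \o (fun p => [tuple f (val i) p | i < m]) = f (val i).
    by apply/funext => p /=; rewrite tnth_mktuple.
  exact: mf.
pose m := minn j n.
pose f i (p : Z) := if (i < m)%N then nth 0%E (val p.1) i else (p.2%:E - cp_jump ((x, es, val p.1) : cpath) j)%E.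
have mf i : measurable_fun setT (f i).
  rewrite /f; case: (i < m)%N; first exact: measurable_nth.
  by apply: emeasurable_funB => //; exact: measurable_jump.
have := measurable_cpath_of x (take j es) (mseq m.+1 f mf).
congr (measurable_fun _ _); apply/funext => p; congr (_, _).
have sz : size (take j p.1) = m by rewrite size_take size_tuple /m; case: ltnP.
apply: (@eq_from_nth _ 0%E); first by rewrite size_tuple size_rcons sz.
move=> i; rewrite size_tuple ltnS => im.
have -> : [tuple f (val i) p | i < m.+1]`_i = f i p.
  by rewrite -[LHS]/(nth _ _ (Ordinal (im : (i < m.+1)%N))) -tnth_nth tnth_mktuple.
rewrite nth_rcons sz /f; case: ifP => // im'; last by rewrite eqn_leq im leqNgt im'.
by rewrite nth_take// (leq_trans im')// geq_minl.
Qed.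

Lemma measurable_cp_at_shape (y : vert G) : measurable
  [set p : Z | cp_at ((x, es, val p.1) : cpath) p.2 == y].
Proof.
have : measurable_fun setT (fun p : Z => cp_at ((x, es, val p.1) : cpath) p.2 == y).
  pose kap (p : Z) := cp_index ((x, es, val p.1) : cpath) p.2.
  apply: (@measurable_fun_cases _ _ _ _ nat _ kap
    (fun j _ => nth x (x :: [seq tgt e | e <- es]) j == y)) => //.
  exact: measurable_cp_index.
by move=> /(_ measurableT [set true] Logic.I); rewrite setTI.
Qed.

End fixed_shape.

Lemma measurable_cp_restr : measurable_fun setT
  (fun p : cpath * measurableTypeR R => cp_restr p.1 p.2).
Proof. by apply: measurable_fun_cpath_prod => x es n; exact: measurable_cp_restr_shape. Qed.

Lemma measurable_cp_at (y : vert G) (a : R) : measurable_fun setT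
  (fun p : cpath * measurableTypeR R => if cp_at p.1 p.2 == y then a else 0).
Proof.
apply: measurable_fun_cpath_prod => x es n /=.
apply: measurable_fun_ifT => //; apply: (@measurable_fun_bool _ _ _ _ true).
by rewrite setTI; exact: measurable_cp_at_shape.
Qed.

End restriction_measurability.

(** * The random walk *)

Section esum_countable.
Local Open Scope ereal_scope.
Context (R : realType) (I : countType) (S : set I).

Let term (a : I -> \bar R) k :=
  if pickle_inv k is Some i then (if i \in S then a i else 0) else 0.

Let esum_series (a : I -> \bar R) : (forall i, 0 <= a i) ->
  \esum_(i in S) a i = \sum_(k <oo) term a k.
Proof.
move=> a0; rewrite nneseries_esumT; last first.
  by move=> k; rewrite /term; case: pickle_inv => // i; case: ifP.
have Sinj : set_inj S pickle by move=> i j _ _; exact: (pcan_inj pickleK_inv).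
transitivity (\esum_(k in pickle @` S) term a k).
  rewrite esum_image//; apply: eq_esum => i Si.
  by rewrite /term pickleK_inv mem_set.
rewrite esum_mkcond; apply: eq_esum => k _.
case: ifPn => // /negP kS; rewrite /term.
have := @pickle_invK I k; case: pickle_inv => //= i ik.
case: ifPn => // /set_mem Si; exfalso; apply: kS.
by apply/mem_set; exists i.
Qed.

Lemma esumZl (c : R) (a : I -> \bar R) : (0 <= c)%R -> (forall i, 0 <= a i) ->
  \esum_(i in S) (c%:E * a i) = c%:E * \esum_(i in S) a i.
Proof.
move=> c0 a0; rewrite !esum_series//; last first.
  by move=> i; rewrite mule_ge0// lee_fin.
rewrite -nneseriesZl//; last first.
  by move=> k _; rewrite /term; case: pickle_inv => // i; case: ifP.
apply: eq_eseriesr => k _; rewrite /term.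
by case: pickle_inv => [i|]; [case: ifP|]; rewrite ?mule0.
Qed.

Context d (T : measurableType d) (M : {measure set T -> \bar R})
  (m_ : I -> {measure set T -> \bar R}).
Hypothesis ME : forall A, measurable A -> M A = \esum_(i in S) m_ i A.

Lemma ge0_integral_esum (f : T -> \bar R) : measurable_fun setT f ->
  (forall x, 0 <= f x) -> \int[M]_x f x = \esum_(i in S) \int[m_ i]_x f x.
Proof.
move=> mf f0.
pose n_ k : {measure set T -> \bar R} :=
  if pickle_inv k is Some i then (if i \in S then m_ i else mzero) else mzero.
transitivity (\int[mseries n_ 0%N]_x f x).
  apply: eq_measure_integral => A mA _; rewrite ME// esum_series//.
  rewrite /mseries/=; apply: eq_eseriesr => k _; rewrite /term /n_.
  by case: pickle_inv => // i; case: ifP.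
rewrite ge0_integral_measure_series// esum_series; last first.
  by move=> i; exact: integral_ge0.
apply: eq_eseriesr => k _; rewrite /term /n_.
by case: pickle_inv => [i|]; [case: ifP => _ //|]; rewrite integral_measure_zero.
Qed.

End esum_countable.

Section walk_theory.
Local Open Scope ereal_scope.
Variables (R : realType) (G : wgraph R).
Local Notation cpath := (cpath R G).

(** The graph is connected and has at least two vertices, so that an edge is
    issued from [x]. *)
Lemma lambda_gt0 (x : vert G) : (0 < lambda x)%R.
Proof.
have [e /eqP ex] : exists e : edge G, src e == x.
  have /set0Pn[w wW] := well_neq0 G.
  have [z zW] : exists z, z \notin well G.
    apply/existsP; rewrite -negb_forall; apply: contra (well_neqT G).
    by move=> /forallP h; apply/eqP/setP => z; rewrite h inE.
  have [z' xz'] : exists z', x != z'.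
    have [xw|xw] := eqVneq x w; last by exists w.
    by exists z; rewrite xw; apply: contraNneq zW => <-.
  have /connectP[[|y p] /= pp pl] := wgraph_connected x z'.
    by rewrite pl eqxx in xz'.
  by move: pp => /andP[/existsP[e /andP[ex _]] _]; exists e.
rewrite /lambda (bigD1 e)/=; last exact/eqP.
by rewrite ltr_pwDl ?chi_gt0// sumr_ge0// => ? _; rewrite ltW ?chi_gt0.
Qed.

Lemma jump_prob_gt0 (e : edge G) : (0 < jump_prob e)%R.
Proof. by rewrite divr_gt0 ?chi_gt0 ?lambda_gt0. Qed.

Lemma sum_jump_prob (x : vert G) : (\sum_(e : edge G | src e == x) jump_prob e = 1)%R.
Proof.
transitivity (\sum_(e : edge G | src e == x) chi e / lambda x)%R.
  by apply: eq_bigr => e /eqP <-.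
by rewrite -mulr_suml mulfV// gt_eqF ?lambda_gt0.
Qed.

Lemma walk_integral (x : vert G) (F : cpath -> \bar R) :
  measurable_fun setT F -> (forall g, 0 <= F g) ->
  \int[walk x]_g F g = \esum_(es in [set es | stopped x es])
    ((\prod_(e <- es) jump_prob e)%:E *
     \int[mpow (@exp_law R) (size es)]_ts F (walk_path x es ts)).
Proof.
move=> mF F0.
have p0 es : (0 <= \prod_(e <- es) @jump_prob R G e)%R.
  by apply: prodr_ge0 => e _; rewrite ltW ?jump_prob_gt0.
pose m_ es : {measure set cpath -> \bar R} := mscale (NngNum (p0 es))
  (measure_function_pushforward__canonical__measure_function_Measure
     (mpow (@exp_law R) (size es)) (@measurable_walk_path R G x es (size es))).
rewrite (@ge0_integral_esum R _ [set es | stopped x es] _ _ _ m_)//.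
apply: eq_esum => es _; rewrite ge0_integral_mscale//=; congr (_ * _).
by rewrite ge0_integral_pushforward//; exact: measurable_walk_path.
Qed.

Lemma eq_walk_integral (x : vert G) (F F' : cpath -> \bar R) :
  measurable_fun setT F -> (forall g, 0 <= F g) ->
  measurable_fun setT F' -> (forall g, 0 <= F' g) ->
  (forall es n (ts : n.-tuple (measurableTypeR R)), stopped x es -> size es = n ->
    F (walk_path x es ts) = F' (walk_path x es ts)) ->
  \int[walk x]_g F g = \int[walk x]_g F' g.
Proof.
move=> mF F0 mF' F'0 FF'; rewrite !walk_integral//; apply: eq_esum => es Ses.
by congr (_ * _); apply: eq_integral => ts _; exact: FF'.
Qed.

(** A discrete path from a proper vertex to the well has a first edge. *)
Lemma esum_stopped (x : vert G) (a : seq (edge G) -> \bar R) : x \notin well G ->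
  (forall es, 0 <= a es) ->
  \esum_(es in [set es | stopped x es]) a es =
  \sum_(e : edge G | src e == x) \esum_(es in [set es | stopped (tgt e) es]) a (e :: es).
Proof.
move=> xW a0.
transitivity (\esum_(es in [set es | stopped x es])
    \sum_(e : edge G | src e == x) (if ohead es == Some e then a es else 0)).
  apply: eq_esum => -[|e es] /=; first by rewrite (negbTE xW).
  move=> /and3P[_ ex _]; rewrite (bigD1 e)//= eqxx big1 ?adde0// => e' /andP[_ e'e].
  by case: eqP => // -[ee']; rewrite ee' eqxx in e'e.
rewrite esum_sum; last by move=> es e _ _; case: ifP.
apply: eq_bigr => e ex.
transitivity (\esum_(es in [set es | stopped x es] `&` [set es | ohead es = Some e]) a es).
  rewrite esum_mkcondr; apply: eq_esum => es _.
  by congr (if _ then _ else _); apply/eqP/idP => [h|/set_mem//]; exact: mem_set.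
rewrite (_ : _ `&` _ = cons e @` [set es | stopped (tgt e) es]).
  by rewrite esum_image// => es es' _ _ [].
apply/seteqP; split => [[|e' es] /= []|es [es' /= h] <-].
- by [].
- by move=> /and3P[_ _ h] [<-]; exists es.
- by rewrite /= xW ex h.
Qed.

(** The Markov property at the first jump. *)
Lemma walk_first_step (x : vert G) (F : cpath -> \bar R) : x \notin well G ->
  measurable_fun setT F -> (forall g, 0 <= F g) ->
  \int[walk x]_g F g = \sum_(e : edge G | src e == x)
    ((jump_prob e)%:E * \int[walk (tgt e)]_g \int[@exp_law R]_s F (cp_cons x e s g)).
Proof.
move=> xW mF F0.
have p0 es : (0 <= \prod_(e <- es) @jump_prob R G e)%R.
  by apply: prodr_ge0 => e _; rewrite ltW ?jump_prob_gt0.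
rewrite walk_integral// esum_stopped//; last first.
  by move=> es; rewrite mule_ge0 ?lee_fin// integral_ge0.
apply: eq_bigr => e ex.
have mFc : measurable_fun setT (fun p : cpath * measurableTypeR R => F (cp_cons x e p.2 p.1)).
  exact: measurableT_comp mF (measurable_cp_cons x e).
rewrite walk_integral; last 2 first.
- exact: (@measurable_fun_fubini_tonelli_F _ _ cpath _ R (@exp_law R) _ mFc).
- by move=> g; exact: integral_ge0.
rewrite -esumZl; last 2 first.
- by rewrite ltW ?jump_prob_gt0.
- by move=> es; rewrite mule_ge0 ?lee_fin ?integral_ge0// => ts _; exact: integral_ge0.
apply: eq_esum => es _; rewrite big_cons EFinM -muleA; congr (_ * (_ * _)).
rewrite ge0_integral_mpowS//.
by apply: measurableT_comp => //; exact: measurable_walk_path.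
Qed.

End walk_theory.

Section walk_mass.
Local Open Scope ereal_scope.
Variables (R : realType) (G : wgraph R).
Local Notation cpath := (cpath R G).

Let short (n : nat) : set cpath := [set g | (size (cp_edges g) <= n)%N].

Let measurable_short n : measurable (short n).
Proof.
change (cpath_measurable (short n)) => x es m.
have [h|h] := boolP (size es <= n)%N.
  by rewrite (_ : [set _ | _] = setT)//; apply/seteqP; split => // t _; exact: h.
rewrite (_ : [set _ | _] = set0)//; apply/seteqP; split => // t.
by rewrite /short /= /cp_edges /= (negbTE h).
Qed.

Let short_ind n g : 0 <= (\1_(short n) g : R)%:E. Proof. by rewrite lee_fin. Qed.

Let measurable_short_ind n : measurable_fun setT (fun g => (\1_(short n) g : R)%:E).
Proof. by apply/measurable_EFinP; exact: measurable_indic. Qed.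

Let walk_well (x : vert G) : x \in well G -> walk x setT = 1.
Proof.
move=> xW; rewrite /walk (_ : [set es | stopped x es] = [set [::]]); last first.
  by apply/seteqP; split => [[|e es]|es ->] //=; rewrite xW.
rewrite esum_set1/=; last by rewrite big_nil mul1e.
by rewrite big_nil mul1e preimage_setT diracT.
Qed.

Let exp_cst (c : \bar R) : \int[@exp_law R]_s c = c.
Proof. by rewrite integral_cst// [X in _ * X]probability_setT mule1. Qed.

Let walk_shortE n (x : vert G) :
  walk x (short n) = \int[walk x]_g (\1_(short n) g : R)%:E.
Proof. by rewrite integral_indic// setIT. Qed.

Let walk_short n (x : vert G) : walk x (short n) <= 1.
Proof.
elim: n x => [|n IH] x; (have [xW|xW] := boolP (x \in well G);
  first by rewrite -(walk_well xW); apply: le_measure; rewrite ?inE).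
- rewrite walk_shortE walk_first_step//.
  rewrite big1// => e _; rewrite integral0_eq ?mule0// => g _.
  by rewrite integral0_eq// => s _; rewrite indicE memNset.
- rewrite walk_shortE walk_first_step//.
  apply: (@le_trans _ _ (\sum_(e : edge G | src e == x) (jump_prob e)%:E)).
    apply: lee_sum => e _; rewrite -[leRHS]mule1; apply: lee_wpmul2l.
      by rewrite lee_fin ltW ?jump_prob_gt0.
    have E g s : \1_(short n.+1) (cp_cons x e s g) = \1_(short n) g :> R by [].
    under eq_integral => g _.
      under eq_integral do rewrite E.
      rewrite exp_cst; over.
    have := IH (tgt e); rewrite walk_shortE; apply: le_trans.
    by apply: ge0_le_integral => //.
  by rewrite sumEFin sum_jump_prob.
Qed.

Let walk_le1 (x : vert G) : walk x setT <= 1.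
Proof.
have -> : setT = \bigcup_n short n.
  by apply/esym/seteqP; split => // g _; exists (size (cp_edges g)) => //=; rewrite /short/=.
have h := @nondecreasing_cvg_mu _ _ R (walk x) short.
have {}h : walk x \o short @ \oo --> walk x (\bigcup_n short n).
  apply: h => //; first exact: bigcup_measurable.
  by move=> i j ij; apply/subsetPset => g /= /leq_trans; apply.
rewrite -(cvg_lim _ h)//; apply: lime_le.
  by apply/cvg_ex; exists (walk x (\bigcup_n short n)).
by apply: nearW => n; exact: walk_short.
Qed.

Let defect (x : vert G) : R := (1 - fine (walk x setT))%R.

Let walk_fin (x : vert G) : walk x setT = (1 - defect x)%:E.
Proof.
rewrite /defect opprB addrCA subrr addr0 fineK// ge0_fin_numE//.
exact: le_lt_trans (walk_le1 x) (ltry _).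
Qed.

Let defect_ge0 x : (0 <= defect x)%R.
Proof. by have := walk_le1 x; rewrite walk_fin lee_fin; lra. Qed.

Let defect_harmonic (x : vert G) : x \notin well G ->
  defect x = (\sum_(e : edge G | src e == x) jump_prob e * defect (tgt e))%R.
Proof.
move=> xW.
have : \int[walk x]_g (cst 1 g) = \sum_(e : edge G | src e == x)
    ((jump_prob e)%:E * \int[walk (tgt e)]_g \int[@exp_law R]_s cst 1 (cp_cons x e s g)).
  by rewrite walk_first_step.
have int1 z : \int[walk z]_g (1 : \bar R) = walk z setT by rewrite integral_cst// mul1e.
rewrite /cst int1 walk_fin.
under eq_bigr => e _.
  under eq_integral do rewrite exp_cst.
  rewrite int1 walk_fin -EFinM.
  over.
rewrite sumEFin => -[].
under eq_bigr do rewrite mulrBr mulr1.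
by rewrite sumrB sum_jump_prob; lra.
Qed.

(** Almost surely the walk reaches the well. The mass of the paths with at most
    [n] jumps is at most [1] by induction on [n], hence so is the total mass. The
    defect of mass is harmonic at the proper vertices and vanishes on the well, so
    that it is zero by the maximum principle on a connected graph. *)
Lemma walk_setT (x : vert G) : walk x setT = 1.
Proof.
rewrite walk_fin; congr EFin; suff -> : defect x = 0%R by rewrite subr0.
have [z _ zmax] := @arg_maxP _ R (vert G) x xpredT defect isT.
have zx := zmax x isT.
apply/eqP; rewrite eq_le defect_ge0 andbT; apply: contraT; rewrite -ltNge => dx0; exfalso.
have dz0 : (0 < defect z)%R by exact: lt_le_trans dx0 zx.
have dW w : w \in well G -> defect w = 0%R.
  by move=> wW; rewrite /defect walk_well//= subrr.
have step a b : defect a = defect z -> adj a b -> defect b = defect z.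
  move=> az /existsP[e /andP[/eqP ea /eqP eb]].
  have aW : a \notin well G by apply: contraTN dz0 => /dW; rewrite az => ->; rewrite ltxx.
  have : (\sum_(e' : edge G | src e' == a) jump_prob e' * (defect z - defect (tgt e')) = 0)%R.
    under eq_bigr do rewrite mulrBr.
    rewrite sumrB -mulr_suml sum_jump_prob mul1r -defect_harmonic//.
    by apply/eqP; rewrite subr_eq0 az.
  move/eqP; rewrite psumr_eq0; last first.
    move=> e' _; apply: mulr_ge0; first exact/ltW/jump_prob_gt0.
    by rewrite subr_ge0; exact: zmax.
  move=> /allP/(_ e (mem_index_enum _)); rewrite ea eqxx/= mulf_eq0 gt_eqF ?jump_prob_gt0//=.
  by rewrite subr_eq0 eb => /eqP.
have /set0Pn[w wW] := well_neq0 G.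
have /connectP[p] := wgraph_connected z w.
have : defect z = defect z by [].
move: {1 3 4}z => a; elim: p a => [|b p IH] a az /=.
  by move=> _ wa; move: dz0; rewrite -az -wa dW ?ltxx.
by move=> /andP[ab pp] pl; apply: (IH b) => //; exact: step ab.
Qed.

HB.instance Definition _ x := Measure_isProbability.Build _ _ R (walk x) (walk_setT x).

End walk_mass.

(** * First-step decomposition of the occupation measure *)

Section exp_law_integral.
Variable R : realType.
Notation mu := (@lebesgue_measure R).

(** The indicator that the time [t] is before the first jump, which occurs at
    time [s]. *)
Definition before (s t : R) : R := (0 < t < s)%R%:R.

Lemma before_ge0 s t : 0 <= before s t. Proof. exact: ler0n. Qed.

Lemma measurable_before : measurable_fun setT
  (fun p : measurableTypeR R * measurableTypeR R => before p.1 p.2).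
Proof.
rewrite (_ : (fun p : measurableTypeR R * measurableTypeR R => _) =
   fun p => if (0 < (p.2 : R)) && ((p.2 : R) < p.1) then 1 else 0 : R).
  apply: measurable_fun_ifT => //; apply: measurable_and => //.
    by apply: measurable_fun_ltr => //; exact: measurable_snd.
  by apply: measurable_fun_ltr; [exact: measurable_snd|exact: measurable_fst].
by apply/funext => p; rewrite /before; case: ifP.
Qed.

Lemma measurable_before_time s : measurable_fun setT
  (fun t : measurableTypeR R => before s t).
Proof. exact: measurableT_comp measurable_before (pair1_measurable s). Qed.

Local Open Scope ereal_scope.

Let pdf : R -> R := exponential_pdf 1.

Lemma ge0_integral_exp_law (f : measurableTypeR R -> \bar R) :
  measurable_fun setT f -> (forall s, 0 <= f s) ->
  \int[@exp_law R]_s f s = \int[mu]_(s in `]0%R, +oo[) (f s * (expR (- s))%:E).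
Proof.
move=> mf f0.
have mpdf : measurable_fun setT pdf by exact: measurable_exponential_pdf.
have pdf0 s : (0 <= pdf s)%R by exact: exponential_pdf_ge0.
rewrite (@ge0_integral_density _ _ R (@exp_law R) mu pdf)//.
transitivity (\int[mu]_(s in `[0%R, +oo[) (f s * (pdf s)%:E)).
  rewrite [RHS]integral_mkcond; apply: eq_integral => s _; rewrite patchE.
  case: ifPn => // /negP s0; rewrite /pdf lt0_exponential_pdf ?mule0//.
  by rewrite ltNge; apply/negP => s0'; apply: s0; rewrite inE/= in_itv/= s0'.
rewrite -integral_itv_obnd_cbnd; last first.
  by apply: measurable_funTS; apply: emeasurable_funM => //; exact/measurable_EFinP.
apply: eq_integral => s; rewrite inE/= in_itv/= andbT => s0.
by rewrite /pdf exponential_pdfE ?(ltW s0)// mul1r mulN1r.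
Qed.

Lemma eq_integral_exp_law (f f' : measurableTypeR R -> \bar R) :
  measurable_fun setT f -> (forall s, 0 <= f s) ->
  measurable_fun setT f' -> (forall s, 0 <= f' s) ->
  (forall s : R, (0 < s)%R -> f s = f' s) ->
  \int[@exp_law R]_s f s = \int[@exp_law R]_s f' s.
Proof.
move=> mf f0 mf' f'0 E; rewrite !ge0_integral_exp_law//.
by apply: eq_integral => s; rewrite inE/= in_itv/= andbT => /E ->.
Qed.

Lemma exp_law_gt (t : R) : (0 < t)%R -> @exp_law R `]t, +oo[ = (expR (- t))%:E.
Proof.
move=> t0; rewrite /exp_law /exponential_prob integral_itv_obnd_cbnd; last first.
  apply/measurable_EFinP; apply: measurable_funTS; exact: measurable_exponential_pdf.
rewrite (@ge0_continuous_FTC2y _ _ (fun x => - expR (- 1 * x))%R _ 0%R).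
- by rewrite mulN1r EFinN oppeK add0e.
- by move=> x _; exact: exponential_pdf_ge0.
- apply: continuous_subspaceW (@within_continuous_exponential_pdf R 1) => x /=.
  by rewrite !in_itv/= !andbT; apply: le_trans; exact: ltW.
- rewrite -oppr0; apply: cvgN.
  rewrite (_ : (fun x => expR (-1 * x)) = (fun z => expR (- z)))%R; first exact: cvgr_expR.
  by apply/funext => x; rewrite mulN1r.
- by move=> x _; exact: ex_derive.
- apply: cvgN; apply: cvg_at_right_filter; apply: continuous_comp; last exact: continuous_expR.
  by apply: cvgM; [exact: cvg_cst|exact: cvg_id].
- move=> x; rewrite in_itv/= andbT => tx; apply: derive1_exponential_pdf.
  by rewrite in_itv/= andbT (lt_trans t0).
Qed.

(** The tail of the exponential law of parameter 1 equals its density. Hence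
    integrating over all times before the first jump amounts to evaluating at the
    first jump. *)
Lemma exp_law_hazard (phi : measurableTypeR R -> \bar R) :
  measurable_fun setT phi -> (forall t, 0 <= phi t) ->
  \int[@exp_law R]_s \int[mu]_t (phi t * (before s t)%:E) =
  \int[@exp_law R]_t phi t.
Proof.
move=> mphi phi0.
have mf : measurable_fun setT (fun p : measurableTypeR R * measurableTypeR R =>
    phi p.2 * (before p.1 p.2)%:E).
  apply: emeasurable_funM; first exact: measurableT_comp.
  by apply/measurable_EFinP; exact: measurable_before.
rewrite (@fubini_tonelli _ _ _ _ R (@exp_law R) mu _ mf)/=; last first.
  by move=> p; rewrite mule_ge0// lee_fin before_ge0.
rewrite ge0_integral_exp_law// [RHS]integral_mkcond; apply: eq_integral => t _.
rewrite patchE; case: ifPn => [|/negP].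
  rewrite inE/= in_itv/= andbT => t0.
  rewrite ge0_integralZl//; last 2 first.
  - by apply/measurable_EFinP; exact: measurableT_comp measurable_before (pair2_measurable t).
  - by move=> s _; rewrite lee_fin before_ge0.
  congr (_ * _); rewrite -exp_law_gt//.
  transitivity (\int[@exp_law R]_s (\1_(`]t, +oo[%classic : set R) s : R)%:E); last first.
    by rewrite integral_indic// setIT.
  apply: eq_integral => s _; congr (_%:E); rewrite indicE /before; congr (_%:R).
  by rewrite mem_setE/= in_itv/= t0 andbT.
rewrite inE/= in_itv/= andbT => t0; rewrite integral0_eq// => s _.
by rewrite /before; case: ltP => //=; rewrite ?mule0// => /t0.
Qed.

End exp_law_integral.

Section nu_recursion.
Local Open Scope ereal_scope.
Variables (R : realType) (G : wgraph R).
Local Notation cpath := (cpath R G).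
Notation mu := (@lebesgue_measure R).

(** The integrand of [nu_int] as a function on a product space, for use with
    Tonelli. *)
Definition nu_integrand (y : vert G) (F : cpath -> \bar R)
    (p : cpath * measurableTypeR R) : \bar R :=
  F (cp_restr p.1 p.2) * (if cp_at p.1 p.2 == y then (lambda y)^-1 else 0)%:E *
  (\1_(`]0%R, +oo[%classic : set R) p.2)%:E.

Lemma nu_intE x y F :
  nu_int x y F = \int[walk x]_g \int[mu]_t nu_integrand y F (g, t).
Proof.
apply: eq_integral => g _; rewrite integral_mkcond; apply: eq_integral => t _.
rewrite patchE /nu_integrand indicE /=.
by case: (t \in _); rewrite ?mule1 ?mule0.
Qed.

Lemma measurable_pos_ind : measurable_fun setT
  (fun t : measurableTypeR R => (\1_(`]0%R, +oo[%classic : set R) t : R)).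
Proof. exact: measurable_indic. Qed.

Lemma measurable_nu_integrand y F : measurable_fun setT F ->
  measurable_fun setT (nu_integrand y F).
Proof.
move=> mF; apply: emeasurable_funM; first apply: emeasurable_funM.
- exact: measurableT_comp mF (@measurable_cp_restr R G).
- by apply/measurable_EFinP; exact: measurable_cp_at.
- by apply/measurable_EFinP; exact: measurableT_comp measurable_pos_ind measurable_snd.
Qed.

Lemma lambdaV_ge0 (y : vert G) (b : bool) : 0 <= (if b then (lambda y)^-1 else 0)%:E.
Proof. by case: b; rewrite lee_fin// invr_ge0 ltW ?lambda_gt0. Qed.

Lemma nu_integrand_ge0 y F : (forall g, 0 <= F g) -> forall p, 0 <= nu_integrand y F p.
Proof.
by move=> F0 p; rewrite /nu_integrand; apply: mule_ge0;
  [apply: mule_ge0 => //; exact: lambdaV_ge0|rewrite lee_fin].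
Qed.

Lemma cp_jump_cons x e s (g : cpath) j :
  cp_jump (cp_cons x e s g) j.+1 = s%:E + cp_jump g j.
Proof. by rewrite /cp_jump big_ord_recl. Qed.

Lemma cp_index_cons x e s (g : cpath) t :
  cp_index (cp_cons x e s g) t = if (t < s)%R then 0%N else (cp_index g (t - s)).+1.
Proof.
rewrite /cp_index.
have -> : iota 0 (size (cp_edges (cp_cons x e s g))).+1 =
    0%N :: map (addn 1) (iota 0 (size (cp_edges g)).+1) by rewrite -iotaDl.
move: (iota 0 (size (cp_edges g)).+1) => ks /=; rewrite cp_jump_cons [cp_jump g 0]big_ord0 adde0 lte_fin.
case: ltP => // _; congr S; rewrite find_map; apply: eq_find => j /=.
by rewrite add1n cp_jump_cons EFinB lteBlDl.
Qed.

Lemma cp_restr_cons_lt x e s (g : cpath) t : (t < s)%R ->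
  cp_restr (cp_cons x e s g) t = (x, [::], [:: t%:E]).
Proof.
by move=> ts; rewrite /cp_restr cp_index_cons ts /= /cp_jump big_ord0 sube0.
Qed.

Lemma cp_restr_cons_ge x e s (g : cpath) t : (s <= t)%R ->
  cp_restr (cp_cons x e s g) t = cp_cons x e s (cp_restr g (t - s)).
Proof.
move=> st; rewrite /cp_restr cp_index_cons ltNge st /= cp_jump_cons.
rewrite /cp_cons /cp_edges/= /cp_holds/=; congr (_, _, _ :: rcons _ _).
by rewrite (addeC s%:E) fin_num_oppeD// (addeC (- _)) addeA EFinB.
Qed.

Lemma cp_at_cons_lt x e s (g : cpath) t : (t < s)%R -> cp_at (cp_cons x e s g) t = x.
Proof. by move=> ts; rewrite /cp_at cp_index_cons ts. Qed.

Lemma cp_jump_walk_path (x : vert G) es n (ts : n.-tuple (measurableTypeR R)) j : (j <= n)%N ->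
  cp_jump (walk_path x es ts) j \is a fin_num.
Proof.
move=> jn; rewrite /cp_jump; apply/sum_fin_numP => i _ _.
have im : (i < n)%N by exact: leq_trans (ltn_ord i) jn.
rewrite /cp_holds /= nth_rcons size_map size_tuple im.
by rewrite (nth_map 0%R) ?size_tuple.
Qed.

Lemma cp_index_walk_path (x : vert G) es n (ts : n.-tuple (measurableTypeR R)) t : size es = n ->
  (cp_index (walk_path x es ts) t <= n)%N.
Proof.
move=> sz; rewrite /cp_index /cp_edges /= sz.
set P := fun k : nat => _.
have := has_find P (iota 0 n.+1); rewrite size_iota ltnS => <-.
apply/hasP; exists n; first by rewrite mem_iota/= add0n.
have fin := @cp_jump_walk_path x es n ts n (leqnn _).
have -> : P n = (t%:E < cp_jump (walk_path x es ts) n + +oo).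
  congr (_ < _); rewrite /cp_jump big_ord_recr/=; congr (_ + _).
  by rewrite /cp_holds /= nth_rcons size_map size_tuple ltnn eqxx.
by rewrite -(fineK fin) addey ?ltry.
Qed.

Lemma cp_at_cons_ge (x : vert G) e s es n (ts : n.-tuple (measurableTypeR R)) t : size es = n ->
  (s <= t)%R -> cp_at (cp_cons x e s (walk_path (tgt e) es ts)) t =
  cp_at (walk_path (tgt e) es ts) (t - s).
Proof.
move=> sz st; rewrite /cp_at cp_index_cons ltNge st /=.
apply: set_nth_default; rewrite /cp_vertices /cp_edges /= size_map sz ltnS.
exact: cp_index_walk_path.
Qed.

Lemma cp_restr_walk_path_size (x : vert G) es n (ts : n.-tuple (measurableTypeR R)) t : size es = n ->
  size (cp_holds (cp_restr (walk_path x es ts) t)) =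
  (size (cp_edges (cp_restr (walk_path x es ts) t))).+1.
Proof.
move=> sz; have h := cp_index_walk_path x ts t sz.
rewrite /cp_restr /cp_holds /cp_edges /= size_rcons !size_takel// ?sz//.
by rewrite size_rcons size_map size_tuple (leq_trans h).
Qed.

Section first_step.
Variables (y : vert G) (F : cpath -> \bar R).
Hypotheses (mF : measurable_fun setT F) (F0 : forall g, 0 <= F g).

Let same (x : vert G) : R := if x == y then (lambda y)^-1%R else 0%R.

Let measurable_trivial (x : vert G) :
  measurable_fun setT (fun t : measurableTypeR R => F (x, [::], [:: t%:E])).
Proof.
have m1 : measurable_fun setT (fun t : measurableTypeR R => [tuple t%:E]).
  by apply: measurable_cons => //; exact: measurable_cst.
exact: measurableT_comp mF (@measurable_cpath_of R G _ _ x [::] 1 _ m1).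
Qed.

Let measurable_consF x e s : measurable_fun setT (F \o cp_cons x e s).
Proof.
have h := measurableT_comp mF (@measurable_cp_cons R G x e).
exact: measurableT_comp h (pair2_measurable s).
Qed.

(* The times before and after the first jump, which occurs at time [s]. *)
Let occupation_cons (x : vert G) e s es n (ts : n.-tuple (measurableTypeR R)) :
  (0 < s)%R -> size es = n ->
  let g := walk_path (tgt e) es ts in
  \int[mu]_t nu_integrand y F (cp_cons x e s g, t) =
  (same x)%:E * \int[mu]_t (F (x, [::], [:: t%:E]) * (before s t)%:E) +
  \int[mu]_t nu_integrand y (F \o cp_cons x e s) (g, t).
Proof.
move=> s0 sz g.
have same0 : 0 <= (same x)%:E by exact: lambdaV_ge0.
have mtriv : measurable_fun setT (fun t : measurableTypeR R =>
    F (x, [::], [:: t%:E]) * (before s t)%:E).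
  by apply: emeasurable_funM => //; apply/measurable_EFinP; exact: measurable_before_time.
pose K u := F (cp_cons x e s (cp_restr g u)) *
  (if cp_at g u == y then (lambda y)^-1 else 0)%:E.
have mK : measurable_fun setT K.
  apply: emeasurable_funM.
    apply: (measurableT_comp (@measurable_consF x e s)).
    exact: measurableT_comp (@measurable_cp_restr R G) (pair1_measurable g).
  apply/measurable_EFinP.
  exact: measurableT_comp (measurable_cp_at y (lambda y)^-1) (pair1_measurable g).
have K0 u : 0 <= K u by rewrite mule_ge0// lambdaV_ge0.
pose f (t : measurableTypeR R) := K (t - s)%R * (\1_(`[s, +oo[%classic : set R) t)%:E.
have mf : measurable_fun setT f.
  apply: emeasurable_funM; last by apply/measurable_EFinP; exact: measurable_indic.
  by apply: measurableT_comp => //; exact: measurable_funB.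
have f0 t : 0 <= f t by rewrite mule_ge0// lee_fin before_ge0.
transitivity (\int[mu]_t ((same x)%:E * (F (x, [::], [:: t%:E]) * (before s t)%:E) + f t)).
  apply: eq_integral => t _; rewrite /nu_integrand/= /f !indicE !mem_setE/= !in_itv/= !andbT /before.
  have [lts|st] := ltP t s.
    rewrite cp_restr_cons_lt// cp_at_cons_lt// mule0 adde0 -/(same x) andbT.
    by rewrite muleAC muleC.
  rewrite cp_restr_cons_ge// /g cp_at_cons_ge// andbF mule0 mule0 add0e.
  by rewrite (lt_le_trans s0 st).
rewrite ge0_integralD//; last 2 first.
- by move=> t _; apply: mule_ge0 => //; apply: mule_ge0 => //; rewrite lee_fin before_ge0.
- by apply: emeasurable_funM => //; exact: measurable_cst.
rewrite ge0_integralZl//; last by move=> t _; apply: mule_ge0 => //; rewrite lee_fin before_ge0.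
congr (_ + _); rewrite -(@ge0_integral_shift R s f)//.
transitivity (\int[mu]_(u in `[0%R, +oo[) K u).
  rewrite [RHS]integral_mkcond; apply: eq_integral => u _.
  rewrite /f addrK patchE indicE !mem_setE/= !in_itv/= !andbT lerDr.
  by case: ifP; rewrite ?mule1 ?mule0.
rewrite -integral_itv_obnd_cbnd; last exact: measurable_funTS.
rewrite integral_mkcond; apply: eq_integral => u _.
rewrite patchE /nu_integrand/= indicE.
by case: ifP => /= _; rewrite ?mule1 ?mule0.
Qed.

Let measurable_occupation (F' : cpath -> \bar R) :
  measurable_fun setT F' -> (forall g, 0 <= F' g) ->
  measurable_fun setT (fun g => \int[mu]_t nu_integrand y F' (g, t)).
Proof.
move=> mF' F'0; apply: (@measurable_fun_fubini_tonelli_F _ _ _ _ R mu).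
  exact: measurable_nu_integrand.
exact: nu_integrand_ge0.
Qed.

Let occupation_ge0 (F' : cpath -> \bar R) g : (forall g, 0 <= F' g) ->
  0 <= \int[mu]_t nu_integrand y F' (g, t).
Proof. by move=> F'0; apply: integral_ge0 => t _; exact: nu_integrand_ge0. Qed.

Let measurable_occupation_cons x e : measurable_fun setT
  (fun p : cpath * measurableTypeR R =>
    \int[mu]_t nu_integrand y (F \o cp_cons x e p.2) (p.1, t)).
Proof.
pose f (q : (cpath * measurableTypeR R) * measurableTypeR R) :=
  nu_integrand y (F \o cp_cons x e q.1.2) (q.1.1, q.2).
have mf : measurable_fun setT f.
  have mgt : measurable_fun setT (fun q : (cpath * measurableTypeR R) * measurableTypeR R => (q.1.1, q.2)).
    apply: measurable_fun_pair; last exact: measurable_snd.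
    exact: measurableT_comp measurable_fst measurable_fst.
  apply: emeasurable_funM; first apply: emeasurable_funM.
  - have mrs : measurable_fun setT (fun q : (cpath * measurableTypeR R) * measurableTypeR R =>
        (cp_restr q.1.1 q.2, q.1.2)).
      apply: measurable_fun_pair; first exact: measurableT_comp (@measurable_cp_restr R G) mgt.
      exact: measurableT_comp measurable_snd measurable_fst.
    exact: measurableT_comp (measurableT_comp mF (@measurable_cp_cons R G x e)) mrs.
  - by apply/measurable_EFinP; exact: measurableT_comp (measurable_cp_at y (lambda y)^-1) mgt.
  - by apply/measurable_EFinP; exact: measurableT_comp measurable_pos_ind measurable_snd.
apply: (@measurable_fun_fubini_tonelli_F _ _ _ _ R mu f mf) => q.
by apply: nu_integrand_ge0 => g; exact: F0.
Qed.

Lemma measurable_nu_cons x e :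
  measurable_fun setT (fun s : measurableTypeR R => nu_int (tgt e) y (F \o cp_cons x e s)).
Proof.
rewrite (_ : (fun s : measurableTypeR R => _) = fun s =>
    \int[walk (tgt e)]_g \int[mu]_t nu_integrand y (F \o cp_cons x e s) (g, t)); last first.
  by apply/funext => s; rewrite nu_intE.
apply: (@measurable_fun_fubini_tonelli_G _ _ _ _ R (walk (tgt e)) _ (@measurable_occupation_cons x e)).
by move=> p; apply: occupation_ge0 => g; exact: F0.
Qed.

Lemma nu_int_ge0 x F' : (forall g, 0 <= F' g) -> 0 <= nu_int x y F'.
Proof.
by move=> F'0; rewrite nu_intE; apply: integral_ge0 => g _; exact: occupation_ge0.
Qed.

(** A walk issued from the well never visits [y]. *)
Lemma nu_int_well w : w \in well G -> y \notin well G -> nu_int w y F = 0.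
Proof.
move=> wW yW; rewrite nu_intE.
rewrite (@eq_walk_integral R G w _ (fun=> 0))//.
- exact: integral0.
- exact: measurable_occupation.
- by move=> g; exact: occupation_ge0.
move=> [|e es] n ts /=; last by rewrite wW.
move=> _ n0; apply: integral0_eq => t _; rewrite /nu_integrand/=.
have -> : cp_at (walk_path w [::] ts) t = w.
  rewrite /cp_at /cp_vertices /=.
  have := @cp_index_walk_path w [::] n ts t n0; move: (cp_index _ _) => i.
  by case: i => // i; rewrite -[X in (_ < X)%N]n0.
by rewrite ifF ?mule0 ?mul0e//; apply: contraNF yW => /eqP <-.
Qed.

(** Under [nu_{x,y}], a path either has not jumped yet, which requires [x = y] and
    leaves a trivial path of exponential lifetime, or consists of an exponential
    time at [x], a jump along some [e] and a path under [nu_{tgt e,y}]. *)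
Lemma nu_int_first_step x : x \notin well G ->
  nu_int x y F = (same x)%:E * \int[@exp_law R]_t F (x, [::], [:: t%:E]) +
  \sum_(e : edge G | src e == x) ((jump_prob e)%:E *
    \int[@exp_law R]_s nu_int (tgt e) y (F \o cp_cons x e s)).
Proof.
move=> xW; rewrite nu_intE walk_first_step//; last 2 first.
- exact: measurable_occupation.
- by move=> g; exact: occupation_ge0.
set C := (same x)%:E * _.
have C0 : 0 <= C by rewrite mule_ge0 ?lambdaV_ge0 ?integral_ge0.
have T0 e : 0 <= \int[@exp_law R]_s nu_int (tgt e) y (F \o cp_cons x e s).
  by apply: integral_ge0 => s _; apply: nu_int_ge0 => ?; exact: F0.
transitivity (\sum_(e : edge G | src e == x) ((jump_prob e)%:E *
    (C + \int[@exp_law R]_s nu_int (tgt e) y (F \o cp_cons x e s)))); last first.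
  under eq_bigr => e _ do rewrite ge0_muleDr//.
  rewrite big_split/=; congr (_ + _).
  rewrite -ge0_sume_distrl; last by move=> e _; rewrite lee_fin ltW ?jump_prob_gt0.
  by rewrite sumEFin sum_jump_prob mul1e.
apply: eq_bigr => e ex; congr (_ * _).
have mD := @measurable_occupation_cons x e.
have mB : measurable_fun setT (fun s : measurableTypeR R =>
    \int[mu]_t (F (x, [::], [:: t%:E]) * (before s t)%:E)).
  have mind : measurable_fun setT (fun p : measurableTypeR R * measurableTypeR R =>
      F (x, [::], [:: p.2%:E]) * (before p.1 p.2)%:E).
    apply: emeasurable_funM; first exact: measurableT_comp (@measurable_trivial x) measurable_snd.
    by apply/measurable_EFinP; exact: measurable_before.
  apply: (@measurable_fun_fubini_tonelli_F _ _ _ _ R mu _ mind) => p.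
  by rewrite mule_ge0// lee_fin before_ge0.
have mA : measurable_fun setT (fun s : measurableTypeR R =>
    (same x)%:E * \int[mu]_t (F (x, [::], [:: t%:E]) * (before s t)%:E)).
  by apply: emeasurable_funM; first exact: measurable_cst.
have A0 s : 0 <= (same x)%:E * \int[mu]_t (F (x, [::], [:: t%:E]) * (before s t)%:E).
  by rewrite mule_ge0 ?lambdaV_ge0 ?integral_ge0// => t _; rewrite mule_ge0// lee_fin before_ge0.
have mO := @measurable_occupation F mF F0.
have mOc : measurable_fun setT (fun p : cpath * measurableTypeR R =>
    \int[mu]_t nu_integrand y F (cp_cons x e p.2 p.1, t)).
  exact: measurableT_comp mO (@measurable_cp_cons R G x e).
transitivity (\int[walk (tgt e)]_g (C + \int[@exp_law R]_s
    \int[mu]_t nu_integrand y (F \o cp_cons x e s) (g, t))).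
  apply: eq_walk_integral.
  - apply: (@measurable_fun_fubini_tonelli_F _ _ _ _ R (@exp_law R) _ mOc) => p.
    by apply: occupation_ge0 => g; exact: F0.
  - by move=> g; apply: integral_ge0 => s _; apply: occupation_ge0 => ?; exact: F0.
  - apply: emeasurable_funD => //.
    apply: (@measurable_fun_fubini_tonelli_F _ _ _ _ R (@exp_law R) _ mD) => p.
    by apply: occupation_ge0 => g; exact: F0.
  - by move=> g; rewrite adde_ge0// integral_ge0// => s _; apply: occupation_ge0 => ?; exact: F0.
  move=> es n ts Ses sz; set g := walk_path _ _ _.
  have mDg : measurable_fun setT (fun s : measurableTypeR R =>
      \int[mu]_t nu_integrand y (F \o cp_cons x e s) (g, t)).
    exact: measurableT_comp mD (pair1_measurable g).
  transitivity (\int[@exp_law R]_s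
    ((same x)%:E * \int[mu]_t (F (x, [::], [:: t%:E]) * (before s t)%:E) +
     \int[mu]_t nu_integrand y (F \o cp_cons x e s) (g, t))).
    apply: eq_integral_exp_law.
    - exact: measurableT_comp mOc (pair1_measurable g).
    - by move=> s; apply: occupation_ge0 => ?; exact: F0.
    - exact: emeasurable_funD.
    - by move=> s; rewrite adde_ge0//; apply: occupation_ge0 => ?; exact: F0.
    - by move=> s s0; exact: occupation_cons.
  rewrite ge0_integralD//; last by move=> s _; apply: occupation_ge0 => ?; exact: F0.
  congr (_ + _); rewrite ge0_integralZl//; last 2 first.
  - by move=> s _; apply: integral_ge0 => t _; rewrite mule_ge0// lee_fin before_ge0.
  - exact: lambdaV_ge0.
  by rewrite exp_law_hazard.
rewrite ge0_integralD//; last 2 first.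
- by move=> g _; apply: integral_ge0 => s _; apply: occupation_ge0 => ?; exact: F0.
- apply: (@measurable_fun_fubini_tonelli_F _ _ _ _ R (@exp_law R) _ mD) => p.
  by apply: occupation_ge0 => g; exact: F0.
rewrite integral_cst// [X in _ * X]probability_setT mule1; congr (_ + _).
rewrite (@fubini_tonelli _ _ _ _ R (walk (tgt e)) (@exp_law R) _ mD); last first.
  by move=> p; apply: occupation_ge0 => g; exact: F0.
by apply: eq_integral => s _; rewrite nu_intE.
Qed.

End first_step.
End nu_recursion.

(** * Integrals of signed and matrix-valued functions of paths *)

Section integral_real_linear.
Context d (T : measurableType d) (R : realType) (k : scal_kind) (m n : nat).
Local Notation K := (scal R k).
Local Notation M := 'M[K]_(m, n).

(** Measurability of matrix-valued maps is that of the real coordinates of the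
    entries. A function is [mx_borel] if it can be composed with such maps, which
    avoids the choice of a sigma-field on matrices. *)
Definition mx_measurable d' (T' : measurableType d') (A : T' -> M) :=
  forall c i j, measurable_fun setT (fun t => scal_part c (A t i j)).

Definition mx_borel (f : M -> R) := forall d' (T' : measurableType d') (A : T' -> M),
  mx_measurable A -> measurable_fun setT (fun t => f (A t)).

Lemma real_linear_borel l : real_linear l -> mx_borel l.
Proof.
move=> hl d' T' A mA; under eq_fun do rewrite (real_linearE _ hl).
apply: measurable_sum => i; apply: measurable_sum => j; apply: measurable_sum => c.
by apply: measurable_funM => //; exact: mA.
Qed.

Lemma mx_norm1_borel : mx_borel (@mx_norm1 R k m n).
Proof.
move=> d' T' A mA.
apply: measurable_sum => i; apply: measurable_sum => j; apply: measurable_sum => c.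
by apply: measurableT_comp => //; exact: mA.
Qed.

Variable mu : {measure set T -> \bar R}.

(** Real-linear functionals are combinations of coordinates, hence commute with
    the entrywise integral. *)
Lemma integral_real_linear (A : T -> M) l :
  (forall c i j, mu.-integrable setT (fun t => (scal_part c (A t i j))%:E)) ->
  real_linear l ->
  mu.-integrable setT (fun t => (l (A t))%:E) /\
  (\int[mu]_t (l (A t))%:E = (l (mx_int (fun f : T -> \bar R => \int[mu]_t f t)%E A))%:E)%E.
Proof.
move=> iA hl.
have iZ c i j : mu.-integrable setT
    (fun t => (functional_coef l i j c)%:E * (scal_part c (A t i j))%:E)%E.
  exact: integrableZl.
have E t : ((l (A t))%:E = \sum_i \sum_j \sum_c
    (functional_coef l i j c)%:E * (scal_part c (A t i j))%:E)%E.
  rewrite (real_linearE _ hl) -sumEFin; apply: eq_bigr => i _.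
  by rewrite -sumEFin; apply: eq_bigr => j _; rewrite -sumEFin.
under eq_fun do rewrite E.
have i1 i j : mu.-integrable setT (fun t => \sum_c
    (functional_coef l i j c)%:E * (scal_part c (A t i j))%:E)%E.
  by apply: integrable_sum.
have i2 i : mu.-integrable setT (fun t => \sum_j \sum_c
    (functional_coef l i j c)%:E * (scal_part c (A t i j))%:E)%E.
  by apply: integrable_sum.
split; first by apply: integrable_sum.
rewrite integral_sum//; rewrite (real_linearE _ hl) -sumEFin; apply: eq_bigr => i _.
rewrite integral_sum//; rewrite -sumEFin; apply: eq_bigr => j _.
rewrite integral_sum//; rewrite -sumEFin; apply: eq_bigr => c _.
rewrite integralZl//; rewrite EFinM; congr (_ * _)%E.
by rewrite mxE scal_part_mk fineK//; exact: integrable_fin_num.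
Qed.

End integral_real_linear.

Section nu_signed.
Local Open Scope ereal_scope.
Variables (R : realType) (G : wgraph R) (x y : vert G).
Local Notation cpath := (cpath R G).
Notation mu := (@lebesgue_measure R).

Definition nu_weight (p : cpath * measurableTypeR R) : R :=
  ((if cp_at p.1 p.2 == y then (lambda y)^-1 else 0) *
    \1_(`]0%R, +oo[%classic : set R) p.2)%R.

Lemma nu_weight_ge0 p : (0 <= nu_weight p)%R.
Proof.
rewrite /nu_weight mulr_ge0//; case: ifP => // _.
by rewrite invr_ge0 ltW ?lambda_gt0.
Qed.

Lemma measurable_nu_weight : measurable_fun setT nu_weight.
Proof.
apply: measurable_funM; first exact: measurable_cp_at.
exact: measurableT_comp (@measurable_pos_ind R) measurable_snd.
Qed.

Lemma nu_integrandE (f : cpath -> R) p :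
  nu_integrand y (EFin \o f) p = (nu_weight p * f (cp_restr p.1 p.2))%:E.
Proof. by rewrite /nu_integrand /nu_weight/= -!EFinM; congr EFin; ring. Qed.

Let W : {measure set (cpath * measurableTypeR R) -> \bar R} := (walk x \x mu).

Section real_function.
Variable f : cpath -> R.
Hypothesis mf : measurable_fun setT f.

Lemma measurable_nu_real : measurable_fun setT
  (fun p : cpath * measurableTypeR R => (nu_weight p * f (cp_restr p.1 p.2))%:E).
Proof.
apply/measurable_EFinP; apply: measurable_funM; first exact: measurable_nu_weight.
exact: measurableT_comp mf (@measurable_cp_restr R G).
Qed.

Lemma ge0_nu_intE : (forall g, 0 <= f g)%R ->
  nu_int x y (EFin \o f) = \int[W]_p (nu_weight p * f (cp_restr p.1 p.2))%:E.
Proof.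
move=> f0; rewrite nu_intE fubini_tonelli1.
- by apply: eq_integral => g _; apply: eq_integral => t _; rewrite nu_integrandE.
- exact: measurable_nu_real.
- by move=> p; rewrite lee_fin mulr_ge0// nu_weight_ge0.
Qed.

End real_function.

Variable f : cpath -> R.
Hypothesis mf : measurable_fun setT f.
Hypothesis fin : nu_int x y (fun g => `|f g|%:E) < +oo.

Lemma nu_integrable : W.-integrable setT (fun p => (nu_weight p * f (cp_restr p.1 p.2))%:E).
Proof.
apply/integrableP; split; first exact: measurable_nu_real.
apply: le_lt_trans fin.
rewrite (ge0_nu_intE (measurableT_comp (@normr_measurable _ setT) mf)); last first.
  by move=> g; exact: normr_ge0.
rewrite le_eqVlt; apply/orP; left; apply/eqP; apply: eq_integral => p _ /=.
by rewrite normrM ger0_norm// nu_weight_ge0.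
Qed.

Lemma nu_int_realE : nu_int x y (EFin \o f) =
  \int[W]_p (nu_weight p * f (cp_restr p.1 p.2))%:E.
Proof.
rewrite nu_intE -(integral12_prod_meas1 nu_integrable).
by apply: eq_integral => g _; apply: eq_integral => t _; rewrite nu_integrandE.
Qed.

(** The first-step decomposition holds for nonnegative functions; signed ones
    reach it through their positive and negative parts. *)
Lemma nu_int_real_posneg :
  [/\ nu_int x y (fun g => (Num.max (f g) 0)%R%:E) \is a fin_num,
      nu_int x y (fun g => (Num.max (- f g) 0)%R%:E) \is a fin_num &
      nu_int x y (EFin \o f) = nu_int x y (fun g => (Num.max (f g) 0)%R%:E) -
                               nu_int x y (fun g => (Num.max (- f g) 0)%R%:E)].
Proof.
have mp : measurable_fun setT (fun g => Num.max (f g) 0)%R by apply: measurable_maxr.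
have mn : measurable_fun setT (fun g => Num.max (- f g) 0)%R.
  by apply: measurable_maxr => //; exact: measurableT_comp.
have Ep : nu_int x y (fun g => (Num.max (f g) 0)%R%:E) =
    \int[W]_p (fun p => (nu_weight p * f (cp_restr p.1 p.2))%:E)^\+ p.
  rewrite (ge0_nu_intE mp); last by move=> g; rewrite le_max lexx orbT.
  apply: eq_integral => p _; rewrite funeposE -EFin_max; congr EFin.
  by rewrite maxr_pMr ?nu_weight_ge0// mulr0.
have En : nu_int x y (fun g => (Num.max (- f g) 0)%R%:E) =
    \int[W]_p (fun p => (nu_weight p * f (cp_restr p.1 p.2))%:E)^\- p.
  rewrite (ge0_nu_intE mn); last by move=> g; rewrite le_max lexx orbT.
  apply: eq_integral => p _; rewrite funenegE -EFin_max; congr EFin.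
  by rewrite maxr_pMr ?nu_weight_ge0// mulr0 mulrN.
split.
- by rewrite Ep; apply: integrable_pos_fin_num => //; exact: nu_integrable.
- by rewrite En; apply: integrable_neg_fin_num => //; exact: nu_integrable.
- by rewrite nu_int_realE integralE -Ep -En.
Qed.

End nu_signed.

(** The paths charged by [nu_{x,y}] start at [x] and have one holding time more
    than jumps. *)
Lemma eq_nu_int (R : realType) (G : wgraph R) (x y : vert G) (F F' : cpath R G -> \bar R) :
  measurable_fun setT F -> (forall g, 0 <= F g)%E ->
  measurable_fun setT F' -> (forall g, 0 <= F' g)%E ->
  (forall g, cp_start g = x -> size (cp_holds g) = (size (cp_edges g)).+1 -> F g = F' g) ->
  nu_int x y F = nu_int x y F'.
Proof.
move=> mF F0 mF' F'0 FF'; rewrite !nu_intE; apply: eq_walk_integral.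
- apply: (@measurable_fun_fubini_tonelli_F _ _ _ _ R lebesgue_measure).
    exact: measurable_nu_integrand.
  exact: nu_integrand_ge0.
- by move=> g; apply: integral_ge0 => t _; exact: nu_integrand_ge0.
- apply: (@measurable_fun_fubini_tonelli_F _ _ _ _ R lebesgue_measure).
    exact: measurable_nu_integrand.
  exact: nu_integrand_ge0.
- by move=> g; apply: integral_ge0 => t _; exact: nu_integrand_ge0.
move=> es n ts _ sz; apply: eq_integral => t _; rewrite /nu_integrand/=.
by congr (_ * _ * _)%E; apply: FF' => //; exact: cp_restr_walk_path_size.
Qed.

Lemma le_nu_int (R : realType) (G : wgraph R) (x y : vert G) (F F' : cpath R G -> \bar R) :
  measurable_fun setT F -> (forall g, 0 <= F g)%E ->
  measurable_fun setT F' -> (forall g, F g <= F' g)%E ->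
  (nu_int x y F <= nu_int x y F')%E.
Proof.
move=> mF F0 mF' FF'.
have F'0 g : (0 <= F' g)%E by exact: le_trans (FF' g).
have mm F'' : measurable_fun setT F'' -> (forall g, 0 <= F'' g)%E ->
    measurable_fun setT (fun g => \int[lebesgue_measure]_t nu_integrand y F'' (g, t))%E.
  move=> mF'' F''0; apply: (@measurable_fun_fubini_tonelli_F _ _ _ _ R lebesgue_measure).
    exact: measurable_nu_integrand.
  exact: nu_integrand_ge0.
rewrite !nu_intE; apply: ge0_le_integral => //.
- by move=> g _; apply: integral_ge0 => t _; exact: nu_integrand_ge0.
- exact: mm.
- exact: mm.
move=> g _; apply: ge0_le_integral => //.
- by move=> t _; exact: nu_integrand_ge0.
- exact: measurableT_comp (measurable_nu_integrand y mF) (pair1_measurable g).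
- exact: measurableT_comp (measurable_nu_integrand y mF') (pair1_measurable g).
move=> t _; rewrite /nu_integrand/=; apply: lee_wpmul2r; first by rewrite lee_fin.
by apply: lee_wpmul2r => //; exact: lambdaV_ge0.
Qed.

Lemma ge0_nu_intZl (R : realType) (G : wgraph R) (x y : vert G) (a : R) (f : cpath R G -> R) :
  measurable_fun setT f -> (forall g, 0 <= f g) -> 0 <= a ->
  nu_int x y (fun g => (a * f g)%:E) = (a%:E * nu_int x y (fun g => (f g)%:E))%E.
Proof.
move=> mf f0 a0; rewrite (ge0_nu_intE _ _ (_ : measurable_fun setT (fun g => a * f g))); last 2 first.
- exact: measurable_funM.
- by move=> g; rewrite mulr_ge0.
rewrite (ge0_nu_intE _ _ mf)// -ge0_integralZl//.
- by apply: eq_integral => p _; rewrite -EFinM; congr EFin; ring.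
- exact: measurable_nu_real.
- by move=> p _; rewrite lee_fin mulr_ge0// nu_weight_ge0.
Qed.

(** * Holonomy along reversed paths *)

Section mx_measurability.
Variables (R : realType) (k : scal_kind).
Local Notation K := (scal R k).

Lemma measurable_scalM d (T : measurableType d) (a b : T -> K) c :
  (forall c', measurable_fun setT (fun t => scal_part c' (a t))) ->
  (forall c', measurable_fun setT (fun t => scal_part c' (b t))) ->
  measurable_fun setT (fun t => scal_part c (a t * b t)).
Proof.
case: k a b c => /= [a b c ma mb|a b c ma mb].
  exact: measurable_funM (ma tt) (mb tt).
have E t : (a t * b t) = Complex
   (complex.Re (a t) * complex.Re (b t) - complex.Im (a t) * complex.Im (b t))
   (complex.Re (a t) * complex.Im (b t) + complex.Im (a t) * complex.Re (b t)).
  by case: (a t) (b t) => [? ?] [? ?].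
under eq_fun do rewrite E.
have := ma false; have := ma true; have := mb false; have := mb true => /=.
move=> iB rB iA rA.
by case: c => /=; [apply: measurable_funD|apply: measurable_funB]; apply: measurable_funM.
Qed.

Lemma mx_measurableM d (T : measurableType d) m n p
    (A : T -> 'M[K]_(m, n)) (B : T -> 'M[K]_(n, p)) :
  mx_measurable A -> mx_measurable B -> mx_measurable (fun t => A t *m B t).
Proof.
move=> mA mB c i j; under eq_fun do rewrite mxE scal_part_sum.
by apply: measurable_sum => l; apply: measurable_scalM => c'; [exact: mA|exact: mB].
Qed.

Lemma mx_measurable_cst d (T : measurableType d) m n (A : 'M[K]_(m, n)) :
  mx_measurable (fun _ : T => A).
Proof. by move=> c i j; exact: measurable_cst. Qed.

Lemma mx_borel_mull r (B : 'M[K]_r) (f : 'M[K]_r -> R) : mx_borel f -> mx_borel (fun X => f (B *m X)).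
Proof.
move=> mf d T A mA; apply: mf.
exact: mx_measurableM (@mx_measurable_cst _ T r r B) mA.
Qed.

End mx_measurability.

Section holonomy_functional.
Variables (R : realType) (G : wgraph R) (k : scal_kind) (r : nat).
Variables (F : bundle G k r) (h : connection F) (H : potential F).
Local Notation K := (scal R k).
Local Notation M := 'M[K]_r.
Local Notation cpath := (cpath R G).

Definition hol_inv (g : cpath) : M := hol h H (cp_inv g).

Definition flow (x : vert G) (s : R) : M := expflow (- H x) s.

Lemma flowE x s : expmx (scal_of k (- s) *: H x) = flow x s.
Proof.
rewrite /flow /expflow; congr expmx.
have -> : scal_of k (- s) = - scal_of k s.
  by apply: scal_partP => c; rewrite scal_partN; case: k c => //= -[] //=; rewrite oppr0.
by rewrite scalerN scaleNr.
Qed.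

Lemma hol_rec_rcons z es ts e (s : \bar R) : size ts = (size es).+1 ->
  hol_rec h H z (rcons es e) (rcons ts s) =
  flow (tgt e) (fine s) *m transport h e *m hol_rec h H z es ts.
Proof.
have E x' t : expmx (scal_of k (- fine (t : \bar R)) *: H x') = flow x' (fine t).
  exact: flowE.
elim: es z ts => [|e' es IH] z [|t ts]; [discriminate| |discriminate|].
  case: ts => [_|t' ts]; last discriminate.
  by rewrite /= !E.
move=> [sz]; rewrite [rcons (_ :: _) _]/= [rcons (t :: ts) _]/= [LHS]/= (IH _ _ sz).
by rewrite /= !mulmxA.
Qed.

(** Reversal makes the first step of the path the last factor applied, that is,
    the leftmost one. Thus the holonomy of the inverse is a product which can be
    unrolled from the start of the path. *)
Lemma hol_inv_cons x e s (g : cpath) : src e = x -> cp_start g = tgt e ->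
  size (cp_holds g) = (size (cp_edges g)).+1 ->
  hol_inv (cp_cons x e s g) = flow x s *m transport h (einv e) *m hol_inv g.
Proof.
move=> ex ge sz; rewrite /hol_inv /hol /=.
have -> : cp_start (cp_inv (cp_cons x e s g)) = cp_start (cp_inv g).
  by rewrite /cp_inv /cp_start /= -ge.
rewrite [cp_edges _]/= [cp_holds _]/= /cp_edges/= /cp_holds/= !rev_cons.
rewrite hol_rec_rcons; last by rewrite !size_rev size_map.
by rewrite tgt_einv ex.
Qed.

Lemma hol_inv_trivial x s : hol_inv (x, [::], [:: s%:E]) = flow x s.
Proof. by rewrite /hol_inv /hol /= flowE. Qed.

Lemma mx_measurable_flow x : mx_measurable (fun s : measurableTypeR R => flow x s).
Proof.
by move=> c i j; exact: (@measurable_expflow R k r (- H x) _ (real_linear_part c i j)).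
Qed.

Lemma mx_measurable_hol_inv : mx_measurable hol_inv.
Proof.
move=> c i j; apply: measurable_fun_cpath => x es n.
have step d (T : measurableType d) z es' (fs : seq (T -> \bar R)) :
    (forall f, List.In f fs -> measurable_fun setT f) ->
    mx_measurable (fun t => hol_rec h H z es' [seq f t | f <- fs]).
  elim: fs es' z => [|f fs IH] es' z mf /=; first exact: mx_measurable_cst.
  have mQ w : mx_measurable (fun t => expmx (scal_of k (- fine (f t)) *: H w)).
    move=> c' i' j'; under eq_fun do rewrite flowE.
    apply: (measurableT_comp (mx_measurable_flow w c' i' j')).
    by apply: measurableT_comp => //; apply: mf; left.
  case: es' => [|e es']; first exact: mQ.
  have m1 : mx_measurable (fun t => hol_rec h H (tgt e) es' [seq f t | f <- fs]).
    by apply: IH => f' ff'; apply: mf; right.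
  have m2 := mx_measurableM m1 (@mx_measurable_cst R k _ T r r (transport h e)).
  exact: mx_measurableM m2 (mQ z).
pose fs := [seq (fun t : n.-tuple (\bar R) => tnth t l) | l <- rev (enum 'I_n)].
pose z := last (cp_start ((x, es, [::]) : cpath)) (cp_vertices ((x, es, [::]) : cpath)).
have E t : hol_inv (x, es, val t) =
    hol_rec h H z (rev [seq einv e | e <- es]) [seq f t | f <- fs].
  rewrite /hol_inv /hol/=; congr hol_rec.
  by rewrite /fs -map_comp /= map_rev map_tnth_enum.
under eq_fun do rewrite E.
apply: step => f; rewrite /fs => /(List.in_map_iff _ _ _)[l [<- _]].
exact: measurable_tnth.
Qed.

Lemma transport_unit e : transport h e \in unitmx.
Proof. by rewrite unitmx_mul conn_in_unit conn_out_unit. Qed.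

End holonomy_functional.

(** * Green matrices of multiplicative functionals *)

Lemma integral_of_posneg d (T : measurableType d) (R : realType)
    (mu : {measure set T -> \bar R}) (p n : T -> \bar R) (v : T -> R) :
  measurable_fun setT p -> measurable_fun setT n ->
  (forall t, 0 <= p t)%E -> (forall t, 0 <= n t)%E ->
  (\int[mu]_t p t < +oo)%E -> (\int[mu]_t n t < +oo)%E ->
  (forall t, ((v t)%:E = p t - n t)%E) ->
  mu.-integrable setT (EFin \o v) /\
  (\int[mu]_t (v t)%:E = \int[mu]_t p t - \int[mu]_t n t)%E.
Proof.
move=> mp mn p0 n0 ip iN E; under eq_integral do rewrite E.
have -> : EFin \o v = (p \- n)%E by apply/funext.
have Ip : mu.-integrable setT p.
  by apply/integrableP; split => //; under eq_integral do rewrite gee0_abs//.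
have In : mu.-integrable setT n.
  by apply/integrableP; split => //; under eq_integral do rewrite gee0_abs//.
by split; [exact: integrableB|rewrite integralB].
Qed.

(** Integrate the inequality over [I]. *)
Lemma bounded_of_integral_lty d (T : measurableType d) (R : realType)
    (mu : {measure set T -> \bar R}) (I : set T) (f : T -> \bar R) (a : \bar R) (c : R) :
  measurable I -> (0 < mu I)%E -> measurable_fun setT f -> (forall t, 0 <= f t)%E ->
  0 <= c -> (0 <= a)%E -> (forall t, I t -> (a <= c%:E * f t)%E) ->
  (\int[mu]_t f t < +oo)%E -> (a < +oo)%E.
Proof.
move=> mI mI0 mf f0 c0 a0 af intf.
have : (a * mu I <= c%:E * \int[mu]_t f t)%E.
  rewrite -integral_cst// -ge0_integralZl//.
  apply: (@le_trans _ _ (\int[mu]_(t in I) (c%:E * f t))%E).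
    apply: ge0_le_integral => //.
    by apply: emeasurable_funM => //; apply: measurable_funTS.
  apply: ge0_subset_integral => //; first by apply: emeasurable_funM.
  by move=> t _; rewrite mule_ge0.
rewrite ltNge => h; apply/negP; rewrite leye_eq => /eqP a1.
move: h; rewrite a1 gt0_mulye// leye_eq => /eqP h.
move: intf; rewrite -ge0_fin_numE; last exact: integral_ge0.
by move=> /fineK E; rewrite -E -EFinM in h.
Qed.

Lemma integrable_exp_law (R : realType) (f : measurableTypeR R -> R) :
  measurable_fun setT f -> (@exp_law R).-integrable setT (EFin \o f) ->
  lebesgue_measure.-integrable `]0, +oo[%classic (fun s : R => (f s * expR (- s))%:E) /\
  (\int[@exp_law R]_s (f s)%:E =
   \int[lebesgue_measure]_(s in `]0%R, +oo[) (f s * expR (- s))%:E)%E.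
Proof.
pose mu := @lebesgue_measure R; pose pdf : R -> R := exponential_pdf 1.
move=> mf intf.
have mpdf : measurable_fun setT pdf by exact: measurable_exponential_pdf.
have pdf0 s : 0 <= pdf s by exact: exponential_pdf_ge0.
have pdfE s : 0 < s -> pdf s = expR (- s).
  by move=> s0; rewrite /pdf exponential_pdfE ?(ltW s0)// mul1r mulN1r.
have := (integrable_density (m := @exp_law R) (mu := mu) mpdf pdf0 (fun A _ => erefl) mf).1 intf.
move=> intfp.
have mI : measurable (`]0%R, +oo[%classic : set (measurableTypeR R)) by exact: measurable_itv.
split.
  have h1 : mu.-integrable (`]0%R, +oo[%classic : set (measurableTypeR R))
      (fun s => (f s * pdf s)%:E).
    exact: (integrableS measurableT mI (@subsetT _ _) intfp).
  apply: eq_integrable h1; first exact: mI.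
  move=> s; rewrite inE/= in_itv/= andbT => s0.
  by rewrite pdfE.
rewrite (integral_density (m := @exp_law R) (mu := mu) mpdf pdf0 (fun A _ => erefl) mf).
transitivity (\int[mu]_(s in `[0%R, +oo[) (f s * pdf s)%:E)%E.
  rewrite [RHS]integral_mkcond; apply: eq_integral => s _; rewrite patchE.
  case: ifPn => // /negP s0; rewrite /pdf lt0_exponential_pdf ?mulr0//.
  by rewrite ltNge; apply/negP => s0'; apply: s0; rewrite inE/= in_itv/= s0'.
rewrite -integral_itv_obnd_cbnd; last first.
  apply/measurable_EFinP; apply: measurable_funTS.
  exact: (measurable_funM mf mpdf).
by apply: eq_integral => s; rewrite inE/= in_itv/= andbT => s0; rewrite pdfE.
Qed.

(** The derivative of [u s * expR (- s)] is the opposite of [u + v] times the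
    exponential density. *)
Lemma integral_exp_law_derive (R : realType) (u v : R -> R) :
  (forall s : R, is_derive s (1 : R) u (- v s)) -> continuous u -> continuous v ->
  (@exp_law R).-integrable setT (EFin \o u) ->
  (@exp_law R).-integrable setT (fun s => (u s + v s)%:E) ->
  (\int[@exp_law R]_s (u s + v s)%:E = (u 0)%:E)%E.
Proof.
move=> du cu cv iu iuv.
have mu : measurable_fun setT (u : measurableTypeR R -> R) by exact: continuous_measurable_fun.
have muv : measurable_fun setT ((fun s => u s + v s) : measurableTypeR R -> R).
  by apply: measurable_funD => //; exact: continuous_measurable_fun.
have [j1 _] := integrable_exp_law mu iu.
have [j2 f2] := integrable_exp_law muv iuv.
pose g (s : R) : R := u s * expR (- s).
pose g' (s : R) : R := - ((u s + v s) * expR (- s)).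
have dE (s : R) : is_derive s (1 : R) (fun s => expR (- s)) (- expR (- s)).
  have := is_derive1_comp (is_derive_expR (- s)) (is_deriveNid s (1 : R)).
  by rewrite mulrN1.
have dg (s : R) : is_derive s (1 : R) g (g' s).
  have h := is_deriveM (du s) (dE s).
  apply: (is_derive_eq h); rewrite /g' /GRing.scale/=.
  by ring.
have cE : continuous (fun s : R => expR (- s)).
  by move=> s; apply: continuous_comp; [exact: opp_continuous|exact: continuous_expR].
have cg' : continuous g'.
  by move=> s; apply: cvgN; apply: cvgM; [apply: cvgD; [exact: cu|exact: cv]|exact: cE].
have mI : measurable (`]0%R, +oo[%classic : set (measurableTypeR R)) by exact: measurable_itv.
have intg' : lebesgue_measure.-integrable `]0, +oo[%classic (EFin \o g').
  have h := integrableN j2; apply: eq_integrable h; first exact: mI.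
  by move=> s _; rewrite /g' /= EFinN.
have := integral_derive_decay dg cg' j1 intg'.
rewrite /g oppr0 expR0 mulr1 /Rintegral => h1.
have fin : (\int[lebesgue_measure]_(s in `]0%R, +oo[) ((u s + v s) * expR (- s))%:E)%E \is a fin_num.
  by apply: integrable_fin_num j2; exact: mI.
have E : (\int[lebesgue_measure]_(s in `]0%R, +oo[) (g' s)%:E =
    - \int[lebesgue_measure]_(s in `]0%R, +oo[) ((u s + v s) * expR (- s))%:E)%E.
  have jd := integrable_add_def mI j2; have <- := integralN jd.
  by apply: eq_integral => s _; rewrite /g' EFinN.
apply: (etrans f2); rewrite -(fineK fin); congr EFin.
by rewrite -[LHS]opprK -fineN -E h1 opprK.
Qed.

(** Only the multiplicative structure of the holonomy matters here: [Q x s] is the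
    contribution of a time [s] spent at [x], [Te e] that of a jump along [e], and
    [U] the resulting functional of the path. *)
Section multiplicative_functional.
Variables (R : realType) (G : wgraph R) (k : scal_kind) (r : nat).
Local Notation K := (scal R k).
Local Notation M := 'M[K]_r.
Local Notation cpath := (cpath R G).

Variables (U : cpath -> M) (Q : vert G -> R -> M) (Te : edge G -> M) (H : vert G -> M).
Hypotheses (mU : mx_measurable U) (Te_unit : forall e, Te e \in unitmx).
Hypothesis U_trivial : forall x (s : R), U (x, [::], [:: s%:E]) = Q x s.
Hypothesis U_cons : forall x e s (g : cpath), src e = x -> cp_start g = tgt e ->
  size (cp_holds g) = (size (cp_edges g)).+1 ->
  U (cp_cons x e s g) = Q x s *m Te e *m U g.
Hypothesis Q0 : forall x, Q x 0 = 1%:M.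
Hypothesis Q_derive : forall x l (s : R), real_linear l ->
  is_derive s (1 : R) (fun s => l (Q x s)) (- l (H x *m Q x s)).
Hypothesis Q_near1 : forall x, exists2 e : R, 0 < e &
  forall s, 0 <= s < e -> forall m (X : 'M[K]_(r, m)), mx_norm1 X <= 2 * mx_norm1 (Q x s *m X).

Variable y : vert G.

Definition nu_mx (x : vert G) (f : M -> R) : \bar R :=
  nu_int x y (fun g => (f (U g))%:E).

Lemma measurable_hol_fun (f : M -> R) : mx_borel f ->
  measurable_fun setT (fun g => f (U g)).
Proof. by move=> mf; apply: mf; exact: mU. Qed.

Lemma measurable_hol_efun (f : M -> R) : mx_borel f ->
  measurable_fun setT (fun g => (f (U g))%:E).
Proof. by move=> mf; apply/measurable_EFinP; exact: measurable_hol_fun. Qed.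

Lemma nu_mx_cons x e s (f : M -> R) : src e = x -> mx_borel f -> (forall X, 0 <= f X) ->
  nu_int (tgt e) y ((fun g => (f (U g))%:E) \o cp_cons x e s) =
  nu_mx (tgt e) (fun X => f (Q x s *m Te e *m X)).
Proof.
move=> ex mf f0; apply: eq_nu_int.
- have h1 := measurableT_comp (measurable_hol_efun mf) (@measurable_cp_cons R G x e).
  exact: measurableT_comp h1 (pair2_measurable s).
- by move=> g; rewrite lee_fin.
- exact: measurable_hol_efun (mx_borel_mull (Q x s *m Te e) mf).
- by move=> g; rewrite lee_fin.
- by move=> g ge sz /=; rewrite U_cons.
Qed.

Lemma measurable_nu_mx_cons x e (f : M -> R) : src e = x -> mx_borel f -> (forall X, 0 <= f X) ->
  measurable_fun setT (fun s : measurableTypeR R =>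
    nu_mx (tgt e) (fun X => f (Q x s *m Te e *m X))).
Proof.
move=> ex mf f0.
have E : (fun s : measurableTypeR R =>
    nu_mx (tgt e) (fun X => f (Q x s *m Te e *m X))) =
    (fun s => nu_int (tgt e) y ((fun g => (f (U g))%:E) \o cp_cons x e s)).
  by apply/funext => s; apply/esym; exact: nu_mx_cons.
rewrite E; apply: measurable_nu_cons; first exact: measurable_hol_efun.
by move=> g; rewrite lee_fin.
Qed.

Lemma nu_mx_ge0 x (f : M -> R) : (forall X, 0 <= f X) -> (0 <= nu_mx x f)%E.
Proof. by move=> f0; apply: nu_int_ge0 => g; rewrite lee_fin. Qed.

Lemma nu_mx_first_step x (f : M -> R) : x \notin well G ->
  mx_borel f -> (forall X, 0 <= f X) ->
  (nu_mx x f =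
   (if x == y then (lambda y)^-1 else 0)%:E * \int[@exp_law R]_s (f (Q x s))%:E +
   \sum_(e : edge G | src e == x) (jump_prob e)%:E *
     \int[@exp_law R]_s nu_mx (tgt e) (fun X => f (Q x s *m Te e *m X)))%E.
Proof.
move=> xW mf f0.
have f0' g : (0 <= (f (U g))%:E)%E by rewrite lee_fin.
rewrite [LHS](@nu_int_first_step R G y _ (measurable_hol_efun mf) f0' x xW).
have E1 s : f (U (x, [::], [:: s%:E])) = f (Q x s) by rewrite U_trivial.
have E2 e : src e == x ->
    (\int[@exp_law R]_s nu_int (tgt e) y ((fun g => (f (U g))%:E) \o cp_cons x e s) =
     \int[@exp_law R]_s nu_mx (tgt e) (fun X => f (Q x s *m Te e *m X)))%E.
  by move=> /eqP ex; apply: eq_integral => s _; exact: nu_mx_cons.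
have E3 : (\int[@exp_law R]_s (f (U (x, [::], [:: s%:E])))%:E =
           \int[@exp_law R]_s (f (Q x s))%:E)%E.
  by apply: eq_integral => s _; rewrite E1.
rewrite E3; apply: congr1; apply: eq_bigr => e ex; apply: congr1; exact: E2.
Qed.

(** The norm controls all the coordinates of [U] at once, and is nonnegative, so
    that the first-step decomposition applies to it. *)
Definition summable_from (x : vert G) : Prop := (nu_mx x (@mx_norm1 R k r r) < +oo)%E.

(** Summability propagates along edges. By the first-step decomposition, the
    integral over the paths from [tgt e] to [y] of the norm of
    [Q x s *m Te e *m U] is integrable in [s]. For small [s] the matrix [Q x s] is
    close to the identity, and [Te e] is invertible, so that the integrand controls
    the norm of [U] on a set of times of positive measure. *)
Lemma summable_neighbor x e : x \notin well G -> src e = x ->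
  summable_from x -> summable_from (tgt e).
Proof.
move=> xW ex Sx; pose B := Te e.
have [eps eps0 hflow] := Q_near1 x.
pose c := mx_norm1 (invmx B) * 2.
have c0 : 0 <= c by rewrite mulr_ge0// mx_norm1_ge0.
have N0 (X : M) : 0 <= mx_norm1 X by exact: mx_norm1_ge0.
have mN := @mx_norm1_borel R k r r.
have mNs : measurable_fun setT (fun s : measurableTypeR R =>
    nu_mx (tgt e) (fun X => mx_norm1 (Q x s *m B *m X))) by exact: measurable_nu_mx_cons.
have le_small s : 0 <= s < eps ->
    (nu_mx (tgt e) (@mx_norm1 R k r r) <=
     c%:E * nu_mx (tgt e) (fun X => mx_norm1 (Q x s *m B *m X)))%E.
  move=> hs.
  have mQB : measurable_fun setT (fun g => mx_norm1 (Q x s *m B *m U g)).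
    exact: (measurable_hol_fun (mx_borel_mull (Q x s *m B) mN)).
  have -> := esym (@ge0_nu_intZl R G (tgt e) y c _ mQB (fun g => N0 _) c0).
  apply: le_nu_int.
  - exact: measurable_hol_efun.
  - by move=> g; rewrite lee_fin.
  - by apply/measurable_EFinP; exact: measurable_funM.
  move=> g; rewrite lee_fin; set X := U g.
  have -> : mx_norm1 X = mx_norm1 (invmx B *m (B *m X)) by rewrite mulKmx// Te_unit.
  rewrite (le_trans (mx_norm1M _ _))// /c -mulrA ler_wpM2l//.
  by rewrite -mulmxA; exact: hflow.
have intfin : (\int[@exp_law R]_s nu_mx (tgt e) (fun X => mx_norm1 (Q x s *m B *m X)) < +oo)%E.
  move: Sx; rewrite /summable_from nu_mx_first_step// (bigD1 e)/=; last exact/eqP.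
  set C := (_ * _)%E; set T := (\sum_(_ | _) _)%E; set J := (\int[_]_s _)%E.
  have C0 : (0 <= C)%E.
    by rewrite mule_ge0 ?lambdaV_ge0// integral_ge0// => s _; rewrite lee_fin.
  have T0 : (0 <= T)%E.
    apply: sume_ge0 => e' _; apply: mule_ge0; first by rewrite lee_fin ltW ?jump_prob_gt0.
    by apply: integral_ge0 => s _; exact: nu_mx_ge0.
  have J0 : (0 <= J)%E by apply: integral_ge0 => s _; exact: nu_mx_ge0.
  move=> h1; have : ((jump_prob e)%:E * J < +oo)%E.
    by apply: le_lt_trans h1; rewrite addeCA leeDl// adde_ge0.
  rewrite -{1}(gee0_abs J0) => h2; rewrite ltNge; apply/negP; rewrite leye_eq => /eqP J1.
  by move: h2; rewrite J1 /= gt0_muley ?ltxx// lte_fin jump_prob_gt0.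
pose I := `[0%R, eps / 2]%classic : set (measurableTypeR R).
have mI : measurable I by exact: measurable_itv.
have expI : (0 < @exp_law R I)%E.
  rewrite (_ : @exp_law R I = (1 - (expR (- 1 * (eps / 2)))%:E)%E); last first.
    by apply: exponential_prob_itv0c; rewrite divr_gt0.
  rewrite mulN1r -EFinB lte_fin subr_gt0.
  by rewrite -expR0 ltr_expR oppr_lt0 divr_gt0.
have nuQ0 s : (0 <= nu_mx (tgt e) (fun X => mx_norm1 (Q x s *m B *m X)))%E.
  by apply: nu_mx_ge0.
have nu0 : (0 <= nu_mx (tgt e) (@mx_norm1 R k r r))%E by apply: nu_mx_ge0.
apply: (bounded_of_integral_lty mI expI mNs nuQ0 c0 nu0 _ intfin) => s.
rewrite /I/= in_itv/= => /andP[s0 s1]; apply: le_small.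
by rewrite s0/= (le_lt_trans s1)// ltr_pdivrMr// ltr_pMr// ltr1n.
Qed.

Definition green_mx (x : vert G) : M := mx_int (nu_int x y) U.

Lemma summable_dominated x (f : M -> R) (C : R) : summable_from x -> mx_borel f ->
  0 <= C -> (forall X, `|f X| <= C * mx_norm1 X) ->
  (nu_int x y (fun g => `|f (U g)|%:E) < +oo)%E.
Proof.
move=> Sx mf C0 fC.
have mN := measurable_hol_fun (@mx_norm1_borel R k r r).
apply: (@le_lt_trans _ _ (nu_int x y (fun g => (C * mx_norm1 (U g))%:E))).
  apply: le_nu_int.
  - apply/measurable_EFinP; apply: measurableT_comp => //; exact: measurable_hol_fun.
  - by move=> g; rewrite lee_fin.
  - by apply/measurable_EFinP; apply: measurable_funM.
  - by move=> g; rewrite lee_fin.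
rewrite ge0_nu_intZl//; last by move=> g; exact: mx_norm1_ge0.
have : nu_int x y (fun g => (mx_norm1 (U g))%:E) \is a fin_num.
  by rewrite ge0_fin_numE//; apply: nu_mx_ge0 => X; exact: mx_norm1_ge0.
by move=> /fineK <-; rewrite -EFinM ltry.
Qed.

Lemma summable_real_linear x l : summable_from x -> real_linear l ->
  (nu_int x y (fun g => `|l (U g)|%:E) < +oo)%E.
Proof.
move=> Sx hl; have [C C0 hC] := real_linear_bound hl.
exact: (summable_dominated Sx (real_linear_borel hl) C0 hC).
Qed.

(** Integration over the times and the paths is integration over one product
    space, on which real-linear functionals commute with the integral. *)
Lemma nu_mx_real_linear x l : summable_from x -> real_linear l ->
  nu_mx x l = (l (green_mx x))%:E.
Proof.
move=> Sx hl.
pose A (p : cpath * measurableTypeR R) : M :=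
  scal_of k (nu_weight y p) *: U (cp_restr p.1 p.2).
pose W : {measure set (cpath * measurableTypeR R) -> \bar R} := (walk x \x lebesgue_measure)%E.
have lA l' : real_linear l' -> forall p, l' (A p) = nu_weight y p * l' (U (cp_restr p.1 p.2)).
  by move=> hl' p; rewrite /A hl'.2.
have intA l' : real_linear l' -> nu_mx x l' = (\int[W]_p (l' (A p))%:E)%E.
  move=> hl'; have := nu_int_realE (measurable_hol_fun (real_linear_borel hl')) (summable_real_linear Sx hl').
  by move=> E; apply: (etrans E); apply: eq_integral => p _; rewrite lA.
have iA c i j : W.-integrable setT (fun p => (scal_part c (A p i j))%:E).
  have hp := @real_linear_part R k r r c i j.
  have h1 := nu_integrable (measurable_hol_fun (real_linear_borel hp)) (summable_real_linear Sx hp).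
  move: h1; congr (integrable _ _ _); apply/funext => p; congr EFin.
  exact: (esym (lA _ hp p)).
rewrite intA// (integral_real_linear iA hl).2; congr (l _)%:E.
apply/matrixP => i j; rewrite !mxE /scal_int; congr scal_mk; apply/funext => c.
congr fine; exact: (esym (intA _ (@real_linear_part R k r r c i j))).
Qed.

Lemma first_step_lty x (f : M -> R) : x \notin well G -> mx_borel f -> (forall X, 0 <= f X) ->
  (nu_mx x f < +oo)%E ->
  ((if x == y then (lambda y)^-1 else 0)%:E * \int[@exp_law R]_s (f (Q x s))%:E < +oo)%E /\
  (forall e, src e = x ->
   (\int[@exp_law R]_s nu_mx (tgt e) (fun X => f (Q x s *m Te e *m X)) < +oo)%E).
Proof.
move=> xW mf f0; rewrite (nu_mx_first_step xW mf f0).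
set C := (_ * _)%E; pose J e := (\int[@exp_law R]_s nu_mx (tgt e) (fun X => f (Q x s *m Te e *m X)))%E.
have C0 : (0 <= C)%E.
  by rewrite mule_ge0 ?lambdaV_ge0// integral_ge0// => s _; rewrite lee_fin.
have J0 e : (0 <= J e)%E by apply: integral_ge0 => s _; exact: nu_mx_ge0.
have PJ0 e : (0 <= (jump_prob e)%:E * J e)%E.
  by apply: mule_ge0 => //; rewrite lee_fin ltW ?jump_prob_gt0.
suff : (C + \sum_(e : edge G | src e == x) (jump_prob e)%:E * J e < +oo)%E ->
    (C < +oo)%E /\ (forall e, src e = x -> (J e < +oo)%E) by [].
move: (J) J0 PJ0 => {}J J0 PJ0 h1; split.
  by apply: le_lt_trans h1; rewrite leeDl//; apply: sume_ge0 => e _; exact: PJ0.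
move=> e /eqP ex; have h2 : ((jump_prob e)%:E * J e < +oo)%E.
  apply: le_lt_trans h1; rewrite (bigD1 e)//= addeCA leeDl// adde_ge0//.
  by apply: sume_ge0 => e' _; exact: PJ0.
rewrite ltNge; apply/negP; rewrite leye_eq => /eqP J1.
by move: h2; rewrite J1 gt0_muley ?ltxx// lte_fin jump_prob_gt0.
Qed.

(** What remains of the path after the holding time at [x], averaged: either the
    path ends there, or it jumps to a neighbour. *)
Definition step_mx (x : vert G) : M :=
  scal_of k (if x == y then (lambda y)^-1 else 0) *: 1%:M +
  \sum_(e : edge G | src e == x) scal_of k (jump_prob e) *: (Te e *m green_mx (tgt e)).

Let pos l (X : M) : R := Num.max (l X) 0.
Let neg l (X : M) : R := Num.max (- l X) 0.

Let pos_ge0 l X : 0 <= pos l X. Proof. by rewrite le_max lexx orbT. Qed.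
Let neg_ge0 l X : 0 <= neg l X. Proof. by rewrite le_max lexx orbT. Qed.

Let pos_borel l : real_linear l -> mx_borel (pos l).
Proof.
move=> hl d T A mA; apply: measurable_maxr => //; exact: (real_linear_borel hl mA).
Qed.

Let neg_borel l : real_linear l -> mx_borel (neg l).
Proof.
move=> hl d T A mA; apply: measurable_maxr => //; apply: measurableT_comp => //.
exact: (real_linear_borel hl mA).
Qed.

Let posneg l X : l X = pos l X - neg l X.
Proof. by rewrite /pos /neg; case: (ltrP 0 (l X)); case: (ltrP 0 (- l X)); lra. Qed.

Let nu_posneg x l : summable_from x -> real_linear l ->
  [/\ nu_mx x (pos l) \is a fin_num, nu_mx x (neg l) \is a fin_num &
      (nu_mx x (pos l) - nu_mx x (neg l) = (l (green_mx x))%:E)%E].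
Proof.
move=> Sx hl; rewrite -nu_mx_real_linear//.
have [h1 h2 h3] := nu_int_real_posneg (measurable_hol_fun (real_linear_borel hl)) (summable_real_linear Sx hl).
exact: And3 h1 h2 (esym h3).
Qed.

Lemma measurable_Q x l : real_linear l -> measurable_fun setT (fun s : R => l (Q x s)).
Proof.
move=> hl; apply: continuous_measurable_fun => s.
apply: differentiable_continuous; apply/derivable1_diffP.
by have [] := Q_derive x s hl.
Qed.

Lemma integral_edge x e l : x \notin well G -> src e = x -> summable_from x -> real_linear l ->
  (\int[@exp_law R]_s nu_mx (tgt e) (fun X => pos l (Q x s *m Te e *m X)) < +oo)%E ->
  (\int[@exp_law R]_s nu_mx (tgt e) (fun X => neg l (Q x s *m Te e *m X)) < +oo)%E ->
  (@exp_law R).-integrable setT (fun s => (l (Q x s *m (Te e *m green_mx (tgt e))))%:E) /\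
  (\int[@exp_law R]_s (l (Q x s *m (Te e *m green_mx (tgt e))))%:E =
   \int[@exp_law R]_s nu_mx (tgt e) (fun X => pos l (Q x s *m Te e *m X)) -
   \int[@exp_law R]_s nu_mx (tgt e) (fun X => neg l (Q x s *m Te e *m X)))%E.
Proof.
move=> xW ex Sx hl.
have Se := summable_neighbor xW ex Sx.
have hls s : real_linear (fun X => l (Q x s *m Te e *m X)) by exact: real_linear_mull.
pose jp s := nu_mx (tgt e) (fun X => pos l (Q x s *m Te e *m X)).
pose jn s := nu_mx (tgt e) (fun X => neg l (Q x s *m Te e *m X)).
have mjp : measurable_fun setT (jp : measurableTypeR R -> \bar R).
  exact: measurable_nu_mx_cons ex (pos_borel hl) (pos_ge0 l).
have mjn : measurable_fun setT (jn : measurableTypeR R -> \bar R).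
  exact: measurable_nu_mx_cons ex (neg_borel hl) (neg_ge0 l).
have jp0 s : (0 <= jp s)%E by apply: nu_mx_ge0 => X; exact: pos_ge0.
have jn0 s : (0 <= jn s)%E by apply: nu_mx_ge0 => X; exact: neg_ge0.
have E s : ((l (Q x s *m (Te e *m green_mx (tgt e))))%:E = jp s - jn s)%E.
  have [_ _ h] := nu_posneg Se (hls s).
  by rewrite mulmxA; exact: esym.
move=> ip iN; exact: (integral_of_posneg mjp mjn jp0 jn0 ip iN E).
Qed.

(** The first-step decomposition for functionals, obtained by subtracting those of
    the positive and negative parts, all terms of which are finite. *)
Lemma green_integral x l : x \notin well G -> summable_from x -> real_linear l ->
  (@exp_law R).-integrable setT (fun s => (l (Q x s *m step_mx x))%:E) /\
  (\int[@exp_law R]_s (l (Q x s *m step_mx x))%:E = (l (green_mx x))%:E)%E.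
Proof.
move=> xW Sx hl.
have [fp fn <-] := nu_posneg Sx hl.
have fp' : (nu_mx x (pos l) < +oo)%E by move: fp; rewrite fin_numE => /andP[_]; rewrite ltey.
have fn' : (nu_mx x (neg l) < +oo)%E by move: fn; rewrite fin_numE => /andP[_]; rewrite ltey.
have [cp ep] := first_step_lty xW (pos_borel hl) (pos_ge0 l) fp'.
have [cn en] := first_step_lty xW (neg_borel hl) (neg_ge0 l) fn'.
have hedge e (ex : src e = x) := integral_edge xW ex Sx hl (ep e ex) (en e ex).
have first_pos := nu_mx_first_step xW (pos_borel hl) (pos_ge0 l).
have first_neg := nu_mx_first_step xW (neg_borel hl) (neg_ge0 l).
set c := (if x == y then _ else _) in cp cn first_pos first_neg *.
have hQ : measurable_fun setT (fun s : measurableTypeR R => l (Q x s)) by exact: measurable_Q.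
have mp : measurable_fun setT (fun s : measurableTypeR R => (c * pos l (Q x s))%:E).
  by apply/measurable_EFinP; apply: measurable_funM => //; apply: measurable_maxr.
have mn : measurable_fun setT (fun s : measurableTypeR R => (c * neg l (Q x s))%:E).
  apply/measurable_EFinP; apply: measurable_funM => //; apply: measurable_maxr => //.
  exact: measurableT_comp.
have c0 : 0 <= c by have := lambdaV_ge0 y (x == y); rewrite lee_fin.
have Zp : (\int[@exp_law R]_s (c * pos l (Q x s))%:E = c%:E * \int[@exp_law R]_s (pos l (Q x s))%:E)%E.
  under eq_integral do rewrite EFinM; rewrite ge0_integralZl//.
    by apply/measurable_EFinP; apply: measurable_maxr.
  by move=> s _; rewrite lee_fin; exact: pos_ge0.
have Zn : (\int[@exp_law R]_s (c * neg l (Q x s))%:E = c%:E * \int[@exp_law R]_s (neg l (Q x s))%:E)%E.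
  under eq_integral do rewrite EFinM; rewrite ge0_integralZl//.
    apply/measurable_EFinP; apply: measurable_maxr => //; exact: measurableT_comp.
  by move=> s _; rewrite lee_fin; exact: neg_ge0.
have [it et] : (@exp_law R).-integrable setT (fun s => (c * l (Q x s))%:E) /\
    (\int[@exp_law R]_s (c * l (Q x s))%:E = c%:E * \int[@exp_law R]_s (pos l (Q x s))%:E -
      c%:E * \int[@exp_law R]_s (neg l (Q x s))%:E)%E.
  rewrite -Zp -Zn in cp cn *; apply: (integral_of_posneg mp mn _ _ cp cn).
  - by move=> s; rewrite lee_fin mulr_ge0//; exact: pos_ge0.
  - by move=> s; rewrite lee_fin mulr_ge0//; exact: neg_ge0.
  - by move=> s; rewrite -EFinB -mulrBr -posneg.
have [jp Ep] : exists jp : edge G -> R, forall e, src e = x ->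
    (\int[@exp_law R]_s nu_mx (tgt e) (fun X => pos l (Q x s *m Te e *m X)) = (jp e)%:E)%E.
  exists (fun e => fine (\int[@exp_law R]_s nu_mx (tgt e) (fun X => pos l (Q x s *m Te e *m X)))%E).
  move=> e ex; rewrite fineK// ge0_fin_numE; first exact: ep.
  by apply: integral_ge0 => s _; apply: nu_mx_ge0 => X; exact: pos_ge0.
have [jn En] : exists jn : edge G -> R, forall e, src e = x ->
    (\int[@exp_law R]_s nu_mx (tgt e) (fun X => neg l (Q x s *m Te e *m X)) = (jn e)%:E)%E.
  exists (fun e => fine (\int[@exp_law R]_s nu_mx (tgt e) (fun X => neg l (Q x s *m Te e *m X)))%E).
  move=> e ex; rewrite fineK// ge0_fin_numE; first exact: en.
  by apply: integral_ge0 => s _; apply: nu_mx_ge0 => X; exact: neg_ge0.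
have hJ e : src e = x ->
    (\int[@exp_law R]_s (l (Q x s *m (Te e *m green_mx (tgt e))))%:E = (jp e)%:E - (jn e)%:E)%E.
  move=> ex; apply: (etrans (hedge e ex).2).
  exact: (congr2 (fun a b => a - b)%E (Ep e ex) (En e ex)).
have lE s : ((l (Q x s *m step_mx x))%:E = (c * l (Q x s))%:E +
    \sum_(e : edge G | src e == x) (jump_prob e)%:E * (l (Q x s *m (Te e *m green_mx (tgt e))))%:E)%E.
  rewrite /step_mx -/c mulmxDr hl.1 -scalemxAr hl.2 mulmx1 EFinD; congr (_ + _)%E.
  rewrite mulmx_sumr real_linear_sum// -sumEFin; apply: eq_bigr => e _.
  by rewrite -scalemxAr hl.2 EFinM.
have iS : (@exp_law R).-integrable setT (fun s => \sum_(e : edge G | src e == x)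
    (jump_prob e)%:E * (l (Q x s *m (Te e *m green_mx (tgt e))))%:E)%E.
  apply: integrable_sum => // e /eqP ex; apply: integrableZl => //.
  exact: (hedge e ex).1.
have -> : (fun s => (l (Q x s *m step_mx x))%:E) = (fun s => (c * l (Q x s))%:E +
    \sum_(e : edge G | src e == x) (jump_prob e)%:E * (l (Q x s *m (Te e *m green_mx (tgt e))))%:E)%E.
  by apply/funext.
split; first exact: integrableD.
rewrite integralD// et.
have -> : (\int[@exp_law R]_s \sum_(e : edge G | src e == x)
      (jump_prob e)%:E * (l (Q x s *m (Te e *m green_mx (tgt e))))%:E =
    (\sum_(e : edge G | src e == x) jump_prob e * (jp e - jn e))%:E)%E.
  under eq_integral do rewrite big_mkcond.
  rewrite integral_sum//; last first.
    move=> e; case: eqP => [ex|_]; last exact: integrable0.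
    by apply: integrableZl => //; exact: (hedge e ex).1.
  rewrite -sumEFin [RHS]big_mkcond; apply: eq_bigr => e _.
  case: eqP => [ex|_]; last exact: integral0.
  rewrite integralZl//; last exact: (hedge e ex).1.
  by rewrite (hJ e ex).
have Sp : (\sum_(e : edge G | src e == x) (jump_prob e)%:E *
    \int[@exp_law R]_s nu_mx (tgt e) (fun X => pos l (Q x s *m Te e *m X)) =
    (\sum_(e : edge G | src e == x) jump_prob e * jp e)%:E)%E.
  by rewrite -sumEFin; apply: eq_bigr => e /eqP ex; rewrite (Ep e ex).
have Sn : (\sum_(e : edge G | src e == x) (jump_prob e)%:E *
    \int[@exp_law R]_s nu_mx (tgt e) (fun X => neg l (Q x s *m Te e *m X)) =
    (\sum_(e : edge G | src e == x) jump_prob e * jn e)%:E)%E.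
  by rewrite -sumEFin; apply: eq_bigr => e /eqP ex; rewrite (En e ex).
have {}first_pos := etrans first_pos (congr1 (fun z => _ + z)%E Sp).
have {}first_neg := etrans first_neg (congr1 (fun z => _ + z)%E Sn).
rewrite first_pos first_neg.
have cpf : (c%:E * \int[@exp_law R]_s (pos l (Q x s))%:E)%E \is a fin_num.
  by rewrite ge0_fin_numE// mule_ge0// integral_ge0// => s _; rewrite lee_fin; exact: pos_ge0.
have cnf : (c%:E * \int[@exp_law R]_s (neg l (Q x s))%:E)%E \is a fin_num.
  by rewrite ge0_fin_numE// mule_ge0// integral_ge0// => s _; rewrite lee_fin; exact: neg_ge0.
rewrite -(fineK cpf) -(fineK cnf) -!EFinB -!EFinD; congr EFin.
under eq_bigr do rewrite mulrBr.
by rewrite sumrB; ring.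
Qed.

(** By [green_integral] the Green matrix is the Laplace transform at 1 of
    [Q x s *m step_mx x]. Since [Q x] has derivative [- H x *m Q x], applying
    [1 + H x] inside the integral makes the integrand an exact derivative, whose
    integral is the value at time zero, [step_mx x]. *)
Lemma green_equation x : x \notin well G -> summable_from x ->
  green_mx x + H x *m green_mx x = step_mx x.
Proof.
move=> xW Sx; set A := step_mx x.
apply/matrixP => i j; apply: scal_partP => c.
pose l (X : M) : R := scal_part c (X i j).
have hl : real_linear l by exact: real_linear_part.
pose lH X := l (H x *m X).
have hlH : real_linear lH by exact: real_linear_mull.
pose l' X := l (X + H x *m X).
have l'E X : l' X = l X + lH X by rewrite /l' hl.1.
have hl' : real_linear l'.
  by split=> [X Y|a X]; rewrite !l'E ?hl.1 ?hlH.1 ?hl.2 ?hlH.2 ?mulrDr// addrACA.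
have [i1 _] := green_integral xW Sx hl.
have [i2 e2] := green_integral xW Sx hl'.
pose u (s : R) : R := l (Q x s *m A).
pose v (s : R) : R := lH (Q x s *m A).
have du (s : R) : is_derive s (1 : R) u (- v s).
  have -> : v s = l (H x *m Q x s *m A) by rewrite /v /lH mulmxA.
  exact: (Q_derive x s (real_linear_mulr A hl)).
have cQ l0 : real_linear l0 -> continuous (fun s : R => l0 (Q x s)).
  move=> hl0 s; apply: differentiable_continuous; apply/derivable1_diffP.
  by have [] := Q_derive x s hl0.
have cu : continuous u by exact: (cQ _ (real_linear_mulr A hl)).
have cv : continuous v by exact: (cQ _ (real_linear_mulr A hlH)).
have uvE : (fun s => (l' (Q x s *m A))%:E) = (fun s => (u s + v s)%:E).
  by apply/funext => s; rewrite l'E.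
rewrite uvE in i2 e2.
have E := integral_exp_law_derive du cu cv i1 i2.
have E' : (l' (green_mx x))%:E = (u 0)%:E by apply: (etrans (esym e2)); exact: E.
by move: E' => []; rewrite /u Q0 mul1mx.
Qed.

Lemma green_well w : w \in well G -> y \notin well G -> green_mx w = 0.
Proof.
move=> wW yW.
have nu0 f : mx_borel f -> (forall X, 0 <= f X) -> nu_mx w f = 0%E.
  move=> mf f0; apply: (nu_int_well (measurable_hol_efun mf) _ wW yW) => g.
  by rewrite lee_fin.
have Sw : summable_from w.
  rewrite /summable_from nu0 ?ltry//; first exact: mx_norm1_borel.
  by move=> X; exact: mx_norm1_ge0.
apply/matrixP => i j; apply: scal_partP => c.
have hl := @real_linear_part R k r r c i j.
have [_ _] := nu_posneg Sw hl.
rewrite (nu0 _ (pos_borel hl) (pos_ge0 _)) (nu0 _ (neg_borel hl) (neg_ge0 _)) sube0.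
by case=> <-; rewrite mxE scal_part0.
Qed.

End multiplicative_functional.

(** * The Green section of the holonomy *)

Section holonomy_green.
Variables (R : realType) (G : wgraph R) (k : scal_kind) (r : nat).
Variables (F : bundle G k r) (h : connection F) (H : potential F) (y : vert G).
Hypothesis yW : y \notin well G.
Local Notation K := (scal R k).
Local Notation M := 'M[K]_r.
Local Notation U := (hol_inv h H).

Definition hol_summable (x : vert G) : Prop := summable_from U y x.

Definition hol_green (x : vert G) : M := green_mx U y x.

Let Q0 (x : vert G) : flow H x 0 = 1%:M.
Proof. exact: expflow0. Qed.

Let Q_derive (x : vert G) (l : M -> R) (s : R) : real_linear l ->
  is_derive s (1 : R) (fun s => l (flow H x s)) (- l (H x *m flow H x s)).
Proof.
move=> hl; have E : - l (H x *m flow H x s) = l ((- H x) *m flow H x s).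
  rewrite mulNmx; have := hl.1 (H x *m flow H x s) (- (H x *m flow H x s)).
  by rewrite subrr (real_linear0 hl) => h0; apply/esym/eqP; rewrite -addr_eq0 addrC -h0.
rewrite E; exact: (is_derive_expflow (- H x) s hl).
Qed.

Let Q_near1 (x : vert G) := expflow_near1 (- H x).

Lemma hol_summable_neighbor x e : x \notin well G -> src e = x ->
  hol_summable x -> hol_summable (tgt e).
Proof.
exact: (summable_neighbor (mx_measurable_hol_inv h H) (fun e => transport_unit h (einv e))
  (@hol_inv_trivial _ _ _ _ _ h H) (@hol_inv_cons _ _ _ _ _ h H) Q_near1).
Qed.

Lemma hol_green_equation x : x \notin well G -> hol_summable x ->
  hol_green x + H x *m hol_green x =
  scal_of k (if x == y then (lambda y)^-1 else 0) *: 1%:M +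
  \sum_(e : edge G | src e == x)
     scal_of k (jump_prob e) *: (transport h (einv e) *m hol_green (tgt e)).
Proof.
exact: (green_equation (mx_measurable_hol_inv h H) (fun e => transport_unit h (einv e))
  (@hol_inv_trivial _ _ _ _ _ h H) (@hol_inv_cons _ _ _ _ _ h H) Q0 Q_derive Q_near1).
Qed.

Lemma hol_green_well w : w \in well G -> hol_green w = 0.
Proof. by move=> wW; exact: (green_well (mx_measurable_hol_inv h H) wW yW). Qed.

Lemma hol_green_real_linear x l : hol_summable x -> real_linear l ->
  nu_int x y (fun g => (l (hol_inv h H g))%:E) = (l (hol_green x))%:E.
Proof.
exact: (nu_mx_real_linear (mx_measurable_hol_inv h H)).
Qed.

Lemma hol_summable_parts x :
  (forall i j c, nu_int x y (fun g => (`|scal_part c (hol_inv h H g i j)|)%:E) < +oo)%E ->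
  hol_summable x.
Proof.
move=> fin; rewrite /hol_summable /summable_from /nu_mx.
have mU : mx_measurable U by exact: mx_measurable_hol_inv.
move: (U) mU fin => V mV fin.
have mp c i j : measurable_fun setT (fun g => `|scal_part c (V g i j)|).
  by apply: measurableT_comp => //; exact: mV.
rewrite ge0_nu_intE; last 2 first.
- exact: (@mx_norm1_borel R k r r _ _ _ mV).
- by move=> g; exact: mx_norm1_ge0.
pose part i j c p := (nu_weight y p * `|scal_part c (V (cp_restr p.1 p.2) i j)|)%:E.
have fin' i j c : (\int[(walk x \x lebesgue_measure)%E]_p part i j c p < +oo)%E.
  have := fin i j c; rewrite ge0_nu_intE//; exact: mp.
have mpart i j c : measurable_fun setT (part i j c).
  by have := measurable_nu_real y (mp c i j).
have part0 i j c p : (0 <= part i j c p)%E.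
  by rewrite lee_fin mulr_ge0// nu_weight_ge0.
have E p : ((nu_weight y p * mx_norm1 (V (cp_restr p.1 p.2)))%:E =
    \sum_i \sum_j \sum_c part i j c p)%E.
  rewrite /mx_norm1 mulr_sumr -sumEFin; apply: eq_bigr => i _.
  rewrite mulr_sumr -sumEFin; apply: eq_bigr => j _.
  by rewrite mulr_sumr -sumEFin.
rewrite (eq_integral _ _ (fun p _ => E p)).
rewrite ge0_integral_sum//; last 2 first.
- by move=> i; apply: emeasurable_sum => j; apply: emeasurable_sum => c.
- by move=> i p _; apply: sume_ge0 => j _; apply: sume_ge0 => c _.
apply: lte_sum_pinfty => i _; rewrite ge0_integral_sum//; last 2 first.
- by move=> j; apply: emeasurable_sum => c.
- by move=> j p _; apply: sume_ge0 => c _.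
apply: lte_sum_pinfty => j _; rewrite ge0_integral_sum//.
by apply: lte_sum_pinfty => c _.
Qed.

Lemma hol_summable_src e : src e \notin well G -> tgt e \notin well G ->
  hol_summable (tgt e) -> hol_summable (src e).
Proof.
move=> _ tW S; rewrite -(tgt_einv e); apply: (hol_summable_neighbor tW _ S).
by rewrite -(einvK e) tgt_einv einvK.
Qed.

(** The value zero away from the vertices where the integral converges is
    harmless: these vertices form a union of connected components of the graph of
    proper vertices, and the operator does not mix such components. *)
Definition green_sec (u : 'cV[K]_r) (x : vert G) : 'cV[K]_r :=
  if (x \notin well G) && `[<hol_summable x>] then hol_green x *m u else 0.

(** Where the integral converges this is [green_equation] applied to [u]: the
    Green matrix vanishes on the well, so that the neighbours in the well drop out.
    Elsewhere the section vanishes at [x] and at all its neighbours, and [x] can be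
    [y] only if the integral diverges at [y]. *)
Lemma green_sec_equation u x : x \notin well G ->
  laplacian h (green_sec u) x + H x *m green_sec u x =
  if (x == y) && `[<hol_summable y>] then scal_of k (lambda y)^-1 *: u else 0.
Proof.
move=> xW; rewrite /laplacian (negbTE xW) addrAC.
have [Sx|nSx] := pselect (hol_summable x).
  have fx : green_sec u x = hol_green x *m u by rewrite /green_sec xW asboolT.
  rewrite fx mulmxA -mulmxDl hol_green_equation// mulmxDl mulmx_suml.
  rewrite -addrA [X in _ + X](_ : _ = 0); last first.
    apply/eqP; rewrite subr_eq0; apply/eqP; apply: eq_bigr => e /eqP ex.
    rewrite /green_sec; have [tW|tW] := boolP (tgt e \in well G) => /=.
      by rewrite (hol_green_well tW) !mulmx0 !scaler0 mul0mx.
    rewrite asboolT; last exact: (hol_summable_neighbor xW ex Sx).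
    by rewrite mulr1 -scalemxAl mulmxA.
  rewrite addr0 -scalemxAl mul1mx.
  by case: eqP => [<-|_]; [rewrite asboolT|rewrite /= scal_of0 scale0r].
have fx : green_sec u x = 0 by rewrite /green_sec asboolF// andbF.
rewrite fx mulmx0 addr0 add0r big1 ?oppr0.
  by case: eqP => [<-|//]; rewrite asboolF.
move=> e /eqP ex; rewrite /green_sec; have [tW|tW] := boolP (tgt e \in well G) => /=.
  by rewrite mulmx0 scaler0.
rewrite asboolF ?mulmx0 ?scaler0// => St; apply: nSx; rewrite -ex.
by apply: hol_summable_src => //; rewrite ex.
Qed.

End holonomy_green.

(** * Quadratic forms on sections *)

Section dot_theory.
Variables (R : realType) (k : scal_kind) (r : nat) (d : inner_product R k r).
Local Notation K := (scal R k).
Implicit Types (u v w : 'cV[K]_r).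

Definition rdot u v : R := scal_re (d u v).

Lemma scal_reD (a b : K) : scal_re (a + b) = scal_re a + scal_re b.
Proof. by case: k a b => //= -[? ?] [? ?]. Qed.

Lemma scal_reZ (a : R) (z : K) : scal_re (scal_of k a * z) = a * scal_re z.
Proof. by case: k z => //= -[? ?] /=; rewrite mul0r subr0. Qed.

Lemma scal_re0 : scal_re (0 : K) = 0.
Proof. by case: k. Qed.

Lemma scal_re_sum (I : Type) (s : seq I) (P : pred I) (f : I -> K) :
  scal_re (\sum_(i <- s | P i) f i) = \sum_(i <- s | P i) scal_re (f i).
Proof. by apply: big_morph; [exact: scal_reD|exact: scal_re0]. Qed.

Lemma rdotC u v : rdot u v = rdot v u.
Proof. by rewrite /rdot (dot_conj d u v); case: k (d u v) => //= -[]. Qed.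

Lemma dot0r u : d u 0 = 0.
Proof.
have := dot_linear d u 1 0 0; rewrite scaler0 addr0 mul1r => /eqP.
by rewrite -subr_eq subrr eq_sym => /eqP.
Qed.

Lemma dotZr u (a : K) v : d u (a *: v) = a * d u v.
Proof. by have := dot_linear d u a v 0; rewrite dot0r !addr0. Qed.

Lemma dotDr u v w : d u (v + w) = d u v + d u w.
Proof. by have := dot_linear d u 1 v w; rewrite scale1r mul1r. Qed.

Lemma rdot_real_linear u : real_linear (rdot u).
Proof.
split=> [v w|a v]; rewrite /rdot; first by rewrite dotDr scal_reD.
by rewrite dotZr scal_reZ.
Qed.

Lemma rdot0r u : rdot u 0 = 0. Proof. exact: real_linear0 (rdot_real_linear u). Qed.

Lemma rdot0l u : rdot 0 u = 0. Proof. by rewrite rdotC rdot0r. Qed.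

End dot_theory.

Lemma real_linearN (R : realType) k m n (l : 'M[scal R k]_(m, n) -> R) A :
  real_linear l -> l (- A) = - l A.
Proof.
move=> hl; apply/eqP; rewrite -addr_eq0 -hl.1 addNr; apply/eqP; exact: real_linear0.
Qed.

Section section_forms.
Variables (R : realType) (G : wgraph R) (k : scal_kind) (r : nat).
Variables (F : bundle G k r) (h : connection F) (H : potential F).
Local Notation K := (scal R k).
Local Notation section := (vert G -> 'cV[K]_r).
Implicit Types (f g : section).

Definition vanishing f := forall x, x \in well G -> f x = 0.

Lemma re_sec_dot f g : scal_re (sec_dot F f g) = \sum_x lambda x * rdot (vdot F x) (f x) (g x).
Proof. by rewrite scal_re_sum; apply: eq_bigr => x _; rewrite scal_reZ. Qed.

Lemma transport_isometry e u v :
  vdot F (tgt e) (transport h e *m u) (transport h e *m v) = vdot F (src e) u v.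
Proof. by rewrite /transport -!mulmxA conn_out_isometry conn_in_isometry. Qed.

Lemma transport_einvK e (v : 'cV[K]_r) : transport h e *m (transport h (einv e) *m v) = v.
Proof.
have cin : conn_in h (einv e) = invmx (conn_out h e).
  by have := conn_einv h (einv e); rewrite einvK => ->; rewrite invmxK.
rewrite /transport conn_einv cin -!mulmxA mulKVmx ?conn_in_unit//.
by rewrite mulKVmx// conn_out_unit.
Qed.

Lemma rdot_transport e u v :
  rdot (vdot F (src e)) u (transport h (einv e) *m v) =
  rdot (vdot F (tgt e)) v (transport h e *m u).
Proof. by rewrite [RHS]rdotC /rdot -transport_isometry transport_einvK. Qed.

Lemma src_einv (e : edge G) : src (einv e) = tgt e.
Proof. by rewrite -tgt_einv einvK. Qed.

(** Since the sections vanish on the well, the indicator in the Laplacian may be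
    dropped, and [lambda x * jump_prob e = chi e] turns the second term into a sum
    over all edges which is visibly invariant under reversal. *)
Lemma re_sec_dot_laplacian f g : vanishing f -> vanishing g ->
  scal_re (sec_dot F f (laplacian h g)) =
  \sum_x lambda x * rdot (vdot F x) (f x) (g x) -
  \sum_(e : edge G) chi e *
     rdot (vdot F (src e)) (f (src e)) (transport h (einv e) *m g (tgt e)).
Proof.
move=> f0 g0; rewrite re_sec_dot.
rewrite [X in _ - X](partition_big (@src G) predT)//= -sumrB; apply: eq_bigr => x _.
have [xW|xW] := boolP (x \in well G).
  rewrite f0// !rdot0l !mulr0 big1 ?subr0// => e /eqP ->.
  by rewrite f0// rdot0l mulr0.
have hl := rdot_real_linear (vdot F x) (f x).
rewrite /laplacian (negbTE xW) hl.1 mulrDr real_linearN// mulrN; congr (_ - _).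
rewrite real_linear_sum// mulr_sumr; apply: eq_bigr => e /eqP ex.
rewrite hl.2 mulrA ex; have [tW|tW] := boolP (tgt e \in well G) => /=.
  by rewrite g0// mulmx0 rdot0r !mulr0.
by rewrite mulr1 /jump_prob ex mulrCA divff ?mulr1// gt_eqF// lambda_gt0.
Qed.

(** Reverse the edges: transports are isometries, and the transport along the
    reversed edge is the inverse. *)
Lemma laplacian_sym f g : vanishing f -> vanishing g ->
  scal_re (sec_dot F f (laplacian h g)) = scal_re (sec_dot F g (laplacian h f)).
Proof.
move=> f0 g0; rewrite !re_sec_dot_laplacian//; congr (_ - _).
  by apply: eq_bigr => x _; rewrite rdotC.
rewrite [RHS](reindex_inj (inv_inj (@einvK G))); apply: eq_bigr => e _.
by rewrite chi_einv einvK tgt_einv src_einv rdot_transport.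
Qed.

Lemma pot_sec_sym f g :
  scal_re (sec_dot F f (pot_sec H g)) = scal_re (sec_dot F g (pot_sec H f)).
Proof.
rewrite !re_sec_dot; apply: eq_bigr => x _.
by rewrite [in RHS]rdotC /rdot pot_selfadjoint.
Qed.

Lemma laplacianD f g x :
  laplacian h (fun z => f z + g z) x = laplacian h f x + laplacian h g x.
Proof.
rewrite /laplacian; case: ifP => _; first by rewrite addr0.
rewrite addrACA -opprD -big_split/=; congr (_ - _).
by apply: eq_bigr => e _; rewrite mulmxDr scalerDr.
Qed.

Lemma laplacianZ a f x :
  laplacian h (fun z => scal_of k a *: f z) x = scal_of k a *: laplacian h f x.
Proof.
rewrite /laplacian; case: ifP => _; first by rewrite scaler0.
rewrite scalerBr scaler_sumr; congr (_ - _).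
by apply: eq_bigr => e _; rewrite -scalemxAr !scalerA mulrC.
Qed.

End section_forms.

Section bilinear_matrix.
Variables (R : realType) (n : nat) (b : 'rV[R]_n -> 'rV[R]_n -> R).
Hypothesis bC : forall u v, b u v = b v u.
Hypothesis bD : forall u v w, b u (v + w) = b u v + b u w.
Hypothesis bZ : forall u a v, b u (a *: v) = a * b u v.

Definition gram : 'M[R]_n := \matrix_(i, j) b (delta_mx 0 i) (delta_mx 0 j).

Lemma gram_sym : gram^T = gram.
Proof. by apply/matrixP => i j; rewrite !mxE bC. Qed.

Lemma bform_gram u v : bform gram u v = b u v.
Proof.
have b0 w : b w 0 = 0 by rewrite -(scale0r (0 : 'rV_n)) bZ mul0r.
have bs w (c : 'I_n -> R) : b w (\sum_i c i *: delta_mx 0 i) = \sum_i c i * b w (delta_mx 0 i).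
  rewrite (big_morph (b w) (bD w) (b0 w)); apply: eq_bigr => i _; exact: bZ.
rewrite [in RHS](row_sum_delta v) bs /bform mxE; apply: eq_bigr => j _.
rewrite !mxE [RHS]mulrC; congr (_ * _).
rewrite bC [in RHS](row_sum_delta u) bs; apply: eq_bigr => i _.
by rewrite mxE bC.
Qed.

End bilinear_matrix.

Lemma bform_add (R : realType) n (P Q : 'M[R]_n) u v :
  bform (P + Q) u v = bform P u v + bform Q u v.
Proof. by rewrite /bform mulmxDr mulmxDl mxE. Qed.

Section coordinates.
Variables (R : realType) (G : wgraph R) (k : scal_kind) (r : nat).
Local Notation K := (scal R k).
Local Notation dim := (Omega0_dim G k r).
Implicit Types (u v : 'rV[R]_dim).

(** [Omega0_of] as a linear map on row vectors, extended by zero to the well. *)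
Definition sec_of u (x : vert G) : 'cV[K]_r :=
  if insub x is Some p then
    \col_i scal_mk (fun c : scal_coord k => u 0 (enum_rank ((p, i, c) : Omega0_coord G k r)))
  else 0.

Definition coords_of (f : vert G -> 'cV[K]_r) : 'rV[R]_dim :=
  \row_a let: (p, i, c) := (enum_val a : Omega0_coord G k r) in scal_part c (f (val p) i 0).

Lemma sec_Omega0_of (t : dim.-tuple (measurableTypeR R)) :
  sec (Omega0_of t) = sec_of (row_of_tuple t).
Proof.
apply/funext => x; rewrite /sec /sec_of; case: insubP => // p _ _.
by rewrite ffunE; apply/colP => i; rewrite !mxE; congr scal_mk; apply/funext => c; rewrite mxE.
Qed.

Lemma sec_of_vanishing u : vanishing (sec_of u).
Proof. by move=> x xW; rewrite /sec_of insubN// negbK. Qed.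

Lemma coords_ofK f : vanishing f -> sec_of (coords_of f) = f.
Proof.
move=> f0; apply/funext => x; rewrite /sec_of; case: insubP => [p _ px|/negPn xW]; last by rewrite f0.
apply/colP => i; rewrite mxE; apply: scal_partP => c.
by rewrite scal_part_mk mxE enum_rankK -px.
Qed.

Lemma sec_ofD u v x : sec_of (u + v) x = sec_of u x + sec_of v x.
Proof.
rewrite /sec_of; case: insubP => [p _ _|_]; last by rewrite addr0.
apply/colP => i; rewrite !mxE; apply: scal_partP => c.
by rewrite scal_partD !scal_part_mk mxE.
Qed.

Lemma sec_ofZ a u x : sec_of (a *: u) x = scal_of k a *: sec_of u x.
Proof.
rewrite /sec_of; case: insubP => [p _ _|_]; last by rewrite scaler0.
apply/colP => i; rewrite !mxE; apply: scal_partP => c.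
by rewrite scal_partZ !scal_part_mk mxE.
Qed.

Lemma sec_of_real_linear (l : 'cV[K]_r -> R) x : real_linear l ->
  exists c : 'rV[R]_dim, forall u, l (sec_of u x) = (u *m c^T) 0 0.
Proof.
move=> hl; exists (\row_a l (sec_of (delta_mx 0 a) x)) => u.
have l0 : l (sec_of (0 : 'rV_dim) x) = 0.
  by rewrite -(scale0r (0 : 'rV_dim)) sec_ofZ hl.2 mul0r.
rewrite [in LHS](row_sum_delta u).
rewrite (@big_morph _ _ (fun v => l (sec_of v x)) 0 +%R 0 +%R)//.
  rewrite mxE; apply: eq_bigr => a _; by rewrite sec_ofZ hl.2 !mxE.
by move=> v w; rewrite sec_ofD hl.1.
Qed.

End coordinates.

(** * Covariance for the weighted Gaussian measure *)

Section gaussian_represent.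
Variables (R : realType) (n : nat) (Q : 'M[R]_n).
Hypotheses (Qsym : Q^T = Q) (Qunit : Q \in unitmx).

(** Linear forms are represented by vectors, the form being nondegenerate. *)
Lemma bform_represent (c : 'rV[R]_n) : exists v, forall u, bform Q u v = (u *m c^T) 0 0.
Proof.
exists (c *m invmx Q) => u.
by rewrite /bform trmx_mul trmx_inv Qsym -mulmxA mulKVmx.
Qed.

Lemma bform_nondegenerate (v : 'rV[R]_n) : (forall u, bform Q u v = 0) -> v = 0.
Proof.
move=> v0; rewrite -[v](mulmxK Qunit) (_ : v *m Q = 0) ?mul0mx//.
apply/rowP => i; have := v0 (delta_mx 0 i); rewrite (bformC Qsym) /bform.
rewrite mxE (bigD1 i)//= big1; last first.
  by move=> j ji; rewrite !mxE eqxx/= (negbTE ji) mulr0.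
by rewrite !mxE !eqxx mulr1 addr0.
Qed.

End gaussian_represent.

Section field_form.
Variables (R : realType) (G : wgraph R) (k : scal_kind) (r : nat).
Variables (F : bundle G k r) (h : connection F) (H : potential F).
Local Notation K := (scal R k).
Local Notation dim := (Omega0_dim G k r).
Local Notation tup := (dim.-tuple (measurableTypeR R)).
Implicit Types (u v w : 'rV[R]_dim).

Definition laplacian_form u v : R := scal_re (sec_dot F (sec_of u) (laplacian h (sec_of v))).

Definition potential_form u v : R := scal_re (sec_dot F (sec_of u) (pot_sec H (sec_of v))).

(** The matrix of the quadratic form in the exponent of the product of both
    weights. *)
Definition field_mx : 'M[R]_dim := gram laplacian_form + gram potential_form.

Let lapC u v : laplacian_form u v = laplacian_form v u.
Proof. by apply: laplacian_sym; exact: sec_of_vanishing. Qed.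

Let lapD u v w : laplacian_form u (v + w) = laplacian_form u v + laplacian_form u w.
Proof.
rewrite /laplacian_form !re_sec_dot -big_split/=; apply: eq_bigr => x _.
rewrite -mulrDr -(rdot_real_linear _ _).1 -laplacianD.
by have -> : sec_of (v + w) = fun z => sec_of v z + sec_of w z by apply/funext => z; rewrite sec_ofD.
Qed.

Let lapZ u a v : laplacian_form u (a *: v) = a * laplacian_form u v.
Proof.
rewrite /laplacian_form !re_sec_dot mulr_sumr; apply: eq_bigr => x _.
rewrite [RHS]mulrCA -[in RHS](rdot_real_linear _ _).2 -laplacianZ.
by have -> : sec_of (a *: v) = fun z => scal_of k a *: sec_of v z by apply/funext => z; rewrite sec_ofZ.
Qed.

Let potC u v : potential_form u v = potential_form v u.
Proof. exact: pot_sec_sym. Qed.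

Let potD u v w : potential_form u (v + w) = potential_form u v + potential_form u w.
Proof.
rewrite /potential_form !re_sec_dot -big_split/=; apply: eq_bigr => x _.
by rewrite /pot_sec sec_ofD mulmxDr (rdot_real_linear _ _).1 mulrDr.
Qed.

Let potZ u a v : potential_form u (a *: v) = a * potential_form u v.
Proof.
rewrite /potential_form !re_sec_dot mulr_sumr; apply: eq_bigr => x _.
by rewrite /pot_sec sec_ofZ -scalemxAr (rdot_real_linear _ _).2 mulrCA.
Qed.

Lemma laplacian_gram_sym : (gram laplacian_form)^T = gram laplacian_form.
Proof. exact: (gram_sym lapC). Qed.

Lemma potential_gram_sym : (gram potential_form)^T = gram potential_form.
Proof. exact: (gram_sym potC). Qed.

Lemma field_mx_sym : field_mx^T = field_mx.
Proof.
have E (A B : 'M[R]_dim) : A^T = A -> B^T = B -> (A + B)^T = A + B.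
  by move=> {2}<- {2}<-; rewrite linearD.
exact: (E _ _ laplacian_gram_sym potential_gram_sym).
Qed.

Lemma bform_field u v : bform field_mx u v =
  \sum_x lambda x * rdot (vdot F x) (sec_of u x)
    (laplacian h (sec_of v) x + H x *m sec_of v x).
Proof.
rewrite /field_mx bform_add (bform_gram lapC lapD lapZ) (bform_gram potC potD potZ).
rewrite /laplacian_form /potential_form.
rewrite !re_sec_dot -big_split/=; apply: eq_bigr => x _.
by rewrite (rdot_real_linear _ _).1 mulrDr.
Qed.

Lemma gauss_weightE (t : tup) : gauss_weight h (Omega0_of t) = gweight (gram laplacian_form) t.
Proof. by rewrite /gauss_weight /gweight (bform_gram lapC lapD lapZ) sec_Omega0_of. Qed.

Lemma pot_weightE (t : tup) : pot_weight H (Omega0_of t) = gweight (gram potential_form) t.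
Proof. by rewrite /pot_weight /gweight (bform_gram potC potD potZ) sec_Omega0_of. Qed.

Lemma field_weightE (t : tup) :
  pot_weight H (Omega0_of t) * gauss_weight h (Omega0_of t) = gweight field_mx t.
Proof.
rewrite gauss_weightE pot_weightE /gweight -expRD; congr expR.
by rewrite /field_mx bform_add; lra.
Qed.

End field_form.

Section covariance.
Variables (R : realType) (G : wgraph R) (k : scal_kind) (r : nat).
Variables (F : bundle G k r) (h : connection F) (H : potential F) (x y : vert G).
Hypotheses (xW : x \notin well G) (yW : y \notin well G).
Hypothesis Sx : hol_summable h H y x.
Local Notation K := (scal R k).
Local Notation dim := (Omega0_dim G k r).
Local Notation tup := (dim.-tuple (measurableTypeR R)).
Local Notation mu := (mpow (@lebesgue_measure R) dim).
Local Notation Q := (field_mx h H).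
Local Notation S := (hol_summable h H y).
Hypothesis wint : mu.-integrable setT (EFin \o gweight Q).

Let Qsym : Q^T = Q := field_mx_sym h H.
Let Qunit : Q \in unitmx := gaussian_unit Qsym wint.

(* Restriction to the vertices at which the integral of the holonomy diverges. It
   commutes with the Laplacian and the potential, as these vertices form a union
   of components of the graph of proper vertices. *)
Let cut (f : vert G -> 'cV[K]_r) (z : vert G) : 'cV[K]_r := if `[<S z>] then 0 else f z.

Let cut_vanishing u : vanishing (cut (sec_of u)).
Proof. by move=> z zW; rewrite /cut sec_of_vanishing// if_same. Qed.

Let bform_cut u v : bform Q u (coords_of (cut (sec_of v))) = bform Q (coords_of (cut (sec_of u))) v.
Proof.
rewrite !bform_field !coords_ofK//; apply: eq_bigr => z _; congr (_ * _).
have [zW|zW] := boolP (z \in well G).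
  by rewrite (cut_vanishing u zW) (sec_of_vanishing u zW) !rdot0l.
rewrite /laplacian (negbTE zW).
have nb e : src e = z -> tgt e \notin well G -> `[<S (tgt e)>] = `[<S z>].
  move=> ez tW; apply/asboolP/asboolP => Sz.
    by rewrite -ez; apply: (hol_summable_src _ tW Sz); rewrite ez.
  exact: (hol_summable_neighbor zW ez Sz).
rewrite (eq_bigr (fun e => scal_of k (jump_prob e * (tgt e \notin well G)%:R) *:
    (transport h (einv e) *m (if `[<S z>] then 0 else sec_of v (tgt e))))); last first.
  move=> e /eqP ez; congr (_ *: (_ *m _)); rewrite /cut.
  have [tW|tW] := boolP (tgt e \in well G); first by rewrite sec_of_vanishing// !if_same.
  by rewrite nb.
rewrite /cut; case: ifP => _ //.
rewrite mulmx0 addr0 rdot0l big1 ?subr0 ?rdot0r// => e _.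
by rewrite mulmx0 scaler0.
Qed.

(* The integral of the holonomy converges at [x]; a form of the value at [x] is
   represented by a section which vanishes wherever it diverges. *)
Let represent_supported v (l : 'cV[K]_r -> R) : real_linear l ->
  (forall u, bform Q u v = l (sec_of u x)) -> ~ S y -> sec_of v y = 0.
Proof.
move=> hl lv nSy; have cut0 : coords_of (cut (sec_of v)) = 0.
  apply: (bform_nondegenerate Qsym Qunit) => u.
  rewrite bform_cut lv coords_ofK// /cut asboolT//; exact: real_linear0.
have := coords_ofK (cut_vanishing v); rewrite cut0 => /(congr1 (@^~ y)) /=.
rewrite /cut asboolF// => <-.
have := sec_ofZ 0 (0 : 'rV[R]_dim) y; by rewrite scale0r scal_of0 scale0r.
Qed.

Let bform_green u a : bform Q u (coords_of (green_sec h H y a)) =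
  if `[<S y>] then rdot (vdot F y) (sec_of u y) a else 0.
Proof.
have gv : vanishing (green_sec h H y a) by move=> z zW; rewrite /green_sec zW.
rewrite bform_field coords_ofK// (bigD1 y)//= green_sec_equation// eqxx/=.
rewrite big1 ?addr0; last first.
  move=> z zy; have [zW|zW] := boolP (z \in well G).
    by rewrite sec_of_vanishing// rdot0l mulr0.
  by rewrite green_sec_equation// (negbTE zy)/= rdot0r mulr0.
case: ifP => _; last by rewrite rdot0r mulr0.
by rewrite (rdot_real_linear _ _).2 mulrA divff ?mul1r// gt_eqF// lambda_gt0.
Qed.

(** Let [v] represent the form [l] of the value at [x]. The covariance of the two
    linear forms is the pairing of [v(y)] with [a]. If the integral of the holonomy
    converges from [y], this pairing is the value of the form represented by [v] at
    the Green section of [a], because the Green section represents the pairing at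
    [y] with [a]. Otherwise [v(y)] and the image of the Green section both vanish. *)
Lemma field_covariance (l : 'cV[K]_r -> R) (a : 'cV[K]_r) : real_linear l ->
  let f t := gweight Q t *
    (l (sec_of (row_of_tuple t) x) * rdot (vdot F y) (sec_of (row_of_tuple t) y) a) in
  mu.-integrable setT (EFin \o f) /\
  (\int[mu]_t (f t)%:E = (l (hol_green h H y x *m a))%:E * \int[mu]_t (gweight Q t)%:E)%E.
Proof.
move=> hl f; have [c lc] := sec_of_real_linear x hl.
have hr : real_linear (rdot (vdot F y) a) by exact: rdot_real_linear.
have [c' lc'] := sec_of_real_linear y hr.
have [v hv] := bform_represent Qsym Qunit c; have [v' hv'] := bform_represent Qsym Qunit c'.
have lv u : bform Q u v = l (sec_of u x) by rewrite hv lc.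
have rv u : bform Q u v' = rdot (vdot F y) (sec_of u y) a by rewrite hv' -lc' rdotC.
have [i e] := gaussian_covariance Qsym wint v v'.
have fE : (fun t => (gweight Q t * (bform Q (row_of_tuple t) v * bform Q (row_of_tuple t) v'))%:E)
    = EFin \o f.
  by apply/funext => t; rewrite /f /= lv rv.
rewrite fE in i; split => //.
have -> : l (hol_green h H y x *m a) = bform Q v v'.
  have := bform_green v a; rewrite (bformC Qsym) lv coords_ofK; last first.
    by move=> z zW; rewrite /green_sec zW.
  rewrite /green_sec xW asboolT//= => ->; rewrite rv; case: ifPn => // /asboolPn nSy.
  by rewrite (represent_supported hl lv nSy) rdot0l.
by rewrite -e; apply: eq_integral => t _; rewrite /f lv rv.
Qed.

End covariance.

(** * The law of the Gaussian field *)

Section law_of_field.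
Variables (R : realType) (G : wgraph R) (k : scal_kind) (r : nat).
Variables (F : bundle G k r) (h : connection F).
Context (d : measure_display) (T : measurableType d) (Pr : probability T R).
Variable Phi : {RV Pr >-> Omega0 G k r}.
Hypothesis law_Phi : forall A : set (Omega0 G k r), measurable A ->
  distribution Pr Phi A = gauss_law h A.
Local Notation dim := (Omega0_dim G k r).
Local Notation tup := (dim.-tuple (measurableTypeR R)).
Local Notation mu := (mpow (@lebesgue_measure R) dim).
Local Notation Omega := (Omega0 G k r).
Local Notation coord := (@Omega0_of R G k r).

Lemma measurable_Omega0 d' (T' : measurableType d') (f : Omega -> T') :
  measurable_fun setT (f \o coord) -> measurable_fun setT f.
Proof.
move=> mf _ A mA; rewrite setTI.
by have := mf measurableT A mA; rewrite setTI.
Qed.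

Lemma measurable_gauss_weight : measurable_fun setT (@gauss_weight R G k r F h).
Proof.
apply: measurable_Omega0.
have -> : gauss_weight h \o coord = gweight (gram (laplacian_form h)).
  by apply/funext => t; exact: gauss_weightE.
exact: (measurable_gweight (laplacian_gram_sym h)).
Qed.

Let Z : R := fine (\int[@Omega0_lebesgue R G k r]_f (gauss_weight h f)%:E).

Definition gauss_density (f : Omega) : R := gauss_weight h f * Z^-1.

(** With a zero or infinite integral the normalised measure would be zero, whereas
    the law of the field has mass 1. *)
Lemma gauss_mass_gt0 : 0 < Z.
Proof.
have : gauss_law h setT = 1%E by rewrite -law_Phi// probability_setT.
rewrite /gauss_law -/Z; set A := (\int[_]_(_ in _) _)%E.
have A0 : (0 <= A)%E by apply: integral_ge0 => f _; rewrite lee_fin expR_ge0.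
rewrite /Z -/A; case: A A0 => [a|_|//] /=; last first.
  by rewrite invr0 mule0 => /eqP; rewrite eq_sym onee_eq0.
rewrite lee_fin le_eqVlt => /orP[/eqP <-|//].
by rewrite mul0e => /eqP; rewrite eq_sym onee_eq0.
Qed.

Let gauss_density_ge0 f : 0 <= gauss_density f.
Proof. by rewrite mulr_ge0 ?expR_ge0// invr_ge0 ltW// gauss_mass_gt0. Qed.

Let measurable_gauss_density : measurable_fun setT gauss_density.
Proof. by apply: measurable_funM => //; exact: measurable_gauss_weight. Qed.

Lemma law_density (A : set Omega) : measurable A ->
  distribution Pr Phi A = (\int[@Omega0_lebesgue R G k r]_(f in A) (gauss_density f)%:E)%E.
Proof.
move=> mA; rewrite law_Phi// /gauss_law -/Z.
under [RHS]eq_integral do rewrite EFinM.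
rewrite ge0_integralZr//.
- by apply/measurable_EFinP; apply: measurable_funTS; exact: measurable_gauss_weight.
- by move=> f _; rewrite lee_fin expR_ge0.
- by rewrite lee_fin invr_ge0 ltW// gauss_mass_gt0.
Qed.

(** Transfer to the law of the field, then to its density, then to the real
    coordinates. *)
Lemma ge0_integral_field (f : Omega -> \bar R) :
  measurable_fun setT (f \o coord) -> (forall a, 0 <= f a)%E ->
  (\int[Pr]_om f (Phi om) = \int[mu]_t (f (coord t) * (gauss_density (coord t))%:E))%E.
Proof.
move=> mf' f0; have mf := measurable_Omega0 mf'.
rewrite -(ge0_integral_distribution Phi mf f0).
rewrite (ge0_integral_density measurable_gauss_density gauss_density_ge0 law_density mf f0).
have mfg : measurable_fun setT (fun a => f a * (gauss_density a)%:E)%E.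
  by apply: emeasurable_funM => //; apply/measurable_EFinP.
apply: (ge0_integral_pushforward (@measurable_Omega0_of R G k r) mu measurableT mfg).
by move=> a _; apply: mule_ge0; [exact: f0|rewrite lee_fin; exact: gauss_density_ge0].
Qed.

Lemma integral_field (f : Omega -> R) :
  measurable_fun setT (f \o coord) ->
  (\int[Pr]_om (f (Phi om))%:E = \int[mu]_t (f (coord t) * gauss_density (coord t))%:E)%E.
Proof.
move=> mf; rewrite [LHS]integralE [RHS]integralE.
have mf1 : measurable_fun setT (fun t => f (coord t)) by [].
have mp : measurable_fun setT (fun t => (Num.max (f (coord t)) 0)%:E).
  by apply/measurable_EFinP; apply: measurable_maxr.
have mn : measurable_fun setT (fun t => (Num.max (- f (coord t)) 0)%:E).
  by apply/measurable_EFinP; apply: measurable_maxr => //; exact: measurableT_comp.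
have p0 (a : R) : (0 <= (Num.max a 0)%:E)%E by rewrite lee_fin le_max lexx orbT.
congr (_ - _)%E.
- have := @ge0_integral_field (fun a => (Num.max (f a) 0)%:E) mp (fun a => p0 _).
  rewrite (_ : (fun om => (Num.max (f (Phi om)) 0)%:E) = (fun om => (f (Phi om))%:E)^\+%E); last first.
    by apply/funext => om; rewrite funeposE/= EFin_max.
  move=> ->; apply: eq_integral => t _.
  by rewrite funeposE/= -EFinM -EFin_max maxr_pMl// mul0r.
- have := @ge0_integral_field (fun a => (Num.max (- f a) 0)%:E) mn (fun a => p0 _).
  rewrite (_ : (fun om => (Num.max (- f (Phi om)) 0)%:E) = (fun om => (f (Phi om))%:E)^\-%E); last first.
    by apply/funext => om; rewrite funenegE/= EFin_max.
  move=> ->; apply: eq_integral => t _.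
  by rewrite funenegE/= -EFinM -EFin_max maxr_pMl// mul0r mulNr.
Qed.

Lemma integrable_field (f : Omega -> R) : measurable_fun setT (f \o coord) ->
  Pr.-integrable setT (fun om => (f (Phi om))%:E) <->
  mu.-integrable setT (fun t => (f (coord t) * gauss_density (coord t))%:E).
Proof.
move=> mf.
have mn : measurable_fun setT (fun t => `|f (coord t)|%:E).
  by apply/measurable_EFinP; exact: (measurableT_comp (@normr_measurable _ _) mf).
have e : (\int[Pr]_om `|(f (Phi om))%:E| =
    \int[mu]_t `|(f (coord t) * gauss_density (coord t))%:E|)%E.
  rewrite (@ge0_integral_field (fun a => `|f a|%:E) mn)//; apply: eq_integral => t _.
  by rewrite /= -EFinM normrM (ger0_norm (gauss_density_ge0 _)).
have m1 : measurable_fun setT (fun om => f (Phi om)).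
  exact: (measurableT_comp (measurable_Omega0 mf)).
have m2 : measurable_fun setT (fun t => f (coord t) * gauss_density (coord t)).
  have md := measurableT_comp measurable_gauss_density (@measurable_Omega0_of R G k r).
  exact: (measurable_funM mf md).
split=> /integrableP[_ fin]; apply/integrableP; split.
- exact/measurable_EFinP.
- by rewrite -e.
- exact/measurable_EFinP.
- by rewrite e.
Qed.

End law_of_field.

(** * The isomorphism *)

Section scalar_product.
Variables (R : realType) (k : scal_kind).
Local Notation K := (scal R k).

(** The basis of the scalars over the reals in which [scal_part] gives the
    coordinates. *)
Definition scal_unit : scal_coord k -> K :=
  match k with
  | Euclidean => fun=> 1
  | Hermitian => fun c => if c then Complex 0 1 else 1
  end.

Lemma scal_unit_conj c : scal_unit c * scal_conj (scal_unit c) = 1.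
Proof.
rewrite /scal_unit; case: k c => [c|[]] /=; first by rewrite mulr1.
- by apply/eqP; rewrite eq_complex/= !mul0r !mulr0 !mul1r sub0r opprK addr0 !eqxx.
- by apply/eqP; rewrite eq_complex/= oppr0 !mulr0 !mulr1 subr0 addr0 !eqxx.
Qed.

(** The first factor enters through real parts and the second one through a
    coordinate, so that the Hermitian case reduces to covariances of real-linear
    forms. *)
Lemma scal_partM c (z1 z2 : K) : scal_part c (z1 * z2) =
  \sum_c' scal_re (scal_conj (scal_unit c') * z1) * scal_part c (scal_unit c' * z2).
Proof.
rewrite /scal_unit; case: k c z1 z2 => [[]|c] /= z1 z2.
  by rewrite (big_pred1 tt) ?mul1r//; case.
case: z1 z2 => [a b] [a' b'].
by rewrite big_bool/=; case: c => /=; ring.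
Qed.

End scalar_product.

Section field_functionals.
Variables (R : realType) (G : wgraph R) (k : scal_kind) (r : nat).
Variables (F : bundle G k r) (h : connection F) (H : potential F).
Local Notation K := (scal R k).
Local Notation dim := (Omega0_dim G k r).
Local Notation tup := (dim.-tuple (measurableTypeR R)).

Lemma measurable_sec_functional (l : 'cV[K]_r -> R) (x : vert G) : real_linear l ->
  measurable_fun setT (fun t : tup => l (sec_of (row_of_tuple t) x)).
Proof.
move=> hl; have [c lc] := sec_of_real_linear x hl.
under eq_fun do rewrite lc mxE.
apply: measurable_sum => a; apply: measurable_funM; last exact: measurable_cst.
by under eq_fun do rewrite mxE; exact: measurable_tnth.
Qed.

Lemma measurable_pot_weight : measurable_fun setT (fun t : tup => pot_weight H (Omega0_of t)).
Proof.
under eq_fun do rewrite pot_weightE.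
exact: (measurable_gweight (potential_gram_sym H)).
Qed.

End field_functionals.

Section moments.
Variables (R : realType) (G : wgraph R) (k : scal_kind) (r : nat).
Variables (F : bundle G k r) (h : connection F) (H : potential F).
Context (d : measure_display) (T : measurableType d) (Pr : probability T R).
Variable Phi : {RV Pr >-> Omega0 G k r}.
Hypothesis law_Phi : forall A : set (Omega0 G k r), measurable A ->
  distribution Pr Phi A = gauss_law h A.
Hypothesis weight_integrable :
  Pr.-integrable setT (fun om => (pot_weight H (Phi om))%:E).
Variables (x y : vert G).
Hypotheses (xW : x \notin well G) (yW : y \notin well G).
Hypothesis Sx : hol_summable h H y x.
Local Notation K := (scal R k).
Local Notation dim := (Omega0_dim G k r).
Local Notation tup := (dim.-tuple (measurableTypeR R)).
Local Notation mu := (mpow (@lebesgue_measure R) dim).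
Local Notation Q := (field_mx h H).

Let Z : R := fine (\int[@Omega0_lebesgue R G k r]_f (gauss_weight h f)%:E).

Let Z0 : Z != 0.
Proof. by rewrite gt_eqF//; exact: (gauss_mass_gt0 law_Phi). Qed.

Let weight_densityE (t : tup) :
  pot_weight H (Omega0_of t) * gauss_density h (Omega0_of t) = gweight Q t * Z^-1.
Proof.
by rewrite [X in _ * X](_ : _ = gauss_weight h (Omega0_of t) * Z^-1)// mulrA field_weightE.
Qed.

Let wint : mu.-integrable setT (EFin \o gweight Q).
Proof.
have mw := measurable_pot_weight H.
have h1 := (integrable_field law_Phi mw).1 weight_integrable.
have h2 := integrableZl measurableT Z h1.
apply: eq_integrable h2; first exact: measurableT.
by move=> t _; rewrite weight_densityE -EFinM mulrCA divff// mulr1.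
Qed.

Lemma weighted_moment (l : 'cV[K]_r -> R) (a : 'cV[K]_r) : real_linear l ->
  let f om := pot_weight H (Phi om) *
    (l (sec (Phi om) x) * rdot (vdot F y) (sec (Phi om) y) a) in
  Pr.-integrable setT (EFin \o f) /\
  (\int[Pr]_om (f om)%:E =
   (l (hol_green h H y x *m a))%:E * \int[Pr]_om (pot_weight H (Phi om))%:E)%E.
Proof.
move=> hl.
pose f0 (o : Omega0 G k r) : R := pot_weight H o *
    (l (sec o x) * rdot (vdot F y) (sec o y) a).
pose q (t : tup) : R := l (sec_of (row_of_tuple t) x) * rdot (vdot F y) (sec_of (row_of_tuple t) y) a.
have f0E t : f0 (Omega0_of t) = pot_weight H (Omega0_of t) * q t.
  by rewrite /f0 sec_Omega0_of.
have mq : measurable_fun setT q.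
  apply: measurable_funM; first exact: measurable_sec_functional.
  under eq_fun do rewrite rdotC.
  by apply: measurable_sec_functional; exact: rdot_real_linear.
have mf0 : measurable_fun setT (f0 \o @Omega0_of R G k r).
  have -> : f0 \o @Omega0_of R G k r = fun t => pot_weight H (Omega0_of t) * q t.
    by apply/funext => t; exact: f0E.
  exact: (measurable_funM (measurable_pot_weight H) mq).
have [i e] := field_covariance xW yW Sx wint a hl.
have fdE t : (f0 (Omega0_of t) * gauss_density h (Omega0_of t))%:E =
    (Z^-1%:E * (gweight Q t * q t)%:E)%E.
  by rewrite f0E mulrAC weight_densityE -EFinM; congr EFin; ring.
split.
  apply: (integrable_field law_Phi mf0).2.
  have h2 := integrableZl measurableT Z^-1 i.
  apply: eq_integrable h2; first exact: measurableT.
  by move=> t _; rewrite fdE.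
apply: (etrans (integral_field law_Phi mf0)).
rewrite (integral_field law_Phi (measurable_pot_weight H)).
under eq_integral do rewrite fdE.
under [in RHS]eq_integral do rewrite weight_densityE mulrC EFinM.
by rewrite !integralZl// e muleCA.
Qed.

End moments.

Section tensor_moment.
Variables (R : realType) (G : wgraph R) (k : scal_kind) (r : nat).
Variables (F : bundle G k r) (h : connection F) (H : potential F).
Context (d : measure_display) (T : measurableType d) (Pr : probability T R).
Variable Phi : {RV Pr >-> Omega0 G k r}.
Hypothesis law_Phi : forall A : set (Omega0 G k r), measurable A ->
  distribution Pr Phi A = gauss_law h A.
Hypothesis weight_integrable :
  Pr.-integrable setT (fun om => (pot_weight H (Phi om))%:E).
Variables (x y : vert G).
Hypotheses (xW : x \notin well G) (yW : y \notin well G).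
Hypothesis Sx : hol_summable h H y x.
Local Notation K := (scal R k).

(** Multiplying the pairing by the conjugate of a unit [c'] amounts to multiplying
    its second argument, and the unit in the other factor cancels it after the
    covariance has been computed. Hence all units give the same contribution. *)
Lemma tensor_moment i j c :
  let f om := scal_part c ((scal_of k (pot_weight H (Phi om)) *:
      tensor F y (sec (Phi om) x) (sec (Phi om) y)) i j) in
  Pr.-integrable setT (EFin \o f) /\
  (\int[Pr]_om (f om)%:E =
   ((scal_dim k)%:R * scal_part c (hol_green h H y x i j))%:E *
    \int[Pr]_om (pot_weight H (Phi om))%:E)%E.
Proof.
move=> f.
pose l c' (v : 'cV[K]_r) : R := scal_part c (scal_unit R c' * v i 0).
pose a c' : 'cV[K]_r := scal_conj (scal_unit R c') *: delta_mx j 0.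
have hl c' : real_linear (l c').
  split=> [v w|b v]; rewrite /l mxE; first by rewrite mulrDr scal_partD.
  by rewrite mulrCA scal_partZ.
pose q c' om : R := pot_weight H (Phi om) *
  (l c' (sec (Phi om) x) * rdot (vdot F y) (sec (Phi om) y) (a c')).
have fE om : f om = \sum_c' q c' om.
  rewrite /f !mxE scal_partZ scal_partM mulr_sumr; apply: eq_bigr => c' _.
  by rewrite /q /rdot dotZr [X in _ * X]mulrC.
have hq c' := weighted_moment law_Phi weight_integrable xW yW Sx (a c') (hl c').
have EE om : ((f om)%:E = \sum_c' (q c' om)%:E)%E by rewrite fE sumEFin.
have fEE : EFin \o f = (fun om => \sum_c' (q c' om)%:E)%E by apply/funext => om; exact: EE.
have iq c' : Pr.-integrable setT (fun om => (q c' om)%:E) by exact: (hq c').1.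
split; first by rewrite fEE; apply: integrable_sum => // c' _; exact: iq.
under eq_integral do rewrite EE.
rewrite integral_sum//.
have wfin : (\int[Pr]_om (pot_weight H (Phi om))%:E)%E \is a fin_num.
  exact: (integrable_fin_num measurableT weight_integrable).
have lE c' : l c' (hol_green h H y x *m a c') = scal_part c (hol_green h H y x i j).
  rewrite /l /a; move: (hol_green h H y x) => A.
  by rewrite -scalemxAr -colE !mxE mulrA scal_unit_conj mul1r.
rewrite (eq_bigr (fun=> (scal_part c (hol_green h H y x i j))%:E *
    \int[Pr]_om (pot_weight H (Phi om))%:E)%E); last first.
  by move=> c' _; rewrite -(lE c'); exact: (hq c').2.
rewrite -(fineK wfin) -!EFinM sumEFin; congr EFin.
by rewrite sumr_const -[#|_|]/(scal_dim k) -mulrA mulr_natl.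
Qed.

End tensor_moment.

Theorem theorem5p1 (R : realType) (G : wgraph R) (k : scal_kind) (r : nat)
    (F : bundle G k r) (h : connection F) (H : potential F)
    (d : measure_display) (T : measurableType d) (Pr : probability T R)
    (Phi : {RV Pr >-> Omega0 G k r})
    (law_Phi : forall A : set (Omega0 G k r), measurable A ->
       distribution Pr Phi A = gauss_law h A)
    (x y : vert G) (x_proper : x \notin well G) (y_proper : y \notin well G)
    (weight_integrable :
       Pr.-integrable setT (fun om => (pot_weight H (Phi om))%:E))
    (hol_integrable : forall (i j : 'I_r) (c : scal_coord k),
       (nu_int x y
         (fun g => (`|scal_part c (hol h H (cp_inv g) i j)|)%:E) < +oo)%E) :
  let E (f : T -> \bar R) : \bar R := (\int[Pr]_om f om)%E in
  let rhs (om : T) : 'M[scal R k]_r :=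
    scal_of k (pot_weight H (Phi om)) *:
      tensor F y (sec (Phi om) x) (sec (Phi om) y) in
  (forall (i j : 'I_r) (c : scal_coord k),
     Pr.-integrable setT (fun om => (scal_part c (rhs om i j))%:E)) /\
  (scal_dim k)%:R *:
    mx_int E (fun om => mx_int (nu_int x y) (fun g =>
      scal_of k (pot_weight H (Phi om)) *: hol h H (cp_inv g))) =
  mx_int E rhs.
Proof.
move=> E rhs.
have Sx : hol_summable h H y x.
  by apply: hol_summable_parts => i j c; exact: hol_integrable.
have moment i j c :=
  tensor_moment law_Phi weight_integrable x_proper y_proper Sx i j c.
split=> [i j c|]; first exact: (moment i j c).1.
apply/matrixP => i j; apply: scal_partP => c.
rewrite mxE -scal_of_nat scal_partZ !mxE !scal_part_mk.
pose p := scal_part c (hol_green h H y x i j).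
have -> : E (fun om => (scal_part c (rhs om i j))%:E) =
    (((scal_dim k)%:R * p)%:E *
      E (fun om => (pot_weight H (Phi om))%:E))%E by exact: (moment i j c).2.
have wfin : E (fun om => (pot_weight H (Phi om))%:E) \is a fin_num.
  exact: (integrable_fin_num measurableT weight_integrable).
have inner om : (scal_part c (mx_int (nu_int x y) (fun g =>
      scal_of k (pot_weight H (Phi om)) *: hol h H (cp_inv g)) i j))%:E =
    (p%:E * (pot_weight H (Phi om))%:E)%E.
  rewrite mxE scal_part_mk -EFinM; congr EFin.
  pose l (X : 'M[scal R k]_r) : R := scal_part c ((scal_of k (pot_weight H (Phi om)) *: X) i j).
  have lE X : l X = pot_weight H (Phi om) * scal_part c (X i j).
    by rewrite /l mxE scal_partZ.
  have hp := @real_linear_part R k r r c i j.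
  have hl : real_linear l.
    split=> [X Y|b X]; rewrite !lE; first by rewrite hp.1 mulrDr.
    by rewrite hp.2 mulrCA.
  have eq := hol_green_real_linear Sx hl.
  apply: (etrans (congr1 fine eq)).
  by rewrite /= lE mulrC.
have -> : E (fun om => (scal_part c (mx_int (nu_int x y) (fun g =>
      scal_of k (pot_weight H (Phi om)) *: hol h H (cp_inv g)) i j))%:E) =
    (p%:E * E (fun om => (pot_weight H (Phi om))%:E))%E.
  rewrite /E -integralZl//; apply: eq_integral => om _; exact: inner.
by rewrite -(fineK wfin) -!EFinM /= mulrA.
Qed.
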